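(* There exists a Banach space $JT_{\mathcal F_2}$ with a boundedly complete Schauder basis $(e_n)_{n\in\mathbb N}$ such that the following hold: (i) The space $JT_{\mathcal F_2}$ is $\ell_2$ saturated. (ii) The basis $(e_n)_n$ is normalized and weakly null, and for every infinite $M\subset\mathbb N$ the subspace $X_M=\overline{\mathrm{span}}\{e_n:\ n\in M\}$ has the (boundedly complete) James tree property.
   Context: A space is $\ell_2$ saturated if each of its infinite dimensional closed subspaces contains a subspace isomorphic to $\ell_2$. Let $\mathcal D$ be the dyadic tree, i.e. the set of finite sequences of $0$'s and $1$'s, ordered by $a\prec b$ iff $a$ is an initial part of $b$; $[\mathcal D]$ is the set of all infinite branches of $\mathcal D$; $\prec_{lex}$ is the lexicographical order of $\mathcal D$, i.e. the order of type $\omega$ (by length, then lexicographically), which is consistent with $\prec$. Let $X$ be a Banach space with a boundedly complete Schauder basis. A block subspace (closed span of a block sequence of the basis) $Y$ of $X$ has the (boundedly complete) James tree property if there exist a seminormalized family $(y_a)_{a\in\mathcal D}$ in $Y$ which, in the order $\prec_{lex}$, is a block sequence, a constant $c>0$, and a bounded family $(b^* )_{b\in[\mathcal D]}$ in $X^*$, such that for each $b=(a_1\prec a_2\prec\cdots)\in[\mathcal D]$ the sequence $(y_{a_n})_n$ is non-trivial weakly Cauchy (weakly Cauchy but not weakly convergent), $\lim_n b^*(y_{a_n})>c$, and $\lim_n b_1^*(y_{a_n})=0$ for all $b_1\in[\mathcal D]$, $b_1\neq b$. *)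

(* Defs.v *)
From HB Require Import structures.
From mathcomp Require Import all_boot all_order all_algebra.
From mathcomp Require Import all_classical all_reals all_analysis.

Set Implicit Arguments.
Unset Strict Implicit.
Unset Printing Implicit Defensive.

Import Order.TTheory GRing.Theory Num.Theory.
Import numFieldNormedType.Exports.

Local Open Scope classical_set_scope.
Local Open Scope ring_scope.

Definition linear_span (R : realType) (X : normedModType R) (A : set X) :
    set X :=
  [set x | exists (n : nat) (v : 'I_n -> X) (a : 'I_n -> R),
    (forall i, A (v i)) /\ x = \sum_(i < n) a i *: v i].

Definition closed_span (R : realType) (X : normedModType R) (A : set X) :
    set X :=
  closure (linear_span A).

Definition subspace (R : realType) (X : normedModType R) (Y : set X) : Prop :=
  submod_closed [in Y].

Definition finite_dimensional (R : realType) (X : normedModType R)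
    (Y : set X) : Prop :=
  exists2 A : set X, finite_set A & Y = linear_span A.

(* The real space ell_2, as L^2 of the counting measure on nat.  The elements
   of LfunType are functions, not classes; no quotient is needed since only
   the empty set is null for the counting measure. *)
Definition ell2 (R : realType) : lmodType R :=
  LfunType (@counting nat R) (lee1n 2).

Definition ell2_norm (R : realType) (u : ell2 R) : R :=
  fine ('N[@counting nat R]_2%:E [EFin \o (u : LfunType _ _)])%E.

Definition isomorphic_ell2 (R : realType) (X : normedModType R) (Z : set X) :
    Prop :=
  exists T : {linear ell2 R -> X}, range T = Z /\
    exists c C : R, [/\ 0 < c, 0 < C &
      forall u, c * ell2_norm u <= `|T u| <= C * ell2_norm u].

Definition ell2_saturated (R : realType) (X : normedModType R) : Prop :=
  forall Y : set X, subspace Y -> closed Y -> ~ finite_dimensional Y ->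
  exists2 Z : set X, Z `<=` Y & subspace Z /\ isomorphic_ell2 Z.

Definition weak_cvg (R : realType) (X : normedModType R) (u : nat -> X)
    (x : X) : Prop :=
  forall f : {linear X -> R^o}, continuous f ->
  (fun n => f (u n)) @ \oo --> f x.

Definition weakly_cauchy (R : realType) (X : normedModType R) (u : nat -> X) :
    Prop :=
  forall f : {linear X -> R^o}, continuous f ->
  cauchy ((fun n => f (u n)) @ \oo).

Definition nontrivial_weakly_cauchy (R : realType) (X : normedModType R)
    (u : nat -> X) : Prop :=
  weakly_cauchy u /\ ~ exists x, weak_cvg u x.

Definition schauder_basis (R : realType) (X : normedModType R) (e : nat -> X) :
    Prop :=
  forall x : X, exists! a : nat -> R, series (fun n => a n *: e n) @ \oo --> x.

Definition boundedly_complete (R : realType) (X : normedModType R)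
    (e : nat -> X) : Prop :=
  forall a : nat -> R,
    (exists K, forall n, `|series (fun n => a n *: e n) n| <= K) ->
  cvgn (series (fun n => a n *: e n)).

(* With I = nat and lt = ltn these are the block sequences of e.  A single
   coefficient sequence a serves all the blocks because their intervals
   [p i, q i) are pairwise disjoint when lt is total. *)
Definition block_family (R : realType) (X : normedModType R) (e : nat -> X)
    (I : Type) (lt : rel I) (y : I -> X) : Prop :=
  exists (p q : I -> nat) (a : nat -> R),
    (forall i, y i != 0 /\ y i = \sum_(p i <= k < q i) a k *: e k) /\
    (forall i j, lt i j -> (q i <= p j)%N).

Definition block_subspace (R : realType) (X : normedModType R) (e : nat -> X)
    (Y : set X) : Prop :=
  exists2 y : nat -> X, block_family e ltn y & Y = closed_span (range y).

Definition seminormalized (R : realType) (X : normedModType R) (I : Type)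
    (y : I -> X) : Prop :=
  exists m K : R, 0 < m /\ forall i, m <= `|y i| <= K.

(* Nodes of the dyadic tree are words over bool; this is the strict order of
   type omega on them: by length, then lexicographically. *)
Definition dyadic_lt (a b : seq bool) : bool :=
  (size a < size b)%N ||
  (size a == size b) && ((a : seqlexi bool) < (b : seqlexi bool))%O.

(* An infinite branch is given by its sequence of digits; branch_node b n is
   its node of length n, so that the branch starts at the root [::]. *)
Definition branch_node (b : nat -> bool) (n : nat) : seq bool := mkseq b n.

Definition james_tree_property (R : realType) (X : normedModType R)
    (e : nat -> X) (Y : set X) : Prop :=
  block_subspace e Y /\
  exists (y : seq bool -> X) (c : R)
         (bstar : (nat -> bool) -> {linear X -> R^o}),
    [/\ forall a, Y (y a),
        seminormalized y,
        block_family e dyadic_lt y,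
        0 < c &
    [/\ forall b, continuous (bstar b),
        exists K : R, forall b x, `|bstar b x| <= K * `|x| &
        forall b : nat -> bool,
        [/\ nontrivial_weakly_cauchy (fun n => y (branch_node b n)),
            exists2 l : R,
              (fun n => bstar b (y (branch_node b n))) @ \oo --> (l : R^o) &
              c < l &
            forall b1 : nat -> bool, b1 <> b ->
              (fun n => bstar b1 (y (branch_node b n))) @ \oo --> (0 : R^o)]]].

(* Main.v *)
Require Import Defs.
From HB Require Import structures.
From mathcomp Require Import all_boot all_order all_algebra.
From mathcomp Require Import all_classical all_reals all_analysis.
From mathcomp Require Import zify ring lra.

(* The norm is of James tree type.  A set A of naturals is cut into successive
   finite blocks, where the size and the weight of a block are functions of an
   injective code (its colour) of the part of A below the block.  A segment is
   the restriction of the resulting weighted sum of coordinates to an interval,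
   and the square of the norm of x is, up to a sup norm, the supremum of
   sum_i s_i(x)^2 over families of segments which are pairwise disjoint inside
   each colour.  Families living on successive intervals can be merged, which
   gives lower l2 estimates for block sequences, hence bounded completeness.

   Block sizes and weights grow so fast that blocks of different colours are
   almost orthogonal.  Any infinite M contains a dyadic tree of blocks whose
   branches are sets A as above; b^* is the functional of the branch b.  Along
   a branch, a signed sum of N differences has norm O(sqrt N), so that these
   differences tend weakly to 0.

   For saturation, block vectors on which all segments are uniformly small have
   almost orthogonal values under every family, and so span l2.  To find them
   in a given subspace, take normalized blocks x_l with small coordinates.
   Segments with different histories before x_l are compatible on x_l, hence
   only boundedly many histories lead to a segment which is large on x_l; along
   an ultrafilter they converge to finitely many sets B_r.  After passing to a
   subsequence, a segment follows some B_r until the last block on which it is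
   large, so the alternating sum of N of these blocks has bounded values on all
   segments while its norm is at least of order sqrt N. *)

(** The obstacle is that branches must occur inside every subsequence although the basis itself is
    weakly null. Hence the norming sets range over all sets of naturals instead of the branches of
    one fixed tree, and constant coefficients along a set are excluded, since they would make long
    sums of basis vectors too large. A set may use the coefficient of one colour at most
    [block_size] many times: in a long sum of unit vectors each colour then contributes little,
    while a block vector spread over a full block and rescaled still has value 1. Coding the whole
    past into the colour brings back a tree structure. Two sets can share a colour only as long as
    their pasts agree, and once they have split they may belong to the same family without
    restriction. This is used in opposite directions: against a fixed branch, a segment keeps the
    colours of the branch only on an interval and one block; against a fixed vector, many different
    pasts would give a large family, so few of them matter. *)

Set Implicit Arguments.
Unset Strict Implicit.
Unset Printing Implicit Defensive.

Import Order.TTheory GRing.Theory Num.Theory.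
Import numFieldNormedType.Exports.

Local Open Scope classical_set_scope.
Local Open Scope ring_scope.

(** * Trees and colours *)

(* Together with the coefficients 2 ^- (j + 1) ^ 2 below, these sizes give the
   near orthogonality of coef_ratio_gt and coef_ratio_lt. *)
Definition root_size (j : nat) : nat := (2 ^ (j + 2) ^ 3)%N.
Definition block_size (j : nat) : nat := (root_size j ^ 2)%N.
Arguments root_size : simpl never.
Arguments block_size : simpl never.

Lemma root_size_gt0 j : (0 < root_size j)%N.
Proof. by rewrite expn_gt0. Qed.

Lemma block_size_gt0 j : (0 < block_size j)%N.
Proof. by rewrite expn_gt0 root_size_gt0. Qed.

Definition below (A : pred nat) (u : nat) : seq nat := [seq k <- iota 0 u | A k].

(* [start A n] is the first position of the block of A in progress at n.  A block
   with history h := below A (start A n) is closed, and a new one is started, as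
   soon as it has block_size (pickle h) elements. *)
Fixpoint start (A : pred nat) (n : nat) : nat :=
  if n is n'.+1 then
    let u := start A n' in
    if (\sum_(u <= k < n) A k == block_size (pickle (below A u)))%N then n else u
  else 0.

Definition colour (A : pred nat) (n : nat) : nat := pickle (below A (start A n)).

Section Colours.
Implicit Types A : pred nat.

Lemma mem_below A u k : (k \in below A u) = (k < u)%N && A k.
Proof. by rewrite mem_filter mem_iota /= add0n andbC. Qed.

Lemma eq_below A A' u : (forall k, (k < u)%N -> A k = A' k) -> below A u = below A' u.
Proof. by move=> h; apply: eq_in_filter => k; rewrite mem_iota /= add0n; exact: h. Qed.

Lemma start_le A n : (start A n <= n)%N.
Proof. by elim: n => //= n IH; case: ifP => // _; rewrite leqW. Qed.

Lemma start_homo A n n' : (n <= n')%N -> (start A n <= start A n')%N.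
Proof.
elim: n' => [|n' IH]; first by rewrite leqn0 => /eqP->.
rewrite leq_eqVlt => /orP[/eqP->//|]; rewrite ltnS => /IH h /=.
case: ifP => // _; apply: leq_trans h _; exact: leqW (start_le _ _).
Qed.

Lemma start_idem A n : start A (start A n) = start A n.
Proof. by elim: n => //= n IH; case E: (_ == _) => //=; rewrite E. Qed.

Lemma start_between A n s : (start A n <= s)%N -> (s <= n)%N ->
  start A s = start A n.
Proof.
move=> h1 h2; apply/eqP; rewrite eqn_leq start_homo//=.
by rewrite -[X in (X <= _)%N]start_idem start_homo.
Qed.

Lemma block_lt A n : (\sum_(start A n <= k < n) A k < block_size (colour A n))%N.
Proof.
rewrite /colour; elim: n => [|n IH] /=; first by rewrite big_geq// block_size_gt0.
case: ifP => [_|/negbT]; first by rewrite big_geq// block_size_gt0.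
rewrite big_nat_recr ?start_le//= => h.
rewrite ltn_neqAle h/=; case: (A n); first by rewrite addn1.
by rewrite addn0 ltnW.
Qed.

(** By [block_lt] the count of a block in progress is strictly below its size, so a block can close
    only at an element of [A]. This lets a history reveal where it ends. *)
Lemma start_elem A n : (0 < start A n)%N -> A (start A n).-1.
Proof.
elim: n => //= n IH; case: ifP => // /eqP h _ /=.
move: h; rewrite big_nat_recr ?start_le//=; case: (A n) => //=.
by rewrite addn0 => h; move: (block_lt A n); rewrite h ltnn.
Qed.

Lemma eq_start A A' n : (forall k, (k < n)%N -> A k = A' k) ->
  start A n = start A' n.
Proof.
elim: n => //= n IH h.
have E : start A n = start A' n by apply: IH => k hk; apply: h; exact: ltnW.
have P : below A (start A n) = below A' (start A' n).
  rewrite E; apply: eq_below => k hk; apply: h.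
  by rewrite (leq_trans hk)// leqW// start_le.
rewrite P E.
suff -> : (\sum_(start A' n <= k < n.+1) A k = \sum_(start A' n <= k < n.+1) A' k)%N.
  by [].
by apply: eq_big_nat => k /andP[_ hk]; rewrite h.
Qed.

Lemma eq_colour A A' n : (forall k, (k < n)%N -> A k = A' k) -> colour A n = colour A' n.
Proof.
move=> h; rewrite /colour (eq_start h); congr pickle; apply: eq_below => k hk.
by apply: h; rewrite (leq_trans hk)// start_le.
Qed.

(** By [start_elem] the start is 0 or one more than the largest entry of the history, so the bare
    list determines the position as well as the set below it. *)
Lemma below_start_inj A A' n n' : below A (start A n) = below A' (start A' n') ->
  start A n = start A' n' /\
  forall k, (k < start A n)%N -> A k = A' k.
Proof.
move=> E.
have W (B B' : pred nat) m m' : below B (start B m) = below B' (start B' m') ->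
    (start B m <= start B' m')%N.
  move=> EB; case: (posnP (start B m)) => [->//|h].
  have : (start B m).-1 \in below B (start B m).
    by rewrite mem_below start_elem// prednK// leqnn.
  by rewrite EB mem_below => /andP[]; rewrite prednK.
have Es : start A n = start A' n' by apply/eqP; rewrite eqn_leq !W.
split=> // k hk.
have : (k \in below A (start A n)) = (k \in below A' (start A' n')) by rewrite E.
by rewrite !mem_below -Es hk.
Qed.

Lemma colour_inj A A' n n' : colour A n = colour A' n' ->
  start A n = start A' n' /\ forall k, (k < start A n)%N -> A k = A' k.
Proof. by move=> /(pcan_inj pickleK) /below_start_inj. Qed.

(* Contrapositive: sets with different histories at s share no colour after s. *)
Lemma eq_colour_back A A' n s : (s <= n)%N -> colour A n = colour A' n ->
  below A (start A s) = below A' (start A' s).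
Proof.
move=> sn /colour_inj[E h].
case: (leqP (start A n) s) => us.
  have E1 := start_between us sn.
  have E2 : start A' s = start A' n by apply: start_between => //; rewrite -E.
  by rewrite E1 E2 -E; apply: eq_below.
have h' k : (k < s)%N -> A k = A' k by move=> ks; apply: h; exact: ltn_trans us.
rewrite (eq_start h'); apply: eq_below => k hk; apply: h'.
by rewrite (leq_trans hk)// start_le.
Qed.

(** By [colour_inj] all positions of colour [j] have the same start, so they lie in a single block
    of [A], and [block_lt] applies to it. *)
Lemma colour_card A j q : (\sum_(0 <= k < q) (A k && (colour A k == j)) <= block_size j)%N.
Proof.
elim: q => [|q IH]; first by rewrite big_geq.
rewrite big_nat_recr//=; case: (boolP (A q && (colour A q == j))); last by rewrite addn0.
move=> /andP[Aq /eqP Ej].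
apply: leq_trans (_ : \sum_(start A q <= k < q) A k + 1 <= _)%N; last first.
  by rewrite addn1 -Ej block_lt.
rewrite leq_add2r (big_cat_nat (n := start A q))//= ?start_le//.
rewrite big_nat big1 ?add0n => [|k /andP[_ hk]]; last first.
  apply/eqP; rewrite eqb0 negb_and; apply/orP; right; apply/eqP => Ek.
  have [Es _] := colour_inj (etrans Ek (esym Ej)).
  by move: hk; rewrite -Es ltnNge start_le.
by apply: leq_sum => k _; case: (A k) => //=; exact: leq_b1.
Qed.

End Colours.

(** * Segments and compatible families *)

Section FiniteSums.
Variable R : realType.

Lemma cauchy_schwarz_sum (I : finType) (a b : I -> R) :
  (\sum_i a i * b i) ^+ 2 <= (\sum_i a i ^+ 2) * (\sum_i b i ^+ 2).
Proof.
rewrite -subr_ge0 -(@pmulr_rge0 _ 2)//.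
suff -> : 2 * ((\sum_i a i ^+ 2) * (\sum_i b i ^+ 2) - (\sum_i a i * b i) ^+ 2) =
    \sum_i \sum_j (a i * b j - a j * b i) ^+ 2.
  by apply: sumr_ge0 => i _; apply: sumr_ge0 => j _; exact: sqr_ge0.
have E1 : (\sum_i a i ^+ 2) * (\sum_i b i ^+ 2) =
    \sum_i \sum_j a i ^+ 2 * b j ^+ 2.
  by rewrite mulr_suml; apply: eq_bigr => i _; rewrite mulr_sumr.
have E2 : (\sum_i a i ^+ 2) * (\sum_i b i ^+ 2) =
    \sum_i \sum_j a j ^+ 2 * b i ^+ 2.
  by rewrite E1 exchange_big.
have E3 : (\sum_i a i * b i) ^+ 2 = \sum_i \sum_j (a i * b i) * (a j * b j).
  by rewrite expr2 mulr_suml; apply: eq_bigr => i _; rewrite mulr_sumr.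
rewrite mulrBr mulr2n mulrDl !mul1r {1}E1 E2 E3 [X in _ - X]mulrDl !mul1r.
rewrite -!big_split -sumrB; apply: eq_bigr => i _ /=.
by rewrite -!big_split -sumrB; apply: eq_bigr => j _ /=; ring.
Qed.

Lemma dual_sum_le (I : finType) (s : I -> R) (B : R) :
  (forall a : I -> R, \sum_i a i ^+ 2 <= 1 -> `|\sum_i a i * s i| <= B) ->
  \sum_i s i ^+ 2 <= B ^+ 2.
Proof.
move=> h; set T := \sum_i _.
have T0 : 0 <= T by apply: sumr_ge0 => i _; exact: sqr_ge0.
have [->|TN] := eqVneq T 0; first exact: sqr_ge0.
have Tp : 0 < T by rewrite lt_def TN.
have sT : 0 < Num.sqrt T by rewrite sqrtr_gt0.
(* The extremal vector of Cauchy-Schwarz: [s] divided by its Euclidean norm. *)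
have := h (fun i => s i / Num.sqrt T).
have -> : \sum_i (s i / Num.sqrt T) ^+ 2 = 1.
  under eq_bigr do rewrite expr_div_n sqr_sqrtr//.
  by rewrite -mulr_suml divff.
have -> : \sum_i s i / Num.sqrt T * s i = Num.sqrt T.
  under eq_bigr do rewrite mulrAC -expr2.
  by rewrite -mulr_suml -/T -{1}(sqr_sqrtr T0) expr2 mulfK ?gt_eqF.
move=> /(_ (lexx _)); rewrite (ger0_norm (ltW sT)) => hB.
by rewrite -(sqr_sqrtr T0) ler_sqr ?nnegrE ?(ltW sT)// (le_trans (ltW sT)).
Qed.

Lemma sum_dual_le (I : finType) (s a : I -> R) (B : R) : 0 <= B ->
  \sum_i s i ^+ 2 <= B ^+ 2 -> \sum_i a i ^+ 2 <= 1 ->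
  `|\sum_i a i * s i| <= B.
Proof.
move=> B0 hs ha; rewrite -(ger0_norm B0) -ler_sqr ?nnegrE//.
rewrite !real_normK ?num_real//; apply: le_trans (cauchy_schwarz_sum _ _) _.
apply: le_trans (_ : 1 * \sum_i s i ^+ 2 <= _); last by rewrite mul1r.
by apply: ler_wpM2r => //; apply: sumr_ge0 => i _; exact: sqr_ge0.
Qed.

Lemma sum_inj_le (I : finType) (P : pred I) (f : I -> nat) (F : nat -> R) J :
  (forall j, 0 <= F j) ->
  (forall i, P i -> (f i < J)%N) ->
  (forall i i', P i -> P i' -> f i = f i' -> i = i') ->
  \sum_(i | P i) F (f i) <= \sum_(0 <= j < J) F j.
Proof.
move=> F0 fJ inj.
have -> : \sum_(i | P i) F (f i) =
    \sum_(i | P i) \sum_(0 <= j < J | j == f i) F j.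
  apply: eq_bigr => i Pi; rewrite big_mkord (big_pred1 (Ordinal (fJ i Pi)))//.
rewrite (exchange_big_dep predT)//=; apply: ler_sum => j _.
have [[i /andP[Pi /eqP ji]]|hN] := pselect (exists i, P i && (j == f i)).
  rewrite (big_pred1 i)// => i' /=; apply/idP/eqP => [/andP[Pi' /eqP e]|->].
    by apply: inj => //; rewrite -e -ji.
  by rewrite Pi ji eqxx.
rewrite big1// => i h; exfalso; apply: hN; exists i; exact: h.
Qed.

End FiniteSums.

(** * Segments, families and norming functionals *)

Section Segments.
Variable R : realType.

(** With the quadratic exponent the ratio of two coefficients is [2^-((j-k)(j+k+2))], small in both
    colours at once as [coef_ratio_gt] requires; a linear exponent would give consecutive ratios of
    constant size. *)
Definition coef (j : nat) : R := 2^-1 ^+ ((j + 1) ^ 2)%N.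

Lemma coef_gt0 j : 0 < coef j.
Proof. by rewrite exprn_gt0// invr_gt0. Qed.

Lemma coef_ge0 j : 0 <= coef j. Proof. exact: ltW (coef_gt0 j). Qed.

Lemma half_exp_le m n : (m <= n)%N -> 2^-1 ^+ n <= 2^-1 ^+ m :> R.
Proof. by move=> h; apply: ler_wiXn2l => //; rewrite ?invr_ge0 ?invf_le1 ?ler1n. Qed.

Lemma coef_le j : coef j <= 2^-1 ^+ j.+1.
Proof. by rewrite /coef; apply: half_exp_le; rewrite addn1 expnS leq_pmulr// expn_gt0. Qed.

Lemma sum_half_exp J : \sum_(0 <= j < J) 2^-1 ^+ j.+1 = 1 - 2^-1 ^+ J :> R.
Proof.
elim: J => [|J IH]; first by rewrite big_geq// expr0 subrr.
by rewrite big_nat_recr//= IH exprS; field.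
Qed.

Lemma sum_half_exp_le1 J : \sum_(0 <= j < J) 2^-1 ^+ j.+1 <= 1 :> R.
Proof. by rewrite sum_half_exp gerBl exprn_ge0// invr_ge0. Qed.

Lemma sum_coef J : \sum_(0 <= j < J) coef j <= 1.
Proof. by apply: le_trans (sum_half_exp_le1 J); apply: ler_sum => j _; exact: coef_le. Qed.

Lemma coef_le1 j : coef j <= 1.
Proof. by rewrite /coef -[leRHS](expr0 (2^-1)); exact: half_exp_le. Qed.

Lemma coef_ratio_gt j k : (k < j)%N -> coef j / coef k <= 2^-1 ^+ (j + k + 1).
Proof.
move=> kj; rewrite ler_pdivrMr ?coef_gt0// -exprD; apply: half_exp_le.
by nia.
Qed.

(** The left side will bound the colour [j] part of a normalized block of a larger colour [k]. The
    factor [1 / coef k] equals [2^((k+1)^2)]; the gap [(k+2)^3 - (j+2)^3], which exceeds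
    [3 (k+1)^2], between the exponents of the root sizes absorbs it. *)
Lemma coef_ratio_lt j k : (j < k)%N ->
  coef j / coef k * ((root_size j)%:R / (root_size k)%:R) <= 2^-1 ^+ (j + k + 1).
Proof.
move=> jk; have rp i : (0 : R) < (root_size i)%:R by rewrite ltr0n root_size_gt0.
rewrite mulrA ler_pdivrMr// mulrAC ler_pdivrMr ?coef_gt0//.
apply: le_trans (_ : (root_size j)%:R <= _).
  by rewrite -[leRHS]mul1r ler_wpM2r ?coef_le1// ltW.
rewrite /coef mulrAC -exprD /root_size !natrX.
have -> : (2 : R) ^+ ((j + 2) ^ 3)%N =
  2^-1 ^+ ((k + 2) ^ 3 - (j + 2) ^ 3)%N * 2 ^+ ((k + 2) ^ 3)%N.
  have le3 : ((j + 2) ^ 3 <= (k + 2) ^ 3)%N by rewrite leq_exp2r//; lia.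
  by rewrite -{2}(subnK le3) exprD mulrA -exprMn mulVf// expr1n mul1r.
rewrite ler_wpM2r ?exprn_ge0//; apply: half_exp_le.
rewrite leq_subRL; last by rewrite leq_exp2r//; lia.
have -> : (k = j + (k - j).-1 + 1)%N by lia.
move: ((k - j).-1) => d; rewrite !expnS !expn0; nia.
Qed.

Record segment := Seg { seg_set : pred nat; seg_lo : nat; seg_hi : nat }.

Definition seg_supp (s : segment) n := (seg_lo s <= n < seg_hi s)%N && seg_set s n.

Definition seg_colour (s : segment) n := colour (seg_set s) n.

Definition seg_coef (s : segment) (n : nat) : R :=
  if seg_supp s n then coef (seg_colour s n) else 0.

Definition seg_eval (s : segment) (x : nat ->
  R) : R := \sum_(0 <= k < seg_hi s) seg_coef s k * x k.

Lemma seg_coef_ge0 s n : 0 <= seg_coef s n.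
Proof. by rewrite /seg_coef; case: ifP => // _; exact: coef_ge0. Qed.

Lemma seg_eval_widen s x Q : (seg_hi s <= Q)%N ->
  seg_eval s x = \sum_(0 <= k < Q) seg_coef s k * x k.
Proof.
move=> h; rewrite [RHS](big_cat_nat (n :=
  seg_hi s))//= [X in _ = _ + X]big_nat [X in _ = _ + X]big1 ?addr0//.
by move=> k /andP[hk _]; rewrite /seg_coef /seg_supp (ltnNge k) hk andbF mul0r.
Qed.

Lemma seg_eval_fin s x N : (forall k, (N <= k)%N -> x k = 0) ->
  seg_eval s x = \sum_(0 <= k < N) seg_coef s k * x k.
Proof.
move=> h; rewrite (seg_eval_widen x (leq_maxl (seg_hi s) N)).
rewrite [LHS](big_cat_nat (n := N))/= ?leq_maxr// [X in _ + X = _]big_nat [X in _ + X =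
  _]big1 ?addr0//.
by move=> k /andP[hk _]; rewrite h// mulr0.
Qed.

Lemma seg_eval_lin s (a : R) x y : seg_eval s (fun k =>
  a * x k + y k) = a * seg_eval s x + seg_eval s y.
Proof.
rewrite /seg_eval mulr_sumr -big_split; apply: eq_bigr => k _ /=; ring.
Qed.

Lemma seg_eval_loc s x y : (forall k, (k < seg_hi s)%N -> x k = y k) ->
  seg_eval s x = seg_eval s y.
Proof. by move=> h; apply: eq_big_nat => k /andP[_ hk]; rewrite h. Qed.

(* Disjointness is only required inside each colour, so that segments whose
   histories have split are always compatible. *)
Definition compat (I : finType) (s : I -> segment) := forall i j n,
  i != j -> seg_supp (s i) n -> seg_supp (s j) n ->
    seg_colour (s i) n != seg_colour (s j) n.

Record family : Type := Family {
  fam_index : finType; fam_seg : fam_index -> segment; fam_compat : compat fam_seg }.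
Arguments fam_seg : clear implicits.

Definition fam_sq (F : family) (x : nat -> R) : R := \sum_i (seg_eval (fam_seg F i) x) ^+ 2.

Lemma fam_sq_ge0 F x : 0 <= fam_sq F x.
Proof. by apply: sumr_ge0 => i _; exact: sqr_ge0. Qed.

Definition seg_restr u v (s : segment) :=
  Seg (seg_set s) (maxn u (seg_lo s)) (minn v (seg_hi s)).

Definition proj_fun u v (x : nat -> R) k := if (u <= k < v)%N then x k else 0.

Lemma seg_supp_restr u v s n : seg_supp (seg_restr u v s) n = (u <=
  n < v)%N && seg_supp s n.
Proof. by rewrite /seg_supp/= geq_max ltnNge geq_min negb_or -!ltnNge -!andbA;
do !bool_congr. Qed.

Lemma seg_coef_restr u v s n : seg_coef (seg_restr u v s) n = if (u <=
  n < v)%N then seg_coef s n else 0.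
Proof. by rewrite /seg_coef seg_supp_restr /seg_colour; case: (_ <= n < _)%N. Qed.

Lemma seg_eval_restr u v s x : seg_eval (seg_restr u v s) x = seg_eval s (proj_fun u v x).
Proof.
rewrite (@seg_eval_widen _ _ (seg_hi s))/= ?geq_minr//; apply: eq_bigr => k _.
by rewrite seg_coef_restr /proj_fun; case: ifP; rewrite ?mulr0 ?mul0r.
Qed.

Lemma compat_restr u v (I : finType) (s : I -> segment) :
  compat s -> compat (fun i => seg_restr u v (s i)).
Proof.
move=> h i j n ij; rewrite !seg_supp_restr => /andP[_ hi] /andP[_ hj].
exact: (h i j n).
Qed.

Definition fam_restr u v F := Family (compat_restr (u := u) (v := v) (@fam_compat F)).

(** The segments through [k] have pairwise distinct colours, so their coefficients are distinct
    terms of a series with sum at most 1. Hence families are dominated by the l1 norm, and unit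
    vectors get norm 1. *)
Lemma compat_at F k : \sum_i seg_coef (fam_seg F i) k <= 1.
Proof.
rewrite /seg_coef -big_mkcond/=.
pose J := (\max_(i | seg_supp (fam_seg F i) k) seg_colour (fam_seg F i) k).+1.
apply: le_trans (sum_coef J).
apply: (sum_inj_le (f := fun i => seg_colour (fam_seg F i) k)) => [j|i Pi|i i' Pi Pi' e].
- exact: coef_ge0.
- by rewrite ltnS; exact: leq_bigmax_cond.
- apply/eqP; apply: contraT => ii'.
  by have := fam_compat ii' Pi Pi'; rewrite e eqxx.
Qed.

Lemma fam_sq_l1 F x N : (forall k, (N <= k)%N -> x k = 0) ->
  \sum_i `|seg_eval (fam_seg F i) x| <= \sum_(0 <= k < N) `|x k|.
Proof.
move=> hx.
apply: le_trans (_ : \sum_i \sum_(0 <= k < N) seg_coef (fam_seg F i) k * `|x k| <= _).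
  apply: ler_sum => i _; rewrite (seg_eval_fin _ hx).
  apply: le_trans (ler_norm_sum _ _ _) _; apply: ler_sum => k _.
  by rewrite normrM ger0_norm ?seg_coef_ge0.
rewrite exchange_big/=; apply: ler_sum => k _; rewrite -mulr_suml.
by rewrite -[leRHS]mul1r ler_wpM2r ?compat_at.
Qed.

Definition colour_coef (j : nat) s n : R :=
  if seg_supp s n && (seg_colour s n == j) then coef j else 0.

(** The cut-off [N] does not depend on the segment, so one range serves a whole family. *)
Definition colour_eval j s N x := \sum_(0 <= k < N) colour_coef j s k * x k.

Lemma seg_coef_colours s k J : (seg_colour s k < J)%N ->
  seg_coef s k = \sum_(0 <= j < J) colour_coef j s k.
Proof.
move=> h; rewrite /seg_coef /colour_coef; case: (seg_supp s k) => /=; last by rewrite big1.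
by rewrite big_mkord -big_mkcond/= (big_pred1 (Ordinal h))// => j; rewrite eq_sym.
Qed.

(** Let [t i] be the mass of [x] on the positions of colour [j] in segment [i]. Compatibility bounds
    the sum of the [t i] by [L], [colour_card] bounds each one by [block_size j * mu], and a sum of
    squares is at most maximum times sum. The first bound serves flat vectors and small colours, the
    second large colours, where [coef j] is small. *)
Lemma colour_bound F j N x (mu L : R) : 0 <= mu ->
  (forall k, `|x k| <= mu) -> \sum_(0 <= k < N) `|x k| <= L ->
  \sum_i colour_eval j (fam_seg F i) N x ^+ 2 <=
    coef j ^+ 2 * ((block_size j)%:R * mu * L) /\
  \sum_i colour_eval j (fam_seg F i) N x ^+ 2 <= coef j ^+ 2 * L ^+ 2.
Proof.
move=> mu0 hmu hL.
pose ind i k : R := (seg_supp (fam_seg F i) k && (seg_colour (fam_seg F i) k == j))%:R.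
pose t i : R := \sum_(0 <= k < N) ind i k * `|x k|.
have t0 i : 0 <= t i by apply: sumr_ge0 => k _; rewrite mulr_ge0.
have st i : colour_eval j (fam_seg F i) N x ^+ 2 <= coef j ^+ 2 * t i ^+ 2.
  rewrite -exprMn -(@real_normK _ (colour_eval _ _ _ _)) ?num_real//.
  rewrite ler_sqr ?nnegrE ?mulr_ge0 ?coef_ge0//.
  apply: le_trans (ler_norm_sum _ _ _) _; rewrite mulr_sumr; apply: ler_sum => k _.
  rewrite normrM mulrA ler_wpM2r// /colour_coef /ind; case: (_ && _) => /=.
    by rewrite mulr1 ger0_norm ?coef_ge0.
  by rewrite normr0 mulr0.
have sumt : \sum_i t i <= L.
  apply: le_trans hL; rewrite exchange_big/=; apply: ler_sum => k _.
  rewrite -mulr_suml -[leRHS]mul1r ler_wpM2r//.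
  rewrite -natr_sum -[1]/(1%:R) ler_nat.
  have [[i hi]|hN] := pselect (exists i,
    seg_supp (fam_seg F i) k && (seg_colour (fam_seg F i) k == j)).
    rewrite (bigD1 i)//= hi big1 ?addn0// => i' ii'.
    apply/eqP; rewrite eqb0; apply/negP => /andP[h1 /eqP h2].
    move: hi => /andP[h3 /eqP h4].
    by have := fam_compat ii' h1 h3; rewrite h2 h4 eqxx.
  rewrite big1// => i _; apply/eqP; rewrite eqb0; apply/negP => h.
  by apply: hN; exists i.
have L0 : 0 <= L by apply: le_trans sumt; apply: sumr_ge0.
have tn i : t i <= (block_size j)%:R * mu.
  apply: le_trans (_ : \sum_(0 <= k < N) ind i k * mu <= _).
    by apply: ler_sum => k _; rewrite ler_wpM2l.
  rewrite -mulr_suml ler_wpM2r// -natr_sum ler_nat.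
  apply: leq_trans (colour_card (seg_set (fam_seg F i)) j N).
  by apply: leq_sum => k _; rewrite /seg_supp /seg_colour; case: (_ <= k < _)%N.
have tL i : t i <= L.
  by apply: le_trans sumt; rewrite (bigD1 i)//= lerDl sumr_ge0.
split; apply: le_trans (ler_sum _ (fun i _ => st i)) _; rewrite -mulr_sumr;
  rewrite ler_wpM2l ?exprn_ge0 ?coef_ge0//.
- apply: le_trans (_ : \sum_i (block_size j)%:R * mu * t i <= _).
    by apply: ler_sum => i _; rewrite expr2 ler_wpM2r.
  by rewrite -mulr_sumr ler_wpM2l// mulr_ge0.
- apply: le_trans (_ : \sum_i L * t i <= _).
    by apply: ler_sum => i _; rewrite expr2 ler_wpM2r.
  by rewrite -mulr_sumr expr2 ler_wpM2l.
Qed.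

Lemma colour_bound_dual F (a : fam_index F -> R) j N x (mu L : R) : 0 <= mu ->
  \sum_i a i ^+ 2 <= 1 ->
  (forall k, `|x k| <= mu) -> \sum_(0 <= k < N) `|x k| <= L ->
  `|\sum_i a i * colour_eval j (fam_seg F i) N x| <= coef j * L /\
  `|\sum_i a i * colour_eval j (fam_seg F i) N x| <=
    coef j * ((root_size j)%:R * Num.sqrt (mu * L)).
Proof.
move=> mu0 ha hmu hL.
have L0 : 0 <= L by apply: le_trans hL; apply: sumr_ge0.
have [h1 h2] := colour_bound F j mu0 hmu hL.
split; apply: sum_dual_le ha.
- by rewrite mulr_ge0// coef_ge0.
- by rewrite exprMn.
- by rewrite !mulr_ge0// ?coef_ge0// sqrtr_ge0.
- by rewrite !exprMn sqr_sqrtr ?mulr_ge0// -natrX (mulrA _%:R mu).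
Qed.

Definition cat_seg (I1 I2 : finType) (s1 : I1 -> segment) (s2 : I2 -> segment)
  (i : I1 + I2) := match i with inl i => s1 i | inr i => s2 i end.

(** Cut the first family below [u] and the second from [u] on. Colours are read off the unchanged
    [seg_set], so the remaining coefficients are the same, and segments from different sides never
    meet. *)
Lemma fam_sq_cat F1 F2 u (x y : nat -> R) :
  (forall k, (u <= k)%N -> x k = 0) -> (forall k, (k < u)%N -> y k = 0) ->
  exists F, fam_sq F (fun k => x k + y k) = fam_sq F1 x + fam_sq F2 y.
Proof.
move=> hx hy.
pose s := cat_seg (fun i => seg_restr 0 u (fam_seg F1 i))
                  (fun i => Seg (seg_set (fam_seg F2 i)) (maxn u (seg_lo (fam_seg F2 i)))
                    (seg_hi (fam_seg F2 i))).
have supp2 i n : seg_supp (s (inr i)) n = (u <= n)%N && seg_supp (fam_seg F2 i) n.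
  by rewrite /s/= /seg_supp/= geq_max -!andbA.
have cs : compat s.
  move=> [i|i] [j|j] n ij.
  - by apply: (compat_restr (@fam_compat F1)).
  - by rewrite supp2 seg_supp_restr leq0n /= => /andP[h _] /andP[]; rewrite leqNgt h.
  - by rewrite supp2 seg_supp_restr leq0n /= => /andP[h _] /andP[]; rewrite ltnNge h.
  - by rewrite !supp2 => /andP[_ hi] /andP[_ hj]; exact: (@fam_compat F2 i j n).
exists (Family cs); rewrite /fam_sq big_sumType/=; congr (_ + _); apply: eq_bigr => i _.
- rewrite seg_eval_restr; congr (_ ^+ 2); apply: eq_bigr => k _; congr (_ * _).
  by rewrite /proj_fun leq0n/=; case: ltnP => [/hy ->|/hx//]; rewrite addr0.
- congr (_ ^+ 2); apply: eq_bigr => k _ /=.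
  case: (ltnP k u) => uk.
    rewrite hy// mulr0 /seg_coef.
    by rewrite (supp2 i k : seg_supp _ _ = _) leqNgt uk/= mul0r.
  rewrite hx// add0r; congr (_ * _); rewrite /seg_coef.
  by rewrite (supp2 i k : seg_supp _ _ = _) uk.
Qed.

Lemma colour_first A n : (forall k, (k < n)%N -> A k = false) ->
  colour A n = pickle ([::] : seq nat).
Proof.
move=> h; rewrite (eq_colour (A' := pred0) h) /colour.
have -> : start pred0 n = 0%N; last by [].
by case E : (start pred0 n) => [|m]//; have := @start_elem pred0 n; rewrite E => /(_ isT).
Qed.

(** The coefficient of the block with empty history. A singleton carries only this one, so each
    coordinate is [kappa^-1] times a segment value: this is the price of dropping the coordinates
    from the norm, and the constant of all lower estimates. *)
Definition kappa : R := coef (pickle ([::] : seq nat)).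

Lemma kappa_gt0 : 0 < kappa. Proof. exact: coef_gt0. Qed.

Lemma kappa_le1 : kappa <= 1. Proof. exact: coef_le1. Qed.

Definition single n := Seg (pred1 n) n n.+1.

Lemma seg_eval_single n x : seg_eval (single n) x = kappa * x n.
Proof.
rewrite /seg_eval /= big_nat_recr//= big_nat big1 ?add0r => [|k /andP[_ hk]].
  rewrite /seg_coef /seg_supp /= leqnn ltnSn eqxx /= /seg_colour colour_first// => k hk.
  by rewrite /= ltn_eqF.
by rewrite /seg_coef /seg_supp /= leqNgt hk mul0r.
Qed.

Definition solo (s : segment) : family.
Proof.
apply: (@Family unit (fun _ => s)) => -[] [] //.
Defined.

Lemma fam_sq_solo s x : fam_sq (solo s) x = seg_eval s x ^+ 2.
Proof. by rewrite /fam_sq /= big_const card_unit /= addr0. Qed.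

(* The coordinates serve to normalize the basis. *)
Definition normset (f : (nat -> R) -> R) :=
  (exists n, f = fun x => x n) \/
  (exists (F : family) (a : fam_index F -> R), \sum_i a i ^+ 2 <= 1 /\
     f = fun x => \sum_i a i * seg_eval (fam_seg F i) x).

Lemma normset_lin f (a : R) x y : normset f ->
  f (fun k => a * x k + y k) = a * f x + f y.
Proof.
case=> [[n ->]//|[F [b [_ ->]]]].
rewrite mulr_sumr -big_split; apply: eq_bigr => i _ /=; rewrite seg_eval_lin; ring.
Qed.

(** This finiteness lets bounds pass to coordinatewise limits: in the completeness proof, for tails,
    and for bounded completeness. *)
Lemma normset_loc f : normset f ->
  exists N, forall x y, (forall k, (k < N)%N -> x k = y k) -> f x = f y.
Proof.
case=> [[n ->]|[F [b [_ ->]]]]; first by exists n.+1 => x y; apply.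
exists (\max_i seg_hi (fam_seg F i)) => x y h; apply: eq_bigr => i _; congr (_ * _).
apply: seg_eval_loc => k hk; apply: h; apply: leq_trans hk _; exact: leq_bigmax.
Qed.

Lemma normset_proj_fun f u v : normset f ->
  exists2 g, normset g & forall x, f (proj_fun u v x) = g x.
Proof.
case=> [[n ->]|[F [b [hb ->]]]].
  case h : (u <= n < v)%N.
    by exists (fun x => x n) => [|x]; [left; exists n|rewrite /proj_fun h].
  (* A coordinate outside the interval becomes the zero functional, represented by a family with
     zero coefficients. *)
  exists (fun x => \sum_i 0 * seg_eval (fam_seg (solo (single 0)) i) x) => [|x].
    right; exists (solo (single 0)), (fun=> 0); split=> //.
    by rewrite big1 ?ler01// => i _; rewrite expr0n.
  by rewrite /proj_fun h big1// => i _; rewrite mul0r.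
exists (fun x => \sum_i b i * seg_eval (fam_seg (fam_restr u v F) i) x).
  by right; exists (fam_restr u v F), b.
by move=> x; apply: eq_bigr => i _; rewrite seg_eval_restr.
Qed.

Lemma normset_l1 f x N : normset f -> (forall k, (N <= k)%N -> x k = 0) ->
  `|f x| <= \sum_(0 <= k < N) `|x k|.
Proof.
case=> [[n ->]|[F [b [hb ->]]]] hx.
  case: (ltnP n N) => nN; last by rewrite hx// normr0; apply: sumr_ge0.
  rewrite big_mkord (bigD1 (Ordinal nN))//= lerDl.
  by apply: sumr_ge0.
apply: le_trans (fam_sq_l1 F hx); apply: le_trans (ler_norm_sum _ _ _) _.
apply: ler_sum => i _; rewrite normrM -[leRHS]mul1r ler_wpM2r//.
rewrite -(@ler_sqr _ `|b i|) ?nnegrE// real_normK ?num_real// expr1n.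
apply: le_trans hb; rewrite (bigD1 i)//= lerDl.
by apply: sumr_ge0 => j _; exact: sqr_ge0.
Qed.

Lemma normset_fam_sq F x B : (forall f, normset f -> `|f x| <= B) -> fam_sq F x <= B ^+ 2.
Proof.
move=> h; apply: dual_sum_le => a ha.
apply: (h (fun x => \sum_i a i * seg_eval (fam_seg F i) x)).
by right; exists F, a.
Qed.

Lemma fam_sq_normset x B : 0 <= B -> (forall n, `|x n| <= B) ->
  (forall F, fam_sq F x <= B ^+ 2) -> forall f, normset f -> `|f x| <= B.
Proof.
move=> B0 h1 h2 f [[n ->]//|[F [b [hb ->]]]].
by apply: sum_dual_le => //; exact: h2.
Qed.

Lemma half_exp_small (eps : R) : 0 < eps -> exists J, 2^-1 ^+ J <= eps.
Proof.
move=> e0; exists (Num.bound eps^-1); rewrite exprVn -lef_pV2 ?posrE ?invr_gt0 ?exprn_gt0//.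
by rewrite invrK ltW// upper_nthrootP.
Qed.

End Segments.

Arguments fam_seg : clear implicits.

(** * The space and its basis *)

Section SpaceDef.
Variable R : realType.

(** All sequences of finite norm, rather than a completion of the finitely supported ones. By
    [tail_cvg] the latter are dense, so both descriptions agree. *)
Definition jt_bounded : {pred (nat -> R)} :=
  [pred x : nat -> R | `[< exists B, forall f, normset f -> `|f x| <= B >]].

Lemma jt_boundedP x : reflect (exists B, forall f, normset f -> `|f x| <= B)
  (x \in jt_bounded).
Proof. exact: asboolP. Qed.

Lemma jt_bounded_submod : submod_closed jt_bounded.
Proof.
split.
  apply/jt_boundedP; exists 0 => f hf.
  apply: le_trans (normset_l1 (N := 0%N) hf _) _ => //.
  by rewrite big_geq.
move=> a x y /jt_boundedP[Bx hx] /jt_boundedP[By hy]; apply/jt_boundedP.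
exists (`|a| * Bx + By) => f hf.
have -> : a *: x + y = (fun k => a * x k + y k) by [].
rewrite normset_lin//; apply: le_trans (ler_normD _ _) _.
by rewrite normrM lerD ?ler_wpM2l ?hx ?hy.
Qed.

HB.instance Definition _ :=
  GRing.isSubmodClosed.Build R (nat -> R) jt_bounded jt_bounded_submod.

Record jt := JT { jtval :> nat -> R; jtvalP : jtval \in jt_bounded }.

HB.instance Definition _ := [isSub for jtval].
HB.instance Definition _ := [Choice of jt by <:].
HB.instance Definition _ := [SubChoice_isSubLmodule of jt by <:].

Lemma jt_ext (x y : jt) : jtval x =1 jtval y -> x = y.
Proof. by move=> h; apply: val_inj; apply/funext => k; exact: h. Qed.

Lemma jtD (x y : jt) k : (x + y) k = x k + y k. Proof. by []. Qed.
Lemma jtZ (a : R) (x : jt) k : (a *: x) k = a * x k. Proof. by []. Qed.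
Lemma jtB (x y : jt) k : (x - y) k = x k - y k. Proof. by []. Qed.
Lemma jt0 k : (0 : jt) k = 0. Proof. by []. Qed.

Lemma jt_sum (I : Type) (r : seq I) (P : pred I) (F : I -> jt) k :
  (\sum_(i <- r | P i) F i) k = \sum_(i <- r | P i) F i k.
Proof. by elim/big_ind2: _ => // x a y b; rewrite jtD => -> ->. Qed.

Definition jnorm (x : jt) : R := sup [set `|f (jtval x)| | f in @normset R].

Lemma jnorm_set_nonempty (x : jt) :
  [set `|f (jtval x)| | f in @normset R] !=set0.
Proof. by exists `|x 0%N|, (fun x => x 0%N) => //; left; exists 0%N. Qed.

Lemma normset_jnorm f (x : jt) : normset f -> `|f (jtval x)| <= jnorm x.
Proof.
move=> hf; apply: ub_le_sup; last by exists f.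
by have /jt_boundedP[B hB] := jtvalP x; exists B => _ [g hg <-]; exact: hB.
Qed.

Lemma jnorm_le (x : jt) B : (forall f, normset f -> `|f (jtval x)| <= B) ->
  jnorm x <= B.
Proof.
move=> h; apply: ge_sup; first exact: jnorm_set_nonempty.
by move=> _ [f hf <-]; exact: h.
Qed.

Lemma normsetD f (x y : nat -> R) : normset f ->
  f (fun k => x k + y k) = f x + f y.
Proof.
move=> hf; rewrite -[X in X + _]mul1r -(normset_lin 1 x y hf); congr f.
by apply/funext => k; rewrite mul1r.
Qed.

Lemma jnormD x y : jnorm (x + y) <= jnorm x + jnorm y.
Proof.
apply: jnorm_le => f hf.
rewrite (normsetD x y hf : f (jtval (x + y)) = _).
by apply: le_trans (ler_normD _ _) _; rewrite lerD// normset_jnorm.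
Qed.

Lemma normset0 (f : (nat -> R) -> R) : normset f -> f (fun=> 0) = 0.
Proof.
move=> hf; apply/eqP; rewrite -normr_le0.
by apply: le_trans (normset_l1 (N := 0%N) hf _) _ => //; rewrite big_geq.
Qed.

Lemma normsetZ f (a : R) (x : nat -> R) : normset f ->
  f (fun k => a * x k) = a * f x.
Proof.
move=> hf; have := normset_lin a x (fun=> 0) hf; rewrite normset0// addr0 => <-.
by congr f; apply/funext => k; rewrite addr0.
Qed.

Lemma jnormZ_le (a : R) x : jnorm (a *: x) <= `|a| * jnorm x.
Proof.
apply: jnorm_le => f hf.
by rewrite (normsetZ a x hf : f (jtval (a *: x)) = _) normrM ler_wpM2l ?normset_jnorm.
Qed.

Lemma jnorm_ge0 x : 0 <= jnorm x.
Proof.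
apply: le_trans (normr_ge0 (x 0%N)) _.
by apply: (@normset_jnorm (fun x => x 0%N)); left; exists 0%N.
Qed.

Lemma jnormZ (a : R) x : jnorm (a *: x) = `|a| * jnorm x.
Proof.
apply/eqP; rewrite eq_le jnormZ_le/=.
have [->|a0] := eqVneq a 0; first by rewrite normr0 mul0r jnorm_ge0.
have := jnormZ_le a^-1 (a *: x); rewrite scalerA mulVf// scale1r normfV.
by rewrite ler_pdivlMl ?normr_gt0.
Qed.

Lemma jnorm_eq0 x : jnorm x = 0 -> x = 0.
Proof.
move=> h; apply: jt_ext => k; apply/eqP; rewrite jt0 -normr_le0 -h.
by apply: (@normset_jnorm (fun x => x k)); left; exists k.
Qed.

HB.instance Definition _ := @Lmodule_isNormed.Build R jt jnorm
  jnormD jnormZ jnorm_eq0.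

Lemma normset_le f (x : jt) : normset f -> `|f (jtval x)| <= `|x|.
Proof. exact: normset_jnorm. Qed.

Lemma norm_le_normset (x : jt) B :
  (forall f, normset f -> `|f (jtval x)| <= B) -> `|x| <= B.
Proof. exact: jnorm_le. Qed.

Lemma coord_le (x : jt) n : `|x n| <= `|x|.
Proof. by apply: (@normset_le (fun x => x n)); left; exists n. Qed.

Lemma normsetB f (x y : nat -> R) : normset f ->
  f (fun k => x k - y k) = f x - f y.
Proof.
move=> hf; rewrite -[f y]mul1r -mulNr addrC -(normset_lin _ y x hf); congr f.
by apply/funext => k; rewrite mulN1r addrC.
Qed.

Lemma normset_sum f : normset f -> exists N,
  forall x : nat -> R, `|f x| <= \sum_(0 <= k < N) `|x k|.
Proof.
move=> hf; have [N hN] := normset_loc hf; exists N => x.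
rewrite (hN x (proj_fun 0 N x)) => [|k kN]; last by rewrite /proj_fun leq0n kN.
apply: le_trans (normset_l1 (N := N) hf _) _.
  by move=> k kN; rewrite /proj_fun (ltnNge k) kN andbF.
by apply: ler_sum => k _; rewrite /proj_fun; case: ifP => // _; rewrite normr0.
Qed.

Lemma jt_complete (F : set_system jt) : ProperFilter F -> cauchy F -> cvg F.
Proof.
move=> node_block /cauchyP Fc.
have cF n : cvg ((fun x : jt => x n : R^o) @ F).
  apply: (@cauchy_cvg R^o); apply/cauchy_exP => e e0.
  have [x0 hx0] := Fc e e0; exists (x0 n).
  suff : F [set x : jt | ball (x0 n : R^o) e (x n)] by [].
  apply: filterS hx0 => x; rewrite -!ball_normE /= => h.
  by apply: le_lt_trans h; exact: (coord_le (x0 - x) n).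
pose z n := lim ((fun x : jt => x n : R^o) @ F).
have cz N : (fun x : jt => \sum_(0 <= k < N) `|x k - z k| : R^o) @ F --> (0 : R^o).
  elim: N => [|N IH].
    by under eq_fun do rewrite big_geq//; exact: cvg_cst.
  under eq_fun do rewrite big_nat_recr//=.
  have h : (fun x : jt => `|x N - z N| : R^o) @ F --> (0 : R^o).
    have h1 : (fun x : jt => x N - z N : R^o) @ F --> (0 : R^o).
      have := cvgB (cF N) (cvg_cst (z N : R^o)).
      by rewrite -/(z N) subrr; apply.
    by have := cvg_norm h1; rewrite normr0; apply.
  by have := cvgD IH h; rewrite addr0; apply.
have nz N e : 0 < e -> \forall x \near F, \sum_(0 <= k < N) `|(x : jt) k - z k| < e.
  move=> e0; have /cvgrPdist_lt/(_ e e0) := cz N; apply: filterS => x.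
  by rewrite sub0r normrN ger0_norm// sumr_ge0.
(* [f] is dominated by finitely many coordinates. Some [x] in the ball is close to [z] on these, and
   carries the bound from [x0 - x] over to [x0 - z]. *)
have near_z (x0 : jt) e : F (ball x0 e) -> forall f, normset f ->
    `|f (fun k => x0 k - z k)| <= e.
  move=> hb f hf; apply/ler_addgt0Pr => d d0.
  have [N hN] := normset_sum hf.
  have [x [h1 h2]] := filter_ex (filterI hb (nz N d d0)).
  have -> : f (fun k => x0 k - z k) = f (x0 - x) + f (fun k => x k - z k).
    by rewrite (normsetB x0 x hf : f (jtval (x0 - x)) = _) !normsetB// addrA subrK.
  apply: le_trans (ler_normD _ _) _; rewrite lerD//.
    apply: le_trans (normset_le _ hf) _.
    by move: h1; rewrite -ball_normE => /ltW.
  by apply: le_trans (hN _) _; exact: ltW.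
have zP : z \in jt_bounded.
  apply/jt_boundedP; have [x0 hx0] := Fc 1 ltr01.
  exists (1 + `|x0|) => f hf.
  have -> : f z = f x0 - f (fun k => x0 k - z k) by rewrite normsetB// opprB addrC subrK.
  apply: le_trans (ler_normB _ _) _; rewrite addrC lerD ?normset_le//.
  exact: near_z.
apply/cvg_ex; exists (JT zP); apply/cvgrPdist_le => e e0.
have [x0 hx0] := Fc (e / 2) (divr_gt0 e0 (ltr0Sn R 1)).
apply: filterS (hx0) => x; rewrite -ball_normE /= => h.
rewrite (splitr e) -(subrK x0 (JT zP)) -addrA; apply: le_trans (ler_normD _ _) _.
rewrite lerD//; last exact: ltW.
apply: norm_le_normset => f hf.
rewrite -normrN.
have -> : - f (jtval (JT zP - x0)) = f (fun k => x0 k - z k).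
  by rewrite (normsetB _ _ hf : f (jtval (JT zP - x0)) = _) normsetB//= opprB.
exact: near_z.
Qed.

HB.instance Definition _ := Uniform_isComplete.Build jt jt_complete.

End SpaceDef.

(** * The unit vectors as a boundedly complete basis *)

Section Basis.
Variable R : realType.
Notation X := (jt R).
Implicit Types x y : X.

Lemma fin_bounded (x : nat -> R) N : (forall k, (N <= k)%N -> x k = 0) ->
  x \in @jt_bounded R.
Proof.
move=> h; apply/jt_boundedP; exists (\sum_(0 <= k < N) `|x k|) => f hf.
exact: normset_l1.
Qed.

Lemma unit_bounded n : (fun k => (k == n)%:R) \in @jt_bounded R.
Proof.
apply: (@fin_bounded _ n.+1) => k nk; case: eqP => // kn.
by rewrite kn ltnn in nk.
Qed.

Definition unit_vec n : X := JT (unit_bounded n).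

Lemma unit_vecE n k : unit_vec n k = (k == n)%:R. Proof. by []. Qed.

Lemma proj_fun_bounded u v x : proj_fun u v x \in @jt_bounded R.
Proof.
apply/jt_boundedP; exists `|x| => f hf.
by have [g hg ->] := normset_proj_fun u v hf; exact: normset_le.
Qed.

Definition proj u v x : X := JT (proj_fun_bounded u v x).

Lemma projE u v x k : proj u v x k = if (u <= k < v)%N then x k else 0.
Proof. by []. Qed.

Lemma norm_proj u v x : `|proj u v x| <= `|x|.
Proof.
apply: norm_le_normset => f hf.
by have [g hg ->] := normset_proj_fun u v hf; exact: normset_le.
Qed.

Lemma norm_l1 x N : (forall k, (N <= k)%N -> x k = 0) ->
  `|x| <= \sum_(0 <= k < N) `|x k|.
Proof. by move=> h; apply: norm_le_normset => f hf; exact: normset_l1. Qed.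

Lemma norm_unit_vec n : `|unit_vec n| = 1.
Proof.
apply/eqP; rewrite eq_le; apply/andP; split.
  apply: le_trans (@norm_l1 _ n.+1 _) _.
    by move=> k nk; rewrite unit_vecE gtn_eqF.
  rewrite big_nat_recr//= big_nat big1 => [|k /andP[_ kn]].
    by rewrite eqxx normr1 add0r.
  by rewrite ltn_eqF// normr0.
by have := coord_le (unit_vec n) n; rewrite unit_vecE eqxx normr1.
Qed.

Lemma sum_unit_vec (a : nat -> R) p q k :
  (\sum_(p <= i < q) a i *: unit_vec i : X) k = if (p <= k < q)%N then a k else 0.
Proof.
rewrite jt_sum; under eq_bigr do rewrite jtZ unit_vecE.
case: ifP => h.
  rewrite (bigD1_seq k) ?mem_index_iota ?iota_uniq//= eqxx mulr1 big1 ?addr0//.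
  by move=> i /negPf; rewrite eq_sym => ->; rewrite mulr0.
rewrite big_nat big1// => i hi; case: eqP => [ki|_]; last by rewrite mulr0.
by rewrite ki hi in h.
Qed.

Lemma proj_sum u v x : proj u v x = \sum_(u <= i < v) x i *: unit_vec i.
Proof. by apply: jt_ext => k; rewrite sum_unit_vec. Qed.

(** The part of the squared norm coming from families. Unlike the full norm with its coordinates it
    is superadditive on successive supports ([sqnorm_add]), and [kappa_sqnorm] shows that it loses
    only a constant. *)
Definition sqnorm x : R := sup [set y | exists F : family, y = fam_sq F x].

Lemma fam_sq_norm F x : fam_sq F x <= `|x| ^+ 2.
Proof. by apply: normset_fam_sq => f hf; exact: normset_le. Qed.

Lemma fam_sq_sqnorm F x : fam_sq F x <= sqnorm x.
Proof.
apply: ub_le_sup; last by exists F.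
by exists (`|x| ^+ 2) => _ [G ->]; exact: fam_sq_norm.
Qed.

Lemma sqnorm_le x B : (forall F, fam_sq F x <= B) -> sqnorm x <= B.
Proof.
move=> h; apply: ge_sup; last by move=> _ [G ->].
by exists (fam_sq (solo (single 0)) x), (solo (single 0)).
Qed.

Lemma sqnorm_norm x : sqnorm x <= `|x| ^+ 2.
Proof. by apply: sqnorm_le => F; exact: fam_sq_norm. Qed.

Lemma sqnorm_ge0 x : 0 <= sqnorm x.
Proof. by apply: le_trans (fam_sq_sqnorm (solo (single 0)) x); exact: fam_sq_ge0. Qed.

Notation kappa := (kappa R).

Lemma norm_sqr_le x B : (forall n, `|x n| ^+ 2 <= B) -> (forall F, fam_sq F x <= B) ->
  `|x| ^+ 2 <= B.
Proof.
move=> h1 h2; have B0 : 0 <= B by apply: le_trans (h1 0%N); exact: sqr_ge0.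
rewrite -(sqr_sqrtr B0) ler_sqr ?nnegrE ?sqrtr_ge0//.
apply: norm_le_normset; apply: fam_sq_normset; first exact: sqrtr_ge0.
  by move=> n; rewrite -ler_sqr ?nnegrE ?sqrtr_ge0// sqr_sqrtr.
by move=> F; rewrite sqr_sqrtr.
Qed.

Lemma kappa_sqnorm x : kappa ^+ 2 * `|x| ^+ 2 <= sqnorm x.
Proof.
have k0 := @kappa_gt0 R.
have k2 : 0 < kappa ^+ 2 by rewrite exprn_gt0.
rewrite mulrC -ler_pdivlMr//; apply: norm_sqr_le => [n|F].
  rewrite ler_pdivlMr// real_normK ?num_real// mulrC -exprMn -seg_eval_single -fam_sq_solo.
  exact: fam_sq_sqnorm.
rewrite ler_pdivlMr//; apply: le_trans (fam_sq_sqnorm F x).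
by rewrite ler_piMr ?fam_sq_ge0// expr_le1 ?kappa_le1// ltW.
Qed.

Lemma sqnorm_add x y u : (forall k, (u <= k)%N -> x k = 0) ->
  (forall k, (k < u)%N -> y k = 0) -> sqnorm x + sqnorm y <= sqnorm (x + y).
Proof.
move=> hx hy; rewrite -lerBrDr; apply: sqnorm_le => F1.
rewrite lerBrDr addrC -lerBrDr; apply: sqnorm_le => F2.
rewrite lerBrDr addrC.
by have [F <-] := fam_sq_cat F1 F2 hx hy; exact: (fam_sq_sqnorm F (x + y)).
Qed.

Lemma normset_tail f x n : normset f -> exists2 M, (n <= M)%N &
  f (jtval (x - proj 0 n x)) = f (jtval (proj n M x)).
Proof.
move=> hf; have [N hN] := normset_loc hf; exists (maxn n N); first exact: leq_maxl.
apply: hN => k kN; rewrite jtB !projE leq0n/=.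
by case: ltnP => nk; rewrite ?subrr ?subr0// leq_max kN orbT.
Qed.

(** The numbers [sqnorm (proj 0 n x)] increase and are bounded. Beyond an index that nearly attains
    their supremum, superadditivity leaves at most [(kappa * eps) ^+ 2] for any later piece. *)
Lemma tail_cvg x eps : 0 < eps -> exists N, forall n, (N <= n)%N ->
  `|x - proj 0 n x| <= eps.
Proof.
move=> e0; have k0 := @kappa_gt0 R.
pose S := [set y | exists n, y = sqnorm (proj 0 n x)].
have hS : has_sup S.
  split; first by exists (sqnorm (proj 0 0 x)), 0%N.
  exists (`|x| ^+ 2) => _ [n ->]; apply: le_trans (sqnorm_norm _) _.
  by rewrite ler_sqr ?nnegrE// norm_proj.
have d0 : 0 < (kappa * eps) ^+ 2 by rewrite exprn_gt0// mulr_gt0.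
have [_ [N ->] hN] := sup_adherent d0 hS.
exists N => n Nn.
apply: norm_le_normset => f hf.
(* The functional sees only a finite piece of the infinite tail. *)
have [M nM ->] := normset_tail x n hf.
apply: le_trans (normset_le _ hf) _.
have h1 : sqnorm (proj 0 n x) + sqnorm (proj n M x) <= sqnorm (proj 0 M x).
  have -> : proj 0 M x = proj 0 n x + proj n M x.
    apply: jt_ext => k; rewrite jtD !projE !leq0n/=.
    case: (ltnP k n) => kn/=; last by rewrite add0r.
    by rewrite (leq_trans kn nM) addr0.
  apply: (@sqnorm_add _ _ n) => k kn; rewrite projE.
    by rewrite (ltnNge k n) kn andbF.
  by rewrite leqNgt kn.
have h2 : sqnorm (proj 0 N x) <= sqnorm (proj 0 n x).
  have -> : proj 0 n x = proj 0 N x + proj N n x.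
    apply: jt_ext => k; rewrite jtD !projE !leq0n/=.
    case: (ltnP k N) => kn/=; last by rewrite add0r.
    by rewrite (leq_trans kn Nn) addr0.
  apply: le_trans (@sqnorm_add _ _ N _ _); first by rewrite lerDl sqnorm_ge0.
    by move=> k kn; rewrite projE (ltnNge k N) kn andbF.
  by move=> k kn; rewrite projE leqNgt kn.
have h3 : sqnorm (proj 0 M x) <= sup S.
  by apply: ub_le_sup; [case: hS|exists M].
have h4 := kappa_sqnorm (proj n M x).
have h5 : kappa ^+ 2 * `|proj n M x| ^+ 2 <= (kappa * eps) ^+ 2 by lra.
move: h5; rewrite exprMn ler_pM2l ?exprn_gt0//.
by rewrite ler_sqr ?nnegrE// ltW.
Qed.

Lemma series_proj x n : series (fun k => x k *: unit_vec k) n = proj 0 n x.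
Proof. by rewrite proj_sum. Qed.

Lemma series_cvg x : series (fun k => x k *: unit_vec k) @ \oo --> x.
Proof.
apply/cvgrPdist_le => e e0; have [N hN] := tail_cvg x e0.
by exists N => // n /= Nn; rewrite series_proj; exact: hN.
Qed.

Lemma unit_vec_schauder : schauder_basis unit_vec.
Proof.
move=> x; exists (jtval x); split; first exact: series_cvg.
move=> b /cvgrPdist_le hb; apply/funext => k; apply/eqP; rewrite -subr_eq0 -normr_le0.
apply/ler_addgt0Pr => e e0; rewrite add0r.
have [N _ hN] := hb e e0.
have := hN (maxn N k.+1) (leq_maxl _ _) => /(le_trans (coord_le _ k)).
by rewrite jtB sum_unit_vec leq0n leq_max ltnSn orbT.
Qed.

(** The sequence of coefficients is itself a point of the space, because every norming functional
    takes the same value on it as on a long partial sum. *)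
Lemma unit_vec_boundedly_complete : boundedly_complete unit_vec.
Proof.
move=> a [K hK].
have aP : a \in @jt_bounded R.
  apply/jt_boundedP; exists K => f hf.
  have [N hN] := normset_loc hf.
  apply: le_trans (hK N); rewrite (hN a (series (fun n => a n *: unit_vec n) N : X)).
    exact: normset_le.
  by move=> k kN; rewrite sum_unit_vec leq0n kN.
by have h := @series_cvg (JT aP); exact: (cvgP _ h).
Qed.

End Basis.

(** * Colour bounds and the weakly null basis *)

Section ColourBounds.
Variable R : realType.
Notation X := (jt R).
Implicit Types x y : X.

Lemma seg_eval_colours (F : family) N : exists J0, forall J, (J0 <= J)%N ->
  forall i (x : nat -> R), (forall k, (N <= k)%N -> x k = 0) ->
  seg_eval (fam_seg F i) x = \sum_(0 <= j < J) colour_eval j (fam_seg F i) N x.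
Proof.
exists (\max_(i : fam_index F) \max_(k < N) seg_colour (fam_seg F i) k).+1 => J hJ i x hx.
rewrite (seg_eval_fin _ hx) exchange_big/=; apply: eq_big_nat => k /andP[_ kN].
rewrite -mulr_suml; congr (_ * _); apply: seg_coef_colours.
apply: leq_trans hJ; rewrite ltnS.
apply: leq_trans (leq_bigmax i); exact: (leq_bigmax (Ordinal kN)).
Qed.

Lemma norm_colours x N (g : nat -> R) B :
  (forall k, (N <= k)%N -> x k = 0) ->
  (forall k, `|x k| <= B) ->
  (forall F (a : fam_index F -> R) j, \sum_i a i ^+ 2 <= 1 ->
    `|\sum_i a i * colour_eval j (fam_seg F i) N x| <= g j) ->
  (forall J, \sum_(0 <= j < J) g j <= B) -> `|x| <= B.
Proof.
move=> hx hB hg hs; apply: norm_le_normset => f [[n ->]//|[F [a [ha ->]]]].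
have [J /(_ J (leqnn _)) hJ] := seg_eval_colours F N.
apply: le_trans (hs J).
under eq_bigr => i _ do rewrite hJ// mulr_sumr.
rewrite exchange_big/=; apply: le_trans (ler_norm_sum _ _ _) _.
by apply: ler_sum => j _; exact: hg.
Qed.

Lemma coef_half j J0 : (J0 <= j)%N -> coef R j <= 2^-1 ^+ J0 * 2^-1 ^+ j.+1.
Proof. by move=> h; rewrite /coef -exprD; apply: half_exp_le; nia. Qed.

Lemma root_size_homo j k : (j <= k)%N -> (root_size j <= root_size k)%N.
Proof. by move=> h; rewrite /root_size leq_exp2l// leq_exp2r//; lia. Qed.

(** Colours below [J0] are controlled by flatness, the others by their tiny coefficients; the
    separate [mu] accounts for the coordinates. A signed sum of [N] unit vectors has norm at most
    [1 + C sqrt N + 2^-J0 N] with [J0] at choice, that is, o(N). *)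
Lemma norm_flat J0 x N mu L : (forall k, (N <= k)%N -> x k = 0) ->
  (forall k, `|x k| <= mu) -> \sum_(0 <= k < N) `|x k| <= L ->
  `|x| <= mu + (root_size J0)%:R * Num.sqrt (mu * L) + 2^-1 ^+ J0 * L.
Proof.
move=> hx hmu hL.
have mu0 : 0 <= mu by apply: le_trans (hmu 0%N).
have L0 : 0 <= L by apply: le_trans hL; apply: sumr_ge0.
have h2 n : (0 : R) <= 2^-1 ^+ n by rewrite exprn_ge0.
pose G := (root_size J0)%:R * Num.sqrt (mu * L) + 2^-1 ^+ J0 * L.
have G0 : 0 <= G by rewrite addr_ge0 ?mulr_ge0 ?sqrtr_ge0.
rewrite -addrA -/G.
apply: (@norm_colours x N (fun j => 2^-1 ^+ j.+1 * G)) => //.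
- by move=> k; rewrite (le_trans (hmu k))// lerDl.
- move=> F a j ha; have [h3 h4] := @colour_bound_dual _ F a j N x mu L mu0 ha hmu hL.
  case: (leqP J0 j) => hj.
    apply: le_trans h3 _; apply: le_trans (ler_wpM2r L0 (coef_half hj)) _.
    by rewrite -mulrA mulrCA ler_wpM2l// lerDr mulr_ge0 ?sqrtr_ge0.
  apply: le_trans h4 _; rewrite mulrDr; apply: ler_wpDr; first by rewrite !mulr_ge0.
  rewrite ler_pM ?coef_ge0 ?mulr_ge0 ?sqrtr_ge0 ?coef_le//.
  by rewrite ler_wpM2r ?sqrtr_ge0// ler_nat root_size_homo// ltnW.
- move=> J; rewrite -mulr_suml; apply: ler_wpDl => //.
  by rewrite -[leRHS]mul1r ler_wpM2r// sum_half_exp_le1.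
Qed.

Lemma functional_bounded (f : {linear X -> R^o}) : continuous f ->
  exists2 K, 0 < K & forall x, `|f x| <= K * `|x|.
Proof.
move=> cf.
have /continuous_linear_bounded/linear_boundedP/pinfty_ex_gt0[K K0 hK] := cf 0.
by exists K.
Qed.

Lemma contraction_continuous (f : {linear X -> R^o}) :
  (forall x, `|f x| <= `|x|) -> continuous f.
Proof.
move=> hf; apply: bounded_linear_continuous; apply/linear_boundedP.
near=> r => x; apply: le_trans (hf x) _; rewrite ler_peMl//.
Unshelve. all: by end_near. Qed.

Lemma unit_vec_weak_null : weak_cvg (@unit_vec R) 0.
Proof.
move=> f cf; have [K K0 hK] := functional_bounded cf.
rewrite raddf0; apply: contrapT => /cvgrPdist_lt.
move=> /existsNP[d /not_implyP[d0 hd]].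
pose big k := d <= `|f (unit_vec R k)|.
have inf n : exists2 k, (n <= k)%N & big k.
  apply: contrapT => hN; apply: hd; exists n => // k /= nk.
  rewrite sub0r normrN ltNge; apply/negP => hk; apply: hN; by exists k.
pose cnt Q := (\sum_(0 <= k < Q) big k)%N.
have cntN N : exists Q, (N <= cnt Q)%N.
  elim: N => [|N [Q hQ]]; first by exists 0%N.
  have [k Qk bk] := inf Q; exists k.+1.
  rewrite /cnt big_nat_recr//= bk addn1 ltnS; apply: leq_trans hQ _.
  by rewrite /cnt (big_cat_nat (n := Q) (p := k))//= leq_addr.
(* The linear term of [norm_flat] may use up half of [d]. The square root term is then beaten by
   more than [T ^+ 2] vectors, where [T] solves [K * (1 + r) = T * d / 2]. *)
have [J0 hJ0] : exists J0, K * 2^-1 ^+ J0 <= d / 2.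
  have [|J hJ] := @half_exp_small R (d / 2 / K); first by rewrite !divr_gt0.
  by exists J; rewrite mulrC -ler_pdivlMr.
pose r : R := (root_size J0)%:R.
have r0 : 0 <= r by rewrite /r.
pose T := K * (1 + r) * 2 / d.
have T0 : 0 <= T by rewrite divr_ge0 ?(ltW d0)// !mulr_ge0 ?addr_ge0 ?(ltW K0).
have [Q hQ] := cntN (Num.bound (T ^+ 2)).+1.
pose c : R := (cnt Q)%:R.
have c1 : 1 <= c by rewrite /c ler1n (leq_trans _ hQ).
have Tc : T ^+ 2 < c.
  apply: lt_le_trans (archi_boundP (sqr_ge0 T)) _.
  by rewrite /c ler_nat (leq_trans _ hQ).
pose xx k : R := if (k < Q)%N && big k then Num.sg (f (unit_vec R k)) else 0.
have hxx k : (Q <= k)%N -> xx k = 0 by rewrite /xx (ltnNge k) => ->.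
have xx1 k : `|xx k| <= (big k)%:R.
  rewrite /xx; case: (big k); rewrite ?andbF ?normr0//= andbT.
  by case: ifP => _; rewrite ?normr0// normr_sg; case: (_ == _).
pose x : X := JT (fin_bounded hxx).
have fx : c * d <= f x.
  have -> : x = \sum_(0 <= k < Q) x k *: unit_vec R k.
    rewrite -proj_sum; apply: jt_ext => k; rewrite projE leq0n /=.
    by case: ltnP => // /hxx.
  rewrite linear_sum /c /cnt natr_sum mulr_suml.
  apply: ler_sum_nat => k /andP[_ kQ]; rewrite linearZ /= /xx kQ/=.
  case: (boolP (big k)) => bk; last by rewrite mul0r scale0r.
  have E : Num.sg (f (unit_vec R k)) *: f (unit_vec R k) =
    `|f (unit_vec R k) : R| by rewrite normrEsg.
  by rewrite mul1r E.
have x1 k : `|x k| <= 1 by apply: le_trans (xx1 k) _; case: (big k).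
have sx : \sum_(0 <= k < Q) `|x k| <= c.
  by rewrite /c /cnt natr_sum; apply: ler_sum => k _; exact: xx1.
have nx := @norm_flat J0 x Q 1 c hxx x1 sx.
rewrite mul1r -/r in nx.
have sT : T < Num.sqrt c.
  by rewrite -(ger0_norm T0) -sqrtr_sqr ltr_sqrt// (lt_le_trans ltr01).
have s1 : 1 <= Num.sqrt c by rewrite -sqrtr1 ler_wsqrtr.
have sc : Num.sqrt c ^+ 2 = c by rewrite sqr_sqrtr// (le_trans ler01).
have h1 : c * d <= K * `|x|.
  by apply: le_trans fx _; apply: le_trans (ler_norm _) _; exact: hK.
have h2 : K * `|x| <= K * (1 + r * Num.sqrt c) + d / 2 * c.
  apply: le_trans (ler_wpM2l (ltW K0) nx) _.
  by rewrite mulrDr lerD2l mulrA ler_wpM2r// (le_trans ler01).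
have h3 : K * (1 + r * Num.sqrt c) <= K * (1 + r) * Num.sqrt c.
  by rewrite -mulrA ler_pM2l// mulrDl mul1r lerD2r.
have h4 : K * (1 + r) = T * d / 2 by rewrite /T; field; rewrite gt_eqF.
have h5 : T * d / 2 * Num.sqrt c < Num.sqrt c * (d / 2) * Num.sqrt c.
  rewrite ltr_pM2r ?(lt_le_trans ltr01)// -mulrA ltr_pM2r// divr_gt0//.
rewrite h4 in h3.
have h6 : Num.sqrt c * (d / 2) * Num.sqrt c = c * d / 2 by rewrite -{3}sc; ring.
lra.
Qed.

End ColourBounds.

(** * Branches *)

Section Blocks.
Variable R : realType.
Notation X := (jt R).

(** Chosen so that a set which takes a full block of colour [j] has value exactly 1 on the
    corresponding block vector. *)
Definition weight (j : nat) : R := (coef R j * (block_size j)%:R)^-1.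

Lemma block_sizeR_gt0 j : (0 : R) < (block_size j)%:R.
Proof. by rewrite ltr0n block_size_gt0. Qed.

Lemma root_sizeR_gt0 j : (0 : R) < (root_size j)%:R.
Proof. by rewrite ltr0n root_size_gt0. Qed.

Lemma weight_gt0 j : 0 < weight j.
Proof. by rewrite invr_gt0 mulr_gt0 ?coef_gt0 ?block_sizeR_gt0. Qed.

Lemma coef_weight j : coef R j * weight j = (block_size j)%:R^-1.
Proof. by rewrite /weight invfM mulrA divff ?mul1r// gt_eqF ?coef_gt0. Qed.

Lemma weight_block_size j : weight j * (block_size j)%:R = (coef R j)^-1.
Proof. by rewrite /weight invfM -mulrA mulVf ?mulr1// gt_eqF ?block_sizeR_gt0. Qed.

Lemma weight_le1 j : weight j <= 1.
Proof.
rewrite /weight invf_le1 ?mulr_gt0 ?coef_gt0 ?block_sizeR_gt0// /coef exprVn.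
rewrite mulrC ler_pdivlMr ?exprn_gt0// mul1r /block_size /root_size -!natrX ler_nat.
rewrite -expnM leq_exp2l// !expnS !expn0; nia.
Qed.

Definition block_vec_fun (F : seq nat) j k : R := if k \in F then weight j else 0.

Lemma block_vec_bounded F j : block_vec_fun F j \in @jt_bounded R.
Proof.
apply: (@fin_bounded _ _ (\max_(k <- F) k).+1) => k hk; rewrite /block_vec_fun.
case: ifP => // kF; move: hk; rewrite ltnNge.
by rewrite (@leq_bigmax_seq _ F xpredT id k kF isT).
Qed.

Definition block_vec F j : X := JT (block_vec_bounded F j).

Lemma block_vecE F j k : block_vec F j k =
  if k \in F then weight j else 0. Proof. by []. Qed.

Lemma block_vec_ge0 F j k : 0 <= block_vec F j k.
Proof. by rewrite block_vecE; case: ifP => // _; exact: ltW (weight_gt0 j). Qed.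

Lemma sum_mem_iota (F : seq nat) N : uniq F -> (forall k, k \in F -> (k < N)%N) ->
  (\sum_(0 <= k < N) (k \in F) = size F)%N.
Proof.
move=> uF hF.
have -> : (\sum_(0 <= k < N) (k \in F) = \sum_(k <- index_iota 0 N | k \in F) 1)%N.
  by rewrite [RHS]big_mkcond; apply: eq_bigr => k _; case: (k \in F).
rewrite sum1_count -size_filter; apply: perm_size; apply: uniq_perm => //.
  by rewrite filter_uniq// iota_uniq.
move=> k; rewrite mem_filter mem_index_iota/=; case: (boolP (k \in F)) => //= kF.
exact: hF.
Qed.

Lemma sum_block_vec F j N : uniq F -> (forall k, k \in F -> (k < N)%N) ->
  \sum_(0 <= k < N) block_vec F j k = weight j * (size F)%:R.
Proof.
move=> uF hF; rewrite -(sum_mem_iota uF hF) natr_sum mulr_sumr.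
by apply: eq_bigr => k _; rewrite block_vecE; case: (k \in F); rewrite ?mulr1 ?mulr0.
Qed.

(** [colour_bound_dual] is applied with [mu = weight h] and [L = 1 / coef h]. Colours above [h] are
    small by the l1 bound and [coef_ratio_gt]. For colours below [h] the flat bound is used, where
    [sqrt (mu L) = 1 / (coef h root_size h)], so that [coef_ratio_lt] applies. *)
Lemma block_vec_colour (F : seq nat) h N (Fam : family) (a : fam_index Fam -> R) j :
  uniq F -> size F = block_size h -> (forall k, k \in F -> (k < N)%N) ->
  \sum_i a i ^+ 2 <= 1 ->
  `|\sum_i a i * colour_eval j (fam_seg Fam i) N (block_vec F h)| <=
    if j == h then 1 else 2^-1 ^+ (j + h + 1).
Proof.
move=> uF sF hF ha.
have hmu k : `|block_vec F h k| <= weight h.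
  by rewrite ger0_norm ?block_vec_ge0// block_vecE; case: ifP => // _;
  exact: ltW (weight_gt0 h).
have hL : \sum_(0 <= k < N) `|block_vec F h k| <= (coef R h)^-1.
  under eq_bigr do rewrite ger0_norm ?block_vec_ge0//.
  by rewrite sum_block_vec// sF weight_block_size.
have [h1 h2] := colour_bound_dual j (ltW (weight_gt0 h)) ha hmu hL.
case: (ltngtP j h) => jh.
- apply: le_trans h2 _; apply: le_trans (coef_ratio_lt R jh).
  rewrite -mulrA ler_wpM2l ?coef_ge0// mulrCA ler_wpM2l//.
  have -> : weight h / coef R h = ((coef R h * (root_size h)%:R)^-1) ^+ 2.
    rewrite /weight /block_size natrX; field.
    by rewrite !gt_eqF ?coef_gt0 ?root_sizeR_gt0.
  rewrite sqrtr_sqr ger0_norm; last by rewrite invr_ge0 mulr_ge0 ?coef_ge0.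
  by rewrite invfM.
- by apply: le_trans h1 _; exact: coef_ratio_gt.
- by apply: le_trans h1 _; rewrite jh divff// gt_eqF ?coef_gt0.
Qed.

Lemma norm_block_vec F h : uniq F -> size F = block_size h -> `|block_vec F h| <= 2.
Proof.
move=> uF sF; pose N := (\max_(k <- F) k).+1.
have hF k : k \in F -> (k < N)%N.
  by move=> kF; rewrite ltnS (@leq_bigmax_seq _ F xpredT id k kF isT).
(* The own colour contributes 1 and all the others together at most 1, hence the bound 2. *)
apply: (@norm_colours _ _ N (fun j => (j == h)%:R + 2^-1 ^+ j.+1)).
- by move=> k; rewrite block_vecE; case: ifP => // /hF; rewrite ltnNge => /negbTE ->.
- move=> k; rewrite ger0_norm ?block_vec_ge0// block_vecE; case: ifP => // _.
  by rewrite (le_trans (weight_le1 h))// ler1n.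
- move=> Fam a j ha; apply: le_trans (block_vec_colour j uF sF hF ha) _.
  case: eqP => _; first by rewrite lerDl exprn_ge0.
  by rewrite add0r; apply: half_exp_le; lia.
- move=> J; rewrite big_split/= -[leRHS]/(1 + 1 : R) lerD ?sum_half_exp_le1//.
  rewrite -natr_sum -[1]/(1%:R) ler_nat.
  have -> : (\sum_(0 <= j < J) (j == h) = count_mem h (index_iota 0 J))%N.
    by rewrite -sum1_count [RHS]big_mkcond; apply: eq_bigr => j _; rewrite /=;
    case: (j == h).
  by rewrite count_uniq_mem ?iota_uniq// leq_b1.
Qed.

End Blocks.

(** * Signed sums of blocks along one branch *)

Section Branch.
Variable R : realType.
Notation X := (jt R).
Variables (B : pred nat) (F : nat -> seq nat) (h lo : nat -> nat).
Hypothesis hF : forall l k, k \in F l ->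
  [/\ B k, colour B k = h l & (lo l <= k < lo l.+1)%N].
Hypothesis hlo : forall l, (lo l <= lo l.+1)%N.
Hypothesis uF : forall l, uniq (F l).
Hypothesis sF : forall l, size (F l) = block_size (h l).
Hypothesis h_inj : injective h.

Let y l : X := block_vec R (F l) (h l).

Let yE l k : y l k = if k \in F l then weight R (h l) else 0.
Proof. by []. Qed.

Let y_ge0 l k : 0 <= y l k.
Proof. exact: block_vec_ge0. Qed.

Lemma lo_homo l l' : (l <= l')%N -> (lo l <= lo l')%N.
Proof.
elim: l' => [|l' IH]; first by rewrite leqn0 => /eqP->.
by rewrite leq_eqVlt => /orP[/eqP->//|/IH/leq_trans]; apply.
Qed.

Lemma F_below l T k : (l < T)%N -> k \in F l -> (k < lo T)%N.
Proof. by move=> lT /hF[_ _ /andP[_ hk]]; apply: leq_trans hk (lo_homo lT). Qed.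

(** The value on [y l] of the branch cut off at [t]: it rises from 0 at [lo l] to 1 at [lo l.+1]. *)
Definition frac l t : R := \sum_(0 <= k < t) coef R (colour B k) * y l k.

Lemma coef_block l k : coef R (colour B k) * y l k = coef R (h l) * y l k.
Proof. by rewrite yE; case: ifP => [/hF[_ -> _]//|_]; rewrite !mulr0. Qed.

Lemma frac_ge0 l t : 0 <= frac l t.
Proof. by apply: sumr_ge0 => k _; rewrite mulr_ge0 ?coef_ge0 ?y_ge0. Qed.

Lemma frac_homo l t t' : (t <= t')%N -> frac l t <= frac l t'.
Proof.
move=> tt; rewrite /frac (big_cat_nat (n := t) (p := t'))//= lerDl.
by apply: sumr_ge0 => k _; rewrite mulr_ge0 ?coef_ge0 ?y_ge0.
Qed.

Lemma frac_full l t : (lo l.+1 <= t)%N -> frac l t = 1.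
Proof.
move=> ht; rewrite /frac; under eq_bigr do rewrite coef_block.
rewrite -mulr_sumr sum_block_vec// => [|k /hF[_ _ /andP[_ hk]]]; last exact: leq_trans ht.
by rewrite sF weight_block_size divff// gt_eqF ?coef_gt0.
Qed.

Lemma frac_le1 l t : frac l t <= 1.
Proof.
by rewrite -(@frac_full l (maxn t (lo l.+1))) ?leq_maxr// frac_homo// leq_maxl.
Qed.

Lemma frac_empty l t : (t <= lo l)%N -> frac l t = 0.
Proof.
move=> ht; rewrite /frac big_nat big1// => k /andP[_ kt].
rewrite yE; case: ifP => [/hF[_ _ /andP[hk _]]|]; last by rewrite mulr0.
by move: (leq_trans kt (leq_trans ht hk)); rewrite ltnn.
Qed.

(** It is the bound on partial sums that keeps all intervals of the branch bounded on [x]; in the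
    application the signs come in cancelling pairs. *)
Variables (eps : nat -> R) (T : nat).
Hypothesis eps_part : forall t, `|\sum_(0 <= l < t) eps l| <= 1.
Hypothesis eps1 : forall l, `|eps l| <= 1.

Let x : X := \sum_(0 <= l < T) eps l *: y l.
Let c : R := \sum_(0 <= l < T) `|eps l|.

Lemma signed_sumE k : x k = \sum_(0 <= l < T) eps l * y l k.
Proof. by rewrite jt_sum. Qed.

Lemma x_outside k : (lo T <= k)%N -> x k = 0.
Proof.
move=> hk; rewrite signed_sumE big_nat big1// => l /andP[_ lT].
rewrite yE; case: ifP => [/(F_below lT)|]; last by rewrite mulr0.
by rewrite ltnNge hk.
Qed.

Lemma x_val k : x k = 0 \/ exists l, [/\ (l < T)%N, B k,
  colour B k = h l & x k = eps l * weight R (h l)].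
Proof.
have [[l [lT kF]]|hN] := pselect (exists l, (l < T)%N /\ k \in F l).
  right; exists l; have [Bk cB _] := hF kF; split=> //.
  rewrite signed_sumE (bigD1_seq l) ?mem_index_iota ?iota_uniq// yE kF big1 => [|l' ll'].
    exact: addr0.
  rewrite yE; case: ifP => [kF'|]; last by rewrite mulr0.
  have [_ cB' _] := hF kF'; move/eqP: ll'; case.
  by apply: h_inj; rewrite -cB -cB'.
left; rewrite signed_sumE big_nat big1// => l /andP[_ lT]; rewrite yE.
by case: ifP => [kF|]; rewrite ?mulr0//; exfalso; apply: hN; exists l.
Qed.

Lemma x_le1 k : `|x k| <= 1.
Proof.
have [->|[l [_ _ _ ->]]] := x_val k; first by rewrite normr0.
rewrite normrM -[leRHS]mul1r ler_pM// ger0_norm ?weight_le1//.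
exact: ltW (weight_gt0 R _).
Qed.

Lemma coef_x k : coef R (colour B k) * `|x k| <= (block_size (colour B k))%:R^-1.
Proof.
have [->|[l [_ _ -> ->]]] := x_val k; first by rewrite normr0 mulr0 invr_ge0.
rewrite normrM (ger0_norm (ltW (weight_gt0 R _))) mulrCA coef_weight -[leRHS]mul1r.
by rewrite ler_wpM2r ?invr_ge0.
Qed.

Lemma sum_coef_x : \sum_(0 <= k < lo T) coef R (colour B k) * `|x k| <= c.
Proof.
apply: le_trans (_ : \sum_(0 <= k < lo T) \sum_(0 <= l < T)
    `|eps l| * (coef R (colour B k) * y l k) <= _).
  apply: ler_sum => k _; rewrite signed_sumE;
  apply: le_trans (ler_wpM2l (coef_ge0 R _) (ler_norm_sum _ _ _)) _.
  rewrite mulr_sumr; apply: ler_sum => l _.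
  by rewrite normrM mulrCA (ger0_norm (y_ge0 _ _)).
rewrite exchange_big/=; apply: ler_sum => l _; rewrite -mulr_sumr.
by rewrite -[leRHS]mulr1 ler_wpM2l//; exact: frac_le1.
Qed.

(** A cut at [t] leaves at most one block partly counted. The full blocks contribute a partial sum
    of [eps], and each of the two contributions is at most 1. *)
Lemma partial_x t : `|\sum_(0 <= k < t) coef R (colour B k) * x k| <= 2.
Proof.
have -> : \sum_(0 <= k < t) coef R (colour B k) * x k = \sum_(0 <= l < T) eps l * frac l t.
  under eq_bigr do rewrite signed_sumE mulr_sumr.
  rewrite exchange_big/=; apply: eq_bigr => l _; rewrite mulr_sumr.
  by apply: eq_bigr => k _; rewrite mulrCA.
elim: T => [|n IH]; first by rewrite big_geq// normr0.
case: (leqP (lo n.+1) t) => ht.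
  rewrite (_ : \sum_(_ <= _ < _) _ = \sum_(0 <= l < n.+1) eps l).
    by apply: le_trans (eps_part _) _; rewrite ler1n.
  apply: eq_big_nat => l /andP[_ ln]; rewrite frac_full ?mulr1//.
  by apply: leq_trans ht; exact: lo_homo.
rewrite big_nat_recr//=.
case: (leqP t (lo n)) => htn; first by rewrite (frac_empty htn) mulr0 addr0.
have -> : \sum_(0 <= i < n) eps i * frac i t = \sum_(0 <= l < n) eps l.
  apply: eq_big_nat => l /andP[_ ln]; rewrite frac_full ?mulr1//.
  by apply: leq_trans (ltnW htn); exact: lo_homo.
apply: le_trans (ler_normD _ _) _; rewrite -[leRHS]/(1 + 1 : R) lerD//.
by rewrite normrM -[leRHS]mul1r ler_pM// ger0_norm ?frac_ge0 ?frac_le1.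
Qed.

(* The part of a segment which agrees in colour with the branch: up to the
   first disagreement it is an interval of the branch, and what remains lies
   in a single block. *)
Definition matched (s : segment) k : R :=
  if seg_supp s k && B k && (seg_colour s k == colour B k) then coef R (colour B k) else 0.

Lemma matched_ge0 s k : 0 <= matched s k.
Proof. by rewrite /matched; case: ifP => // _; exact: coef_ge0. Qed.

Lemma first_diff (A : pred nat) N : exists d, [/\ (d <= N)%N,
  forall k, (k < d)%N -> A k = B k & d = N \/ A d <> B d].
Proof.
elim: N => [|N [d [dN hd e]]]; first by exists 0%N; split=> //; left.
case: e => [dE|ne]; last by exists d; split=> //; [exact: leqW|right].
have [e|ne] := pselect (A d = B d); last first.
  by exists d; split=> //; [exact: leqW|right].
exists N.+1; split=> //; last by left.
by move=> k; rewrite ltnS leq_eqVlt => /orP[/eqP->|]; [rewrite -dE|rewrite -dE; exact: hd].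
Qed.

Lemma matched_head s d : (forall k, (k < d)%N -> seg_set s k = B k) ->
  \sum_(0 <= k < d) matched s k * x k =
  \sum_(0 <= k < d | (seg_lo s <= k < seg_hi s)%N) coef R (colour B k) * x k.
Proof.
move=> hd; rewrite [RHS]big_mkcond; apply: eq_big_nat => k /andP[_ kd].
rewrite /matched /seg_supp /seg_colour hd//.
have -> : colour (seg_set s) k = colour B k by apply: eq_colour => i ik; apply: hd;
exact: ltn_trans kd.
rewrite eqxx andbT; case: (seg_lo s <= k < seg_hi s)%N; last by rewrite mul0r.
have [E|[l [_ Bk _ _]]] := x_val k; first by rewrite E !mulr0.
by rewrite Bk.
Qed.

Lemma matched_head_le s d : (forall k, (k < d)%N -> seg_set s k = B k) ->
  `|\sum_(0 <= k < d) matched s k * x k| <= 4.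
Proof.
move=> hd; rewrite matched_head//.
set W := fun t => \sum_(0 <= k < t) coef R (colour B k) * x k.
have W2 t : `|W t| <= 2 by exact: partial_x.
suff [t1 [t2 ->]] : exists t1 t2,
    \sum_(0 <= k < d | (seg_lo s <= k < seg_hi s)%N) coef R (colour B k) * x k =
      W t1 - W t2.
  apply: le_trans (ler_normB _ _) _.
  by rewrite (_ : (4 : R) = 2 + 2) ?lerD//; ring.
(* The interval of the segment, cut at [d]; capping [p] by [q] covers the empty case. Its two ends
   are cuts of value at most 2, whence the 4. *)
pose q := minn (seg_hi s) d; pose p := minn (seg_lo s) q.
exists q, p.
have pq : (p <= q)%N by rewrite geq_minr.
have -> : W q - W p = \sum_(p <= k < q) coef R (colour B k) * x k.
  by rewrite /W (big_cat_nat (n := p) (p := q))//= addrAC subrr add0r.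
rewrite (big_cat_nat (n := q) (p := d))/= ?geq_minr//.
rewrite [X in _ + X]big_nat_cond [X in _ + X]big1 ?addr0; last first.
  move=> k /andP[/andP[h1 h2] /andP[_ h3]].
  by move: h1; rewrite geq_min (leqNgt d) h2 orbF leqNgt h3.
rewrite (big_cat_nat (n := p) (p := q))//=.
rewrite [X in X + _]big_nat_cond [X in X + _]big1 ?add0r; last first.
  move=> k /andP[/andP[_ h1] /andP[h2 _]].
  by move: h1; rewrite ltnNge geq_min h2.
rewrite [LHS]big_nat_cond [RHS]big_nat_cond; apply: eq_bigl => k.
case: (boolP (p <= k < q)%N) => //= /andP[h1 h2].
apply/andP; split.
  move: h1; rewrite geq_min => /orP[//|]; by rewrite leqNgt h2.
by move: h2; rewrite ltn_min => /andP[].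
Qed.

(** Equal colours at [k >= d] force the sets to agree below the start of the block, so this start is
    at most [d] and the block is the one of [B] in progress at [d]. It has at most [block_size]
    elements, each contributing at most the inverse of that number. *)
Lemma matched_tail_le s d N : seg_set s d <> B d ->
  `|\sum_(d <= k < N) matched s k * x k| <= 1.
Proof.
move=> nd.
apply: le_trans (ler_norm_sum _ _ _) _.
apply: le_trans (_ : \sum_(d <= k < N) (B k && (colour B k == colour B d))%:R *
  (block_size (colour B d))%:R^-1 <= _).
  apply: ler_sum_nat => k /andP[dk _].
  rewrite /matched; case: ifP => [|_]; last by rewrite mul0r normr0 mulr_ge0// invr_ge0.
  move=> /andP[/andP[_ Bk] /eqP ck].
  have [Es Eb] := colour_inj ck.
  have ud : (start B k <= d)%N.
    by rewrite leqNgt; apply/negP => du; apply: nd; apply: Eb; rewrite Es.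
  have E : colour B k = colour B d.
    by rewrite /colour -(start_between ud dk).
  rewrite Bk E eqxx mul1r normrM (ger0_norm (coef_ge0 R _)) -E; exact: coef_x.
rewrite -mulr_suml ler_pdivrMr ?block_sizeR_gt0// mul1r -natr_sum ler_nat.
apply: leq_trans (colour_card B (colour B d) N).
by case: (leqP d N) => dN; [rewrite [leqRHS](big_cat_nat (n :=
  d))//= leq_addl|rewrite big_geq// ltnW].
Qed.

Lemma matched_le5 s N : `|\sum_(0 <= k < N) matched s k * x k| <= 5.
Proof.
have [d [dN hd e]] := first_diff (seg_set s) N.
rewrite (big_cat_nat (n := d))//=; apply: le_trans (ler_normD _ _) _.
have -> : (5 : R) = 4 + 1 by ring.
rewrite lerD ?matched_head_le//.
by case: e => [->|/matched_tail_le//]; rewrite big_geq// normr0.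
Qed.

(** At each coordinate at most one segment of the family has the colour of [B], so the absolute
    masses add up to at most [c]. Estimating one factor of each square by 5 keeps the bound linear
    in [c], which is the source of the square root growth of the norm. *)
Lemma matched_family (Fam : family) :
  \sum_i (\sum_(0 <= k < lo T) matched (fam_seg Fam i) k * x k) ^+ 2 <= 5 * c.
Proof.
pose t i := \sum_(0 <= k < lo T) matched (fam_seg Fam i) k * `|x k|.
have ht i : `|\sum_(0 <= k < lo T) matched (fam_seg Fam i) k * x k| <= t i.
  apply: le_trans (ler_norm_sum _ _ _) _; apply: ler_sum => k _.
  by rewrite normrM ger0_norm ?matched_ge0.
apply: le_trans (_ : \sum_i 5 * t i <= _).
  apply: ler_sum => i _; rewrite -real_normK ?num_real// expr2.
  by rewrite ler_pM ?matched_le5.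
rewrite -mulr_sumr ler_wpM2l//; apply: le_trans sum_coef_x.
rewrite exchange_big/=; apply: ler_sum => k _; rewrite -mulr_suml ler_wpM2r//.
have [[i hi]|hN] := pselect (exists i,
  seg_supp (fam_seg Fam i) k && B k && (seg_colour (fam_seg Fam i) k == colour B k)).
  rewrite (bigD1 i)//= /matched hi big1 ?addr0// => i' ii'.
  case: ifP => // /andP[/andP[h1 _] /eqP h2].
  move: hi => /andP[/andP[h3 _] /eqP h4].
  by have := fam_compat ii' h1 h3; rewrite h2 h4 eqxx.
rewrite big1 ?coef_ge0// => i _; rewrite /matched; case: ifP => // hi.
by exfalso; apply: hN; exists i.
Qed.

(** The colours of the branch are handled by [matched_family]. On [y l] all other colours together
    give at most [2^-(h l)], and as the [h l] are distinct these terms sum to at most 2. *)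
Lemma norm_signed_sum : `|x| <= Num.sqrt (5 * c) + 2.
Proof.
have c0 : 0 <= c by apply: sumr_ge0.
apply: norm_le_normset => f [[n ->]|[Fam [a [ha ->]]]].
  by apply: le_trans (x_le1 n) _; apply: ler_wpDl; rewrite ?sqrtr_ge0 ?ler1n.
pose N := lo T.
have [J0 hJ0] := seg_eval_colours R Fam N.
pose J := maxn J0 (\max_(l < T) h l).+1.
have hJ := hJ0 J (leq_maxl _ _).
have hlJ l : (l < T)%N -> (h l < J)%N.
  move=> lT; rewrite leq_max ltnS; apply/orP; right.
  exact: (leq_bigmax (Ordinal lT)).
have ysupp l k : (l < T)%N -> (N <= k)%N -> y l k = 0.
  move=> lT Nk; rewrite yE; case: ifP => // /(F_below lT).
  by rewrite ltnNge Nk.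
pose psi i := \sum_(0 <= k < N) matched (fam_seg Fam i) k * x k.
pose rest l i := \sum_(0 <= j < J | j != h l) colour_eval j (fam_seg Fam i) N (y l).
have dec i : seg_eval (fam_seg Fam i) x = psi i + \sum_(0 <= l < T) eps l * rest l i.
  have -> : seg_eval (fam_seg Fam i) x = \sum_(0 <=
    l < T) eps l * seg_eval (fam_seg Fam i) (y l).
    rewrite /seg_eval; under eq_bigr do rewrite signed_sumE mulr_sumr.
    rewrite exchange_big/=; apply: eq_bigr => l _; rewrite mulr_sumr.
    by apply: eq_bigr => k _; rewrite mulrCA.
  have -> : psi i = \sum_(0 <= l < T) eps l * colour_eval (h l) (fam_seg Fam i) N (y l).
    rewrite /psi; under eq_bigr do rewrite signed_sumE mulr_sumr.
    rewrite exchange_big/=; apply: eq_bigr => l _; rewrite mulr_sumr.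
    apply: eq_bigr => k _; rewrite mulrCA; congr (_ * _).
    suff : matched (fam_seg Fam i) k * y l k =
      colour_coef R (h l) (fam_seg Fam i) k * y l k by [].
    rewrite yE; case: ifP => [kF|_]; last by rewrite !mulr0.
    have [Bk ck _] := hF kF; congr (_ * _).
    by rewrite /matched /colour_coef Bk ck andbT.
  rewrite -big_split/=; apply: eq_big_nat => l /andP[_ lT].
  rewrite -mulrDr; congr (_ * _).
  rewrite (hJ i (y l)) => [|k]; last exact: ysupp.
  rewrite (bigID (fun j => j == h l))/=; congr (_ + _).
  by rewrite big_mkord (big_pred1 (Ordinal (hlJ l lT))).
under eq_bigr do rewrite dec mulrDr.
rewrite big_split/=; apply: le_trans (ler_normD _ _) _; rewrite lerD//.
  apply: sum_dual_le ha; first exact: sqrtr_ge0.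
  by rewrite sqr_sqrtr ?mulr_ge0//; exact: matched_family.
under eq_bigr do rewrite mulr_sumr.
rewrite exchange_big/=; apply: le_trans (ler_norm_sum _ _ _) _.
apply: le_trans (_ : \sum_(0 <= l < T) 2^-1 ^+ h l <= _); last first.
  rewrite big_mkord.
  apply: le_trans (@sum_inj_le _ _ predT (fun l : 'I_T => h l) (fun j =>
    2^-1 ^+ j) J _ _ _) _.
  - by move=> j; rewrite exprn_ge0.
  - by move=> l _; exact: hlJ.
  - by move=> l l' _ _ /h_inj; exact: val_inj.
  have -> : \sum_(0 <= j < J) 2^-1 ^+ j = 2 * \sum_(0 <= j < J) 2^-1 ^+ j.+1 :> R.
    by rewrite mulr_sumr; apply: eq_bigr => j _; rewrite exprS mulrA divff// mul1r.
  by rewrite -[leRHS]mulr1 ler_wpM2l// sum_half_exp_le1.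
apply: ler_sum_nat => l /andP[_ lT].
have -> : \sum_i a i * (eps l * rest l i) =
    eps l * \sum_(0 <= j < J | j != h l) \sum_i a i * colour_eval j (fam_seg Fam i) N (y l).
  under eq_bigr do rewrite mulrCA.
  rewrite -mulr_sumr; congr (_ * _).
  by rewrite exchange_big/=; apply: eq_bigr => i _; rewrite mulr_sumr.
rewrite normrM -[leRHS]mul1r ler_pM//; apply: le_trans (ler_norm_sum _ _ _) _.
apply: le_trans (_ : \sum_(0 <= j < J) 2^-1 ^+ h l * 2^-1 ^+ j.+1 <= _).
  rewrite [leRHS](bigID (fun j => j != h l))/=; apply: ler_wpDr.
    by apply: sumr_ge0 => j _; rewrite mulr_ge0 ?exprn_ge0.
  apply: ler_sum => j /negbTE jh.
  apply: le_trans (block_vec_colour j (uF l) (sF l) _ ha) _; first by move=> k;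
  exact: F_below.
  by rewrite jh -exprD; apply: half_exp_le; lia.
by rewrite -mulr_sumr -[leRHS]mulr1 ler_wpM2l ?exprn_ge0// sum_half_exp_le1.
Qed.

End Branch.

(** * Functionals of infinite branches *)

Section BranchFunctional.
Variable R : realType.
Notation X := (jt R).

Definition branch_part (A : pred nat) (x : X) n : R := seg_eval (Seg A 0 n) x.

Definition branch_fun (A : pred nat) (x : X) : R^o :=
  limn (fun n => branch_part A x n : R^o).

Lemma normset_seg s : normset (fun x : nat -> R => seg_eval s x).
Proof.
right; exists (solo s), (fun=> 1); split.
  by rewrite big_const card_unit /= expr1n addr0.
by apply/funext => x; rewrite /= big_const card_unit /= mul1r addr0.
Qed.

Lemma seg_le s (x : X) : `|seg_eval s x| <= `|x|.
Proof. exact: (normset_le x (normset_seg s)). Qed.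

Lemma branch_part_le A x n : `|branch_part A x n| <= `|x|.
Proof. exact: seg_le. Qed.

Lemma branch_partE A x n : branch_part A x n =
  \sum_(0 <= k < n) (if A k then coef R (colour A k) else 0) * x k.
Proof. by apply: eq_big_nat => k /andP[_ kn]; rewrite /seg_coef /seg_supp /= kn. Qed.

Lemma branch_part_diff A x m n : (m <= n)%N ->
  `|branch_part A x n - branch_part A x m| <= `|x - proj 0 m x|.
Proof.
move=> mn; have -> : branch_part A x n - branch_part A x m =
  branch_part A (x - proj 0 m x) n; last exact: branch_part_le.
rewrite !branch_partE (big_cat_nat (n := m))//= addrAC subrr add0r.
rewrite [RHS](big_cat_nat (n := m))//= [X in _ = X + _]big_nat [X in _ =
  X + _]big1 ?add0r => [|k /andP[_ km]].
  apply: eq_big_nat => k /andP[mk _]; congr (_ * _).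
  by rewrite -[RHS]/(x k - proj 0 m x k) projE leq0n ltnNge mk subr0.
rewrite [X in _ * X](_ : _ = 0) ?mulr0//.
by rewrite -[LHS]/(x k - proj 0 m x k) projE leq0n km subrr.
Qed.

Lemma branch_fun_cvg A x : (fun n => branch_part A x n : R^o) @ \oo --> branch_fun A x.
Proof.
apply/cauchy_cvgP; apply/cauchy_exP => e e0.
have [N hN] := tail_cvg x (divr_gt0 e0 (ltr0Sn R 1)).
exists (branch_part A x N); exists N => // n /= Nn.
rewrite -ball_normE /= distrC; apply: le_lt_trans (branch_part_diff A x Nn) _.
by apply: le_lt_trans (hN N (leqnn _)) _; rewrite ltr_pdivrMr// ltr_pMr// ltr1n.
Qed.

Lemma branch_fun_linear A : linear (branch_fun A : X -> R^o).
Proof.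
move=> a x y; apply/cvg_lim => //.
have -> : (fun n => branch_part A (a *: x + y) n : R^o) =
    (fun n => a *: (branch_part A x n : R^o) + branch_part A y n).
  by apply/funext => n; exact: (seg_eval_lin _ a x y).
by apply: cvgD; [apply: cvgZr|]; exact: branch_fun_cvg.
Qed.

HB.instance Definition _ A := GRing.isLinear.Build R X R^o _ (branch_fun A)
  (@branch_fun_linear A).

Lemma branch_fun_le A x : `|branch_fun A x| <= `|x|.
Proof.
have h : (fun n => `|branch_part A x n : R^o|) @ \oo --> `|branch_fun A x|.
  exact: (cvg_norm (@branch_fun_cvg A x)).
rewrite -(cvg_lim _ h)//; apply: limr_le; first by apply/cvg_ex; eexists; exact: h.
by apply: nearW => n; exact: branch_part_le.
Qed.

Lemma branch_fun_continuous A : continuous (branch_fun A : X -> R^o).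
Proof. exact: contraction_continuous (branch_fun_le A). Qed.

Lemma branch_fun_fin A (x : X) N : (forall k, (N <= k)%N -> x k = 0) ->
  branch_fun A x = branch_part A x N.
Proof.
move=> hx; apply/cvg_lim => //; apply: cvg_near_cst.
exists N => // n /= Nn; rewrite !branch_partE (big_cat_nat (n := N) (p := n))//=.
rewrite [X in _ + X]big_nat [X in _ + X]big1 ?addr0// => k /andP[Nk _].
by rewrite hx// mulr0.
Qed.

Lemma coord_linear n : linear ((fun x : X => x n) : X -> R^o).
Proof. by move=> a x y. Qed.

Definition coord n (x : X) : R^o := x n.

HB.instance Definition _ n := GRing.isLinear.Build R X R^o _ (coord n) (@coord_linear n).

Lemma coord_continuous n : continuous (coord n : X -> R^o).
Proof. by apply: contraction_continuous => x; exact: coord_le. Qed.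

End BranchFunctional.

Lemma sum_delta (R : pzRingType) (g : nat -> R) (T t : nat) :
  \sum_(0 <= l < t) (l == T)%:R * g l = if (T < t)%N then g T else 0.
Proof.
case: ifP => h.
  rewrite (bigD1_seq T) ?mem_index_iota ?iota_uniq//= eqxx mul1r big1 ?addr0//.
  by move=> i /negPf ->; rewrite mul0r.
rewrite big_nat big1// => l lt; case: eqP => [e|_]; last by rewrite mul0r.
by move: lt; rewrite e leq0n /= h.
Qed.

(** * Weak behaviour along a branch *)

Section BranchWeak.
Variable R : realType.
Notation X := (jt R).
Variables (B : pred nat) (F : nat -> seq nat) (h lo : nat -> nat).
Hypothesis hF : forall l k, k \in F l ->
  [/\ B k, colour B k = h l & (lo l <= k < lo l.+1)%N].
Hypothesis hlo : forall l, (lo l <= lo l.+1)%N.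
Hypothesis uF : forall l, uniq (F l).
Hypothesis sF : forall l, size (F l) = block_size (h l).
Hypothesis h_inj : injective h.

Let y l : X := block_vec R (F l) (h l).

Lemma branch_fun_branch l : branch_fun B (y l) = 1.
Proof.
rewrite (@branch_fun_fin _ B (y l) (lo l.+1)) => [|k hk]; last first.
  rewrite block_vecE; case: ifP => // /hF[_ _ /andP[_]].
  by rewrite ltnNge hk.
rewrite branch_partE -(frac_full R (@hF) uF sF (leqnn (lo l.+1))); apply: eq_bigr => k _.
suff : (if B k then coef R (colour B k) else 0) * y l k = coef R (colour B k) * y l k by [].
by rewrite block_vecE; case: (boolP (k \in F l)) => [/hF[-> _ _]//|_]; rewrite !mulr0.
Qed.

(** Each step appends, beyond the support so far, a pair [s] at [T] and [-s] at some [m > T], with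
    [s] the sign of [u T - u m]. It gains at least [d], costs at most 2 in absolute values, and
    returns the partial sums to 0. *)
Lemma branch_signs (u : nat -> R) d : 0 < d ->
  (forall N, exists2 m, (N <= m)%N & d <= `|u N - u m|) ->
  forall K, exists T eps, [/\ forall t, `|\sum_(0 <= l < t) eps l| <= 1,
    forall l, `|eps l| <= 1, forall l, (T <= l)%N -> eps l = 0,
    \sum_(0 <= l < T) eps l = 0 &
    \sum_(0 <= l < T) `|eps l| <= (2 * K)%:R /\
    K%:R * d <= \sum_(0 <= l < T) eps l * u l].
Proof.
move=> d0 hu; elim=> [|K [T [eps [h1 h2 h3 h4 [h5 h6]]]]].
  exists 0%N, (fun=> 0); split=> //; rewrite ?big_geq// ?muln0 ?mul0r//.
  - by move=> t; rewrite big1// normr0.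
  - by move=> l; rewrite normr0.
have [m Tm hm] := hu T.
have Tltm : (T < m)%N.
  rewrite ltn_neqAle Tm andbT; apply/eqP => E.
  by move: hm; rewrite E subrr normr0 leNgt d0.
pose s := Num.sg (u T - u m).
have s1 : `|s| <= 1 by rewrite normr_sg; case: (_ != 0).
pose dl l : R := (l == T)%:R * s + (l == m)%:R * - s.
have sdl (g : nat -> R) t : \sum_(0 <= l < t) dl l * g l =
    (if (T < t)%N then s * g T else 0) - (if (m < t)%N then s * g m else 0).
  rewrite /dl; under eq_bigr do rewrite mulrDl -!mulrA.
  by rewrite big_split/= !sum_delta; case: ifP; case: ifP; rewrite ?mulNr ?oppr0.
have sdl1 t : \sum_(0 <= l < t) dl l =
    (if (T < t)%N then s else 0) - (if (m < t)%N then s else 0).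
  by have := sdl (fun=> 1) t; under eq_bigr do rewrite mulr1; rewrite !mulr1.
have epsT t : (T <= t)%N -> \sum_(0 <= l < t) eps l = 0.
  move=> Tt; rewrite (big_cat_nat (n := T))//= h4 add0r big_nat big1// => l /andP[hl _].
  exact: h3.
have dlT l : (l < T)%N -> dl l = 0.
  by move=> lT; rewrite /dl !ltn_eqF ?mul0r ?addr0// (ltn_trans lT).
have dl1 l : `|dl l| <= 1.
  rewrite /dl; case: eqP => [->|_].
    by rewrite (ltn_eqF Tltm) mul0r addr0 mul1r.
  by rewrite mul0r add0r; case: eqP => _; rewrite ?mul1r ?mul0r ?normr0// normrN.
exists m.+1, (fun l => eps l + dl l); split.
- move=> t; rewrite big_split/= sdl1.
  case: (ltnP T t) => Tt.
    rewrite epsT ?(ltnW Tt)// add0r; case: ifP => _; rewrite ?subr0//.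
    by rewrite subrr normr0.
  by rewrite (leq_gtF (leq_trans Tt Tm)) subrr addr0.
- move=> l; case: (ltnP l T) => lT; first by rewrite dlT// addr0.
  by rewrite h3// add0r.
- move=> l ml; rewrite h3 ?add0r; last by rewrite (leq_trans Tm)// ltnW.
  rewrite /dl !gtn_eqF ?mul0r ?addr0//; exact: leq_trans ml.
- by rewrite big_split/= sdl1 ltnS Tm ltnSn subrr addr0 epsT// leqW.
split.
- apply: le_trans (ler_sum _ (fun l _ => ler_normD (eps l) (dl l))) _.
  rewrite big_split/= mulnS addnC natrD; apply: lerD.
    rewrite (big_cat_nat (n := T))/= ?leqW// [X in _ + X]big_nat [X in _ + X]big1 ?addr0//.
    by move=> l /andP[hl _]; rewrite h3// normr0.
  apply: le_trans (_ : \sum_(0 <= l < m.+1) ((l == T)%:R * 1 + (l == m)%:R * 1) <= _).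
    apply: ler_sum => l _; rewrite /dl; apply: le_trans (ler_normD _ _) _.
    by rewrite !normrM normrN !normr_nat lerD// ler_wpM2l.
  by rewrite big_split/= !(sum_delta (fun=> 1)) ltnS Tm ltnSn.
- under eq_bigr do rewrite mulrDl.
  rewrite big_split/= sdl ltnS Tm ltnSn -mulrBr -[K.+1]addn1 natrD mulrDl mul1r lerD//.
    rewrite (big_cat_nat (n := T))/= ?leqW// [X in _ + X]big_nat [X in _ + X]big1 ?addr0//.
    by move=> l /andP[hl _]; rewrite h3// mul0r.
  by apply: le_trans hm _; rewrite normrEsg.
Qed.

Lemma branch_weakly_cauchy : weakly_cauchy y.
Proof.
move=> f cf; have [C C0 hC] := functional_bounded cf.
apply/cauchy_exP; apply: contrapT => /existsNP[d /not_implyP[d0 hd]].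
have hu N : exists2 m, (N <= m)%N & d <= `|f (y N) - f (y m)|.
  apply: contrapT => hN; apply: hd; exists (f (y N)); exists N => // m /= Nm.
  rewrite -ball_normE /= ltNge; apply/negP => hm; apply: hN; by exists m.
pose n := Num.bound (2 * C / d).
have hn : 2 * C < d * n%:R.
  rewrite [ltRHS]mulrC -ltr_pdivrMr//; apply: archi_boundP.
  by rewrite divr_ge0// ?(ltW d0)// mulr_ge0// ltW.
have n0 : (0 : R) < n%:R by rewrite -(pmulr_rgt0 _ d0) (lt_trans _ hn)// mulr_gt0.
have n1 : (1 : R) <= n%:R by rewrite ler1n -(ltr0n R).
(* With [10 n^2] pairs, [5 c] is at most [(10 n)^2] and the norm of the signed sum at most
   [10 n + 2], whereas [f] is at least [10 n^2 d > 20 C n] on it. *)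
have [T [eps [h1 h2 h3 h4 [h5 h6]]]] := branch_signs d0 hu (10 * n ^ 2)%N.
have hx := norm_signed_sum (@hF) hlo uF sF h_inj T h1 h2.
have h7 : (10 * n ^ 2)%:R * d <= C * (10 * n%:R + 2).
  apply: le_trans h6 _.
  have -> : \sum_(0 <= l < T) eps l * f (y l) = f (\sum_(0 <= l < T) eps l *: y l).
    by rewrite linear_sum; apply: eq_bigr => l _; rewrite linearZ.
  apply: le_trans (ler_norm _) _; apply: le_trans (hC _) _.
  rewrite ler_pM2l//; apply: le_trans hx _; rewrite lerD2r.
  apply: le_trans (_ : Num.sqrt ((10 * n%:R) ^+ 2) <= _); last first.
    by rewrite sqrtr_sqr ger0_norm.
  apply: ler_wsqrtr; apply: le_trans (ler_wpM2l _ h5) _ => //.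
  by rewrite mulnA natrM natrX exprMn mulrA ler_wpM2r ?sqr_ge0// -natrM -natrX ler_nat.
move: h7; rewrite natrM natrX => h7.
have h8 : 10 * n%:R ^+ 2 * d = 10 * (d * n%:R) * n%:R by ring.
rewrite h8 in h7.
have h9 : 10 * (2 * C) * n%:R < 10 * (d * n%:R) * n%:R by rewrite ltr_pM2r// ltr_pM2l.
have h10 : C <= C * n%:R by rewrite ler_peMr// ltW.
lra.
Qed.

(** A weak limit would have zero coordinates, each position lying in at most one block; but the
    functional of the branch is constantly 1 on the sequence. *)
Lemma branch_not_weakly_convergent : ~ exists x, weak_cvg y x.
Proof.
move=> [x hx].
have x0 : x = 0.
  apply: jt_ext => k; rewrite jt0.
  have hk := hx _ (@coord_continuous R k).
  have : (fun n => coord k (y n)) @ \oo --> (0 : R^o).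
    apply: cvg_near_cst.
    have [[l kF]|hN] := pselect (exists l, k \in F l).
      exists l.+1 => // m lm; rewrite /coord /y block_vecE; case: ifP => // kF'.
      have [_ c1 _] := hF kF; have [_ c2 _] := hF kF'.
      have E : l = m by apply: h_inj; rewrite -c1 -c2.
      by move: lm; rewrite E /= ltnn.
    exists 0%N => // m _; rewrite /coord /y block_vecE; case: ifP => // kF.
    by exfalso; apply: hN; exists m.
  by move=> h0; apply: (cvg_unique _ hk h0).
have hb := hx _ (@branch_fun_continuous R B).
rewrite x0 raddf0 in hb.
have h1 : (fun n => branch_fun B (y n)) @ \oo --> (1 : R^o).
  by under eq_fun do rewrite branch_fun_branch; exact: cvg_cst.
have E : (0 : R^o) = 1 by apply: (cvg_unique _ hb h1).
by have := oner_neq0 R; rewrite -[X in X != _]E eqxx.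
Qed.

Lemma norm_branch_ge1 l : 1 <= `|y l|.
Proof. by apply: le_trans (branch_fun_le B (y l)); rewrite branch_fun_branch normr1. Qed.

End BranchWeak.

(** * The James tree property *)

Section Nodes.

(** Heap numbering: the children of [v] are [2v+1] and [2v+2], so the parent of [i.+1] is [i./2],
    and the order by length and then lexicographically becomes the order of numbers. *)
Definition node_from (v : nat) (a : seq bool) : nat :=
  foldl (fun v (d : bool) => (v.*2.+1 + d)%N) v a.

Definition node (a : seq bool) : nat := node_from 0 a.

(** After a shift by one, the descendants of [v] at depth [n] lie in [[2^n (v+1), 2^n (v+2))]; these
    ranges are disjoint and ordered like the nodes [v]. *)
Lemma node_from_bounds v a :
  (2 ^ size a * v.+1 <= (node_from v a).+1 <= 2 ^ size a * v.+2 - 1)%N.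
Proof.
elim: a v => [|d a IH] v /=; first by rewrite expn0; lia.
move: (IH (v.*2.+1 + d)%N); rewrite expnS -muln2; case: d => /=; nia.
Qed.

Lemma node_from_lexi v a b : size a = size b ->
  ((a : seqlexi bool) < (b : seqlexi bool))%O -> (node_from v a < node_from v b)%N.
Proof.
elim: a b v => [|d a IH] [|d' b] v //= [sab].
rewrite ltxi_cons; case: d; case: d' => //=; try exact: IH.
move=> _; rewrite addn0.
have /andP[_ h1] := node_from_bounds v.*2.+1 a.
have /andP[h2 _] := node_from_bounds (v.*2.+1 + 1) b.
have p0 : (0 < 2 ^ size b)%N by rewrite expn_gt0.
move: h1 h2; rewrite sab; nia.
Qed.

Lemma node_homo a b : dyadic_lt a b -> (node a < node b)%N.
Proof.
rewrite /dyadic_lt => /orP[h|/andP[/eqP h1 h2]]; last exact: node_from_lexi.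
have /andP[_ h1] := node_from_bounds 0 a.
have /andP[h2 _] := node_from_bounds 0 b.
have p0 : (0 < 2 ^ size a)%N by rewrite expn_gt0.
have h3 : (2 ^ (size a).+1 <= 2 ^ size b)%N by rewrite leq_exp2l.
move: h3; rewrite expnS /node; nia.
Qed.

Lemma node_rcons a d : node (rcons a d) = ((node a).*2.+1 + d)%N.
Proof. by rewrite /node /node_from foldl_rcons. Qed.

Lemma node_branch b n : node (branch_node b n.+1) =
  ((node (branch_node b n)).*2.+1 + b n)%N.
Proof. by rewrite /branch_node mkseqS node_rcons. Qed.

Lemma node_inj : injective node.
Proof.
elim/last_ind => [|a d IH] b; elim/last_ind: b => [|b d' _] //;
  rewrite ?node_rcons //= => e.
by congr rcons; [apply: IH|]; move: e; case: d; case: d'; lia.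
Qed.

Lemma node_branch_diff b b1 : b1 <> b -> exists n0, forall n, (n0 <= n)%N ->
  forall m, node (branch_node b n) <> node (branch_node b1 m).
Proof.
move=> ne; have [i hi] : exists i, b1 i <> b i.
  by apply: contrapT => h; apply: ne; apply/funext => i; apply: contrapT => hi; apply: h;
  exists i.
exists i.+1 => n ni m /node_inj e.
have nm : n = m by rewrite -(size_mkseq b n) -(size_mkseq b1 m) -/(branch_node b n) e.
by apply: hi; have := congr1 (nth false ^~ i) e; rewrite /= -nm !nth_mkseq.
Qed.

End Nodes.

Section StartStep.

(** Since [t.-1] lies in [F], the count reaches the required size exactly on passing to [t], so [F]
    is the block of [A] begun at [s]. *)
Lemma start_block (A : pred nat) (s t : nat) (F : seq nat) :
  start A s = s -> sorted ltn F -> size F = block_size (pickle (below A s)) ->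
  (s < t)%N -> t.-1 \in F -> (forall k, k \in F -> (s <= k < t)%N) ->
  (forall k, (s <= k < t)%N -> A k = (k \in F)) ->
  [/\ start A t = t, below A t = below A s ++ F &
      forall k, (s <= k < t)%N -> start A k = s].
Proof.
move=> hs sF szF; case: t => // t; rewrite ltnS /= => st tF Fst AF.
have uF : uniq F by apply: sorted_uniq sF; [exact: ltn_trans|exact: ltnn].
have tot : (\sum_(s <= k < t.+1) A k = block_size (pickle (below A s)))%N.
  rewrite -szF -(@sum_mem_iota F t.+1 uF) => [|k /Fst/andP[]//].
  rewrite [RHS](big_cat_nat (n := s))/= ?leqW//.
  rewrite [X in _ = (X + _)%N]big_nat [X in _ = (X + _)%N]big1 ?add0n => [|k /andP[_ ks]].
    by apply: eq_big_nat => k hk; rewrite AF.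
  by case: (boolP (k \in F)) => // /Fst; rewrite leqNgt ks.
have tot1 : (\sum_(s <= k < t) A k < block_size (pickle (below A s)))%N.
  by rewrite -tot big_nat_recr//= AF ?tF ?addn1// st ltnSn.
have stay u : (s <= u)%N -> (u <= t)%N -> start A u = s.
  elim: u => [|u IH]; first by rewrite leqn0 => /eqP ->.
  rewrite leq_eqVlt => /orP[/eqP<-//|]; rewrite ltnS => su ut.
  rewrite /= IH//; last exact: ltnW.
  case: eqP => // e; exfalso.
  have : (\sum_(s <= k < u.+1) A k <= \sum_(s <= k < t) A k)%N.
    by rewrite [leqRHS](big_cat_nat (n := u.+1))/= ?leq_addr// leqW.
  by rewrite e leqNgt tot1.
split.
- by rewrite /= stay// tot eqxx.
- rewrite /below -[in LHS](subnKC (leqW st)) iotaD filter_cat; congr (_ ++ _).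
  rewrite add0n; apply: (irr_sorted_eq ltn_trans ltnn) => //.
    by apply: sorted_filter; [exact: ltn_trans|exact: iota_ltn_sorted].
  move=> k; rewrite mem_filter mem_iota subnKC; last exact: leqW.
  case: (boolP (s <= k < t.+1)%N) => hk; first by rewrite AF// andbT.
  by rewrite andbF; apply/esym/negP => /Fst; apply/negP.
- by move=> k /andP[h1 h2]; exact: stay.
Qed.

End StartStep.

Lemma infinite_set_ge (M : set nat) n : infinite_set M -> exists2 k, (n <= k)%N & M k.
Proof.
move=> Minf; apply: contrapT => h; apply: Minf.
apply: (@sub_finite_set _ _ `I_n); last exact: finite_II.
by move=> k Mk /=; rewrite ltnNge; apply/negP => nk; apply: h; exists k.
Qed.

Lemma infinite_set_enum (M : set nat) : infinite_set M ->
  exists mu : nat -> nat, [/\ forall k, M (mu k), forall k, (mu k < mu k.+1)%N &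
    forall m, M m -> exists k, mu k = m].
Proof.
move=> Minf.
have hn n : exists k, (n <= k)%N && `[< M k >].
  by have [k nk Mk] := infinite_set_ge n Minf; exists k; rewrite nk; apply/asboolP.
pose nxt n := ex_minn (hn n).
have nxtP n : [/\ (n <= nxt n)%N, M (nxt n) & forall m, (n <= m)%N -> M m ->
  (nxt n <= m)%N].
  rewrite /nxt; case: ex_minnP => k /andP[h1 /asboolP h2] h3; split=> // m nm Mm.
  by apply: h3; rewrite nm; apply/asboolP.
pose mu k := iter k (fun m => nxt m.+1) (nxt 0).
have muS k : mu k.+1 = nxt (mu k).+1 by [].
exists mu; split.
- by case=> [|k]; [have [_] := nxtP 0%N|rewrite muS; have [_] := nxtP (mu k).+1].
- by move=> k; rewrite muS; have [] := nxtP (mu k).+1.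
move=> m Mm.
have gek k : (k <= mu k)%N.
  elim: k => // k IH; apply: leq_ltn_trans IH _.
  by rewrite muS; have [] := nxtP (mu k).+1.
have ex : exists k, (m <= mu k)%N by exists m.
pose k := ex_minn ex; exists k; apply/eqP; rewrite eqn_leq.
rewrite /k; case: ex_minnP => -[|k'] h1 h2; rewrite h1 andbT.
  by have [_ _] := nxtP 0%N; apply.
rewrite muS; have [_ _] := nxtP (mu k').+1; apply=> //.
by rewrite ltnNge; apply/negP => /h2; rewrite ltnn.
Qed.

(** * A dyadic tree of blocks inside an infinite set *)

Section Tree.
Variable mu : nat -> nat.
Hypothesis mu_lt : forall k, (mu k < mu k.+1)%N.

Definition tstate (S : seq (seq nat * nat)) i := nth ([::], 0%N) S i.
Definition tblock (HQ : seq nat * nat) : seq nat :=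
  [seq mu k | k <- iota HQ.2 (block_size (pickle HQ.1))].

(** An entry holds the elements of all ancestor blocks and the index in [mu] at which the own block
    begins. The history continues that of the parent [i./2], while the index continues that of the
    preceding node [i], so the blocks of all nodes are successive; hence the list of all earlier
    states is kept. *)
Fixpoint tree n : seq (seq nat * nat) :=
  if n is i.+1 then
    let S := tree i in
    rcons S ((tstate S i./2).1 ++ tblock (tstate S i./2),
             (tstate S i).2 + block_size (pickle (tstate S i).1))%N
  else [:: ([::], 0%N)].

Lemma treeS i : tree i.+1 = rcons (tree i)
  ((tstate (tree i) i./2).1 ++ tblock (tstate (tree i) i./2),
   ((tstate (tree i) i).2 + block_size (pickle (tstate (tree i) i).1))%N).
Proof. by []. Qed.

Lemma size_tree n : size (tree n) = n.+1.
Proof. by elim: n => //= n IH; rewrite size_rcons IH. Qed.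

Lemma tree_stable n i : (i <= n)%N -> tstate (tree n) i = tstate (tree i) i.
Proof.
elim: n => [|n IH]; first by rewrite leqn0 => /eqP->.
rewrite leq_eqVlt => /orP[/eqP->//|]; rewrite ltnS => h.
by rewrite treeS [LHS]/tstate nth_rcons size_tree ltnS h -IH.
Qed.

Definition node_history i := (tstate (tree i) i).1.
Definition node_index i := (tstate (tree i) i).2.
Definition node_block i := [seq mu k | k <- iota (node_index i) (block_size (pickle
  (node_history i)))].

Lemma tstate_last i : tstate (tree i.+1) i.+1 =
  ((tstate (tree i) i./2).1 ++ tblock (tstate (tree i) i./2),
   ((tstate (tree i) i).2 + block_size (pickle (tstate (tree i) i).1))%N).
Proof. by rewrite treeS [LHS]/tstate nth_rcons size_tree ltnn eqxx. Qed.

Lemma node_historyS i : node_history i.+1 = node_history i./2 ++ node_block i./2.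
Proof. by rewrite /node_history tstate_last tree_stable//; lia. Qed.

Lemma node_indexS i : node_index i.+1 =
  (node_index i + block_size (pickle (node_history i)))%N.
Proof. by rewrite /node_index tstate_last. Qed.

Lemma mu_homo k l : (k < l)%N -> (mu k < mu l)%N.
Proof.
elim: l => // l IH; rewrite ltnS leq_eqVlt => /orP[/eqP->//|/IH h].
exact: ltn_trans h (mu_lt l).
Qed.

Lemma mu_mono k l : (mu k < mu l)%N = (k < l)%N.
Proof.
apply/idP/idP; last exact: mu_homo.
case: (ltngtP k l) => // [/mu_homo h1 h2|->]; last by rewrite ltnn.
by move: (ltn_trans h1 h2); rewrite ltnn.
Qed.

Definition node_lo i := mu (node_index i).
Definition node_colour i := pickle (node_history i).

Lemma node_blockP i k : reflect (exists2 j,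
  (node_index i <= j < node_index i.+1)%N & k = mu j) (k \in node_block i).
Proof.
apply: (iffP mapP) => -[j].
  by rewrite mem_iota => hj ->; exists j => //; rewrite node_indexS.
by rewrite node_indexS => hj ->; exists j => //; rewrite mem_iota.
Qed.

Lemma node_index_lt i : (node_index i < node_index i.+1)%N.
Proof. by rewrite node_indexS -[X in (X < _)%N]addn0 ltn_add2l block_size_gt0. Qed.

Lemma node_index_homo i j : (i <= j)%N -> (node_index i <= node_index j)%N.
Proof.
elim: j => [|j IH]; first by rewrite leqn0 => /eqP->.
by rewrite leq_eqVlt => /orP[/eqP->//|/IH h]; apply: leq_trans h (ltnW (node_index_lt j)).
Qed.

Lemma node_lo_homo i j : (i <= j)%N -> (node_lo i <= node_lo j)%N.
Proof. by move=> ij; rewrite /node_lo leqNgt mu_mono -leqNgt node_index_homo. Qed.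

Lemma node_block_between i k : k \in node_block i -> (node_lo i <= k < node_lo i.+1)%N.
Proof. by move=> /node_blockP[j /andP[h1 h2] ->];
rewrite /node_lo leqNgt !mu_mono h2 -leqNgt h1. Qed.

Lemma node_block_disj i j k : k \in node_block i -> k \in node_block j -> i = j.
Proof.
move=> /node_block_between/andP[h1 h2] /node_block_between/andP[h3 h4].
case: (ltngtP i j) => // ij; exfalso.
  by move: (leq_trans h2 (leq_trans (node_lo_homo ij) h3)); rewrite ltnn.
by move: (leq_trans h4 (leq_trans (node_lo_homo ij) h1)); rewrite ltnn.
Qed.

Lemma sorted_node_block i : sorted ltn (node_block i).
Proof.
rewrite sorted_map; apply: sub_sorted (iota_ltn_sorted _ _) => k l /=.
by rewrite mu_mono.
Qed.

Lemma uniq_node_block i : uniq (node_block i).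
Proof. by apply: sorted_uniq (sorted_node_block i); [exact: ltn_trans|exact: ltnn]. Qed.

Lemma size_node_block i : size (node_block i) = block_size (node_colour i).
Proof. by rewrite size_map size_iota. Qed.

Definition last_node_block i := mu (node_index i.+1).-1.

Lemma last_node_block_in i : last_node_block i \in node_block i.
Proof.
apply/node_blockP; exists (node_index i.+1).-1 => //.
by have := node_index_lt i; case: (node_index i.+1) => //= q; rewrite ltnS => ->;
rewrite ltnSn.
Qed.

Lemma node_block_last i k : k \in node_block i -> (k <= last_node_block i)%N.
Proof.
move=> /node_blockP[j /andP[_ h2] ->]; rewrite leqNgt mu_mono -leqNgt.
by move: h2; case: (node_index i.+1).
Qed.

Section TreeBranch.
Variable b : nat -> bool.

Let N n := node (branch_node b n).

Definition branch_set : pred nat := fun k => `[< exists n, k \in node_block (N n) >].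

Lemma NS n : N n.+1 = ((N n).*2.+1 + b n)%N. Proof. exact: node_branch. Qed.

Lemma N_lt n : (N n < N n.+1)%N. Proof. by rewrite NS -addnn; lia. Qed.

Lemma N_homo n m : (n < m)%N -> (N n < N m)%N.
Proof.
elim: m => // m IH; rewrite ltnS leq_eqVlt => /orP[/eqP->|/IH h]; first exact: N_lt.
exact: ltn_trans h (N_lt m).
Qed.

Lemma node_history_branch n : node_history (N n.+1) =
  node_history (N n) ++ node_block (N n).
Proof.
have h : (((N n).*2 + b n)%N)./2 = N n by case: (b n);
rewrite /= ?addn1 ?addn0 /= ?uphalf_double ?doubleK.
by rewrite NS addSn node_historyS h.
Qed.

(** Not [node_lo (N n)]: the rule of [start] opens a new block immediately after the last element of
    the previous one on the branch, before the gap left to other nodes. *)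
Definition bstart n := if n is m.+1 then (last_node_block (N m)).+1 else 0%N.

Lemma bstart_le n : (bstart n <= node_lo (N n))%N.
Proof.
case: n => //= n; have /node_block_between/andP[_ h] := last_node_block_in (N n).
by apply: leq_trans h (node_lo_homo (N_lt n)).
Qed.

Lemma branch_set_between n k : (bstart n <= k < bstart n.+1)%N ->
  branch_set k = (k \in node_block (N n)).
Proof.
move=> /andP[h1 h2]; apply/asboolP/idP => [[m kF]|]; last by exists n.
case: (ltngtP m n) => [mn|nm|<-//].
  have : (bstart m.+1 <= bstart n)%N.
    case: n mn {h1 h2} => // n; rewrite ltnS leq_eqVlt => /orP[/eqP->//|mn].
    apply: leq_trans (bstart_le m.+1) _;
    apply: leq_trans (node_lo_homo (i := N m.+1) (j := N n) _) _.
      by case: (ltngtP m.+1 n) mn => [/N_homo/ltnW//||->].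
    have /node_block_between/andP[h _] := last_node_block_in (N n); exact: leqW.
  move=> /leq_trans/(_ h1) /= h3.
  by have := node_block_last kF; rewrite leqNgt h3.
have /andP[h3 _] := node_block_between kF.
have h4 : (node_lo (N n).+1 <= k)%N by apply: leq_trans h3; apply: node_lo_homo;
exact: N_homo.
have /node_block_between/andP[_ h5] := last_node_block_in (N n).
by have := leq_trans h2 (leq_trans h5 h4); rewrite ltnn.
Qed.

(** The size of a node block is prescribed by the code of its history, which is exactly the closing
    rule of [start]; hence the blocks of [branch_set] are the node blocks, by induction along the
    branch. *)
Lemma branch_start n : [/\ start branch_set (bstart n) = bstart n,
  below branch_set (bstart n) = node_history (N n) &
  forall k, k \in node_block (N n) -> start branch_set k = bstart n].
Proof.
have step m : start branch_set (bstart m) = bstart m ->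
    below branch_set (bstart m) = node_history (N m) ->
    [/\ start branch_set (bstart m.+1) = bstart m.+1,
        below branch_set (bstart m.+1) = node_history (N m) ++ node_block (N m) &
        forall k, (bstart m <= k < bstart m.+1)%N -> start branch_set k = bstart m].
  move=> h1 h2; rewrite -h2; apply: start_block => //.
  - exact: sorted_node_block.
  - by rewrite size_node_block /node_colour -h2.
  - have /node_block_between/andP[h _] := last_node_block_in (N m).
    by rewrite /= ltnS; apply: leq_trans (bstart_le m) h.
  - exact: last_node_block_in.
  - move=> k kF; have /andP[h _] := node_block_between kF.
    by rewrite (leq_trans (bstart_le m) h) ltnS node_block_last.
  - exact: branch_set_between.
have main m : start branch_set (bstart m) = bstart m /\ below branch_set (bstart m) =
  node_history (N m).
  elim: m => [//|m [h1 h2]]; have [h3 h4 _] := step m h1 h2.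
  by rewrite h3 h4 node_history_branch.
have [h1 h2] := main n; have [_ _ h3] := step n h1 h2; split=> // k kF.
apply: h3; have /andP[h _] := node_block_between kF.
by rewrite (leq_trans (bstart_le n) h) ltnS node_block_last.
Qed.

Lemma branch_hyp n k : k \in node_block (N n) ->
  [/\ branch_set k, colour branch_set k = node_colour (N n) & (node_lo (N n) <=
    k < node_lo (N n.+1))%N].
Proof.
move=> kF; split; first by apply/asboolP; exists n.
  by have [_ h1 h2] := branch_start n; rewrite /colour h2// h1.
have /andP[-> h] := node_block_between kF; exact: leq_trans h (node_lo_homo (N_lt n)).
Qed.

Lemma branch_lo n : (node_lo (N n) <= node_lo (N n.+1))%N.
Proof. by apply: node_lo_homo; exact: ltnW (N_lt n). Qed.

Lemma branch_colour_inj : injective (fun n => node_colour (N n)).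
Proof.
have lt n m : (n < m)%N -> (size (node_history (N n)) < size (node_history (N m)))%N.
  elim: m => // m IH; rewrite ltnS node_history_branch size_cat size_node_block leq_eqVlt.
  have p := block_size_gt0 (node_colour (N m)).
  by move=> /orP[/eqP->|/IH]; lia.
move=> n m /(pcan_inj pickleK) e; case: (ltngtP n m) => // /lt; by rewrite e ltnn.
Qed.

End TreeBranch.

End Tree.

Section JamesTree.
Variable R : realType.
Notation X := (jt R).

Lemma block_vec_sum (F : seq nat) h : uniq F ->
  block_vec R F h = \sum_(k <- F) weight R h *: unit_vec R k.
Proof.
move=> uF; apply: jt_ext => k; rewrite jt_sum block_vecE.
under eq_bigr do rewrite jtZ unit_vecE.
case: ifP => kF.
  rewrite (bigD1_seq k)//= eqxx mulr1 big1 ?addr0// => i /negPf.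
  by rewrite eq_sym => ->; rewrite mulr0.
rewrite big_seq big1// => i iF; case: eqP => [e|_]; last by rewrite mulr0.
by rewrite e iF in kF.
Qed.

Lemma block_vec_span (F : seq nat) h (M : set nat) : uniq F -> (forall k, k \in F -> M k) ->
  closed_span (@unit_vec R @` M) (block_vec R F h).
Proof.
move=> uF FM; apply: subset_closure; rewrite block_vec_sum//.
exists (size F), (fun i => unit_vec R (nth 0%N F i)), (fun=> weight R h); split.
  by move=> i; exists (nth 0%N F i) => //; apply: FM; exact: mem_nth.
by rewrite (big_nth 0%N) big_mkord.
Qed.

Lemma unit_vec_james_tree (M : set nat) : infinite_set M ->
  james_tree_property (@unit_vec R) (closed_span (@unit_vec R @` M)).
Proof.
move=> /infinite_set_enum[mu [muM mu_lt mu_onto]].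
have ee_neq0 k : unit_vec R k != 0 by rewrite -normr_eq0 norm_unit_vec oner_eq0.
split.
  exists (fun k => unit_vec R (mu k)).
    exists mu, (fun k => (mu k).+1), (fun=> 1); split.
      by move=> k; split=> //; rewrite big_nat1 scale1r.
    by move=> i j ij; exact: mu_homo.
  congr closed_span; apply/seteqP; split => [_ [m Mm <-]|_ [k _ <-]].
    by have [k <-] := mu_onto m Mm; exists k.
  by exists (mu k).
pose F a := node_block mu (node a).
pose y a := block_vec R (F a) (node_colour mu (node a)).
have Bhyp b := @branch_hyp mu mu_lt b.
have Blo b := @branch_lo mu mu_lt b.
have Binj b := @branch_colour_inj mu b.
have uF b l := @uniq_node_block mu mu_lt (node (branch_node b l)).
have sF b l := @size_node_block mu (node (branch_node b l)).
have FM a k : k \in F a -> M k by move=> /node_blockP[j _ ->].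
(* A branch has value 1 on its own nodes, so a constant below 1 gives the strict inequality. *)
exists y, 2^-1, (fun b => branch_fun (branch_set mu b)); split.
- by move=> a; apply: block_vec_span; [exact: uniq_node_block|exact: FM].
- exists 1, 2; split=> // a; apply/andP; split.
    (* Every node lies on a branch, here its extension by zeros, whose functional yields the lower
       bound. *)
    pose b := nth false a.
    have ab : branch_node b (size a) = a by rewrite /branch_node mkseq_nth.
    have := norm_branch_ge1 R (@Bhyp b) (uF b) (sF b) (size a).
    by rewrite ab.
  by apply: norm_block_vec; [exact: uniq_node_block|exact: size_node_block].
(* One coefficient sequence for all nodes: on a node block its weight, well defined as the blocks
   are disjoint, and 0 elsewhere. *)
- pose P i := exists j, i \in node_block mu j.
  pose a i := if pselect (P i) is left h then weight R (node_colour mu (sval (cid h)))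
    else 0.
  have aE j i : i \in node_block mu j -> a i = weight R (node_colour mu j).
    move=> ij; rewrite /a; case: pselect => [h|hN]; last by exfalso; apply: hN; exists j.
    by congr (weight _ (node_colour _ _)); apply: (node_block_disj mu_lt) ij;
    exact: svalP (cid h).
  have a0 j i : (node_lo mu j <= i < node_lo mu j.+1)%N -> i \notin node_block mu j ->
    a i = 0.
    move=> hi ij; rewrite /a; case: pselect => // -[j' ij']; exfalso.
    have /andP[h1 h2] := hi; have /andP[h3 h4] := node_block_between mu_lt ij'.
    case: (ltngtP j j') => jj.
    + by have := leq_trans h2 (leq_trans (node_lo_homo mu_lt jj) h3); rewrite ltnn.
    + by have := leq_trans h4 (leq_trans (node_lo_homo mu_lt jj) h1); rewrite ltnn.
    + by rewrite jj ij' in ij.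
  exists (fun c => node_lo mu (node c)), (fun c => node_lo mu (node c).+1), a; split.
    move=> c; split.
      rewrite -normr_eq0 gt_eqF// (lt_le_trans ltr01)//.
      pose b := nth false c.
      have cb : branch_node b (size c) = c by rewrite /branch_node mkseq_nth.
      have := norm_branch_ge1 R (@Bhyp b) (uF b) (sF b) (size c).
      by rewrite cb.
    apply: jt_ext => k; rewrite sum_unit_vec block_vecE; case: ifP => kF.
      by rewrite (node_block_between mu_lt kF) (aE _ _ kF).
    by case: ifP => // hk; rewrite (a0 _ _ hk)// kF.
  by move=> c d cd; apply: node_lo_homo => //; exact: node_homo.
- by rewrite invr_gt0.
split.
- by move=> b; exact: branch_fun_continuous.
- by exists 1 => b x; rewrite mul1r; exact: branch_fun_le.
move=> b; split.
- split.
    exact: (@branch_weakly_cauchy R (branch_set mu b) (fun l => F (branch_node b l))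
      (fun l => node_colour mu (node (branch_node b l))) (fun l =>
        node_lo mu (node (branch_node b l)))
      (@Bhyp b) (Blo b) (uF b) (sF b) (Binj b)).
  exact: (@branch_not_weakly_convergent R (branch_set mu b) (fun l => F (branch_node b l))
      (fun l => node_colour mu (node (branch_node b l))) (fun l =>
        node_lo mu (node (branch_node b l)))
      (@Bhyp b) (uF b) (sF b) (Binj b)).
- exists 1; last by rewrite invf_lt1// ltr1n.
  have E l : branch_fun (branch_set mu b) (y (branch_node b l)) = 1.
    exact: (branch_fun_branch R (@Bhyp b) (uF b) (sF b) l).
  by apply: cvg_near_cst; exists 0%N => // l _; exact: E.
(* From level [n0] on the nodes of [b] are off [b1], so their blocks miss the set of [b1] and the
   values are exactly 0. *)
move=> b1 bb1; have [n0 hn0] := node_branch_diff bb1.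
apply: cvg_near_cst; exists n0 => // n /= n0n.
pose N := node_lo mu (node (branch_node b n)).+1.
rewrite (@branch_fun_fin _ _ (y (branch_node b n)) N) => [|k Nk]; last first.
  rewrite block_vecE; case: ifP => // /(node_block_between mu_lt)/andP[_].
  by rewrite ltnNge -/N Nk.
rewrite branch_partE big1// => k _; case: ifP => [/asboolP[m km]|_]; last by rewrite mul0r.
rewrite block_vecE; case: ifP => [kn|]; last by rewrite mulr0.
by exfalso; apply: (hn0 n n0n m); exact: (node_block_disj mu_lt kn km).
Qed.

End JamesTree.

(** * Saturation by l2 *)

Section AlternatingSums.
Variable R : realType.
Notation X := (jt R).

(** The terms alternate from the first [m] with [P m] on, so the sum is 0 or
    [((-1)^m - (-1)^n) / 2]. *)
Lemma alt_upclosed (P : pred nat) n : (forall i j, (i <= j)%N -> P i -> P j) ->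
  `|\sum_(0 <= i < n) (-1) ^+ i * (P i)%:R : R| <= 1.
Proof.
move=> up; pose g n : R := \sum_(0 <= i < n) (-1) ^+ i * (P i)%:R.
have gS k : g k.+1 = g k + (-1) ^+ k * (P k)%:R by rewrite /g big_nat_recr.
have : ((forall i, (i < n)%N -> ~~ P i) /\ g n = 0) \/
    exists m, [/\ (m < n)%N, P m & g n = ((-1) ^+ m - (-1) ^+ n) / 2].
  elim: n => [|n IH]; first by left; split=> //; rewrite /g big_geq.
  rewrite gS.
  case: IH => [[h1 ->]|[m [mn Pm ->]]].
    case: (boolP (P n)) => Pn.
      by right; exists n; split=> //; rewrite add0r /= mulr1 exprS; field.
    left; split; last by rewrite mulr0 addr0.
    by move=> i; rewrite ltnS leq_eqVlt => /orP[/eqP->//|/h1].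
  right; exists m; split=> //; first exact: ltnW.
  by rewrite (up m n (ltnW mn) Pm) /= mulr1 exprS; field.
have s1 k : `|(-1) ^+ k : R| <= 1 by rewrite normrX normrN1 expr1n.
rewrite -/(g n) => -[[_ ->]|[m [_ _ ->]]]; first by rewrite normr0.
rewrite normrM [X in _ * X]ger0_norm ?invr_ge0// ler_pdivrMr//.
apply: le_trans (ler_normB _ _) _.
by rewrite mul1r (_ : (2 : R) = 1 + 1)// lerD.
Qed.

(** [t i] lists the histories that can lead to a value above [eps] on [x i], [B r] is the limit of
    their [r]-th entries and [beta r] the limit of the values of [B r]. *)
Variables (x : nat -> X) (S E : nat -> nat) (eps : R) (K : nat).
Variables (t : nat -> seq (seq nat)) (B : nat -> pred nat) (beta : nat -> R).
Hypothesis eps0 : 0 <= eps.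
Hypothesis x1 : forall i, `|x i| <= 1.
Hypothesis x_outside : forall i k, ~~ (S i <= k < E i)%N -> x i k = 0.
Hypothesis SE : forall i, (S i <= E i)%N.
Hypothesis ES : forall i, (E i <= S i.+1)%N.
Hypothesis hist : forall i s, eps < `|seg_eval s (x i)| ->
  exists2 r, (r < K)%N & below (seg_set s) (start (seg_set s) (S i)) = nth [::] (t i) r.
Hypothesis limB : forall i i' r k, (i < i')%N -> (r < K)%N -> (k < E i)%N ->
  (k \in nth [::] (t i') r) = B r k.
Hypothesis limbeta : forall i r, (r < K)%N ->
  `|seg_eval (Seg (B r) 0 (E i)) (x i) - beta r| <= eps.
Hypothesis colour_sparse : forall j, exists i0, forall i s, i <> i0 ->
  `|colour_eval j s (E i) (x i)| <= eps.

Lemma S_homo i j : (i <= j)%N -> (S i <= S j)%N.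
Proof.
elim: j => [|j IH]; first by rewrite leqn0 => /eqP->.
rewrite leq_eqVlt => /orP[/eqP->//|/IH h].
exact: leq_trans h (leq_trans (SE j) (ES j)).
Qed.

Lemma ES_lt i j : (i < j)%N -> (E i <= S j)%N.
Proof. by move=> ij; apply: leq_trans (ES i) (S_homo ij). Qed.

Lemma seg_eval_x s i : seg_eval s (x i) = \sum_(0 <= k < E i) seg_coef R s k * x i k.
Proof.
by apply: seg_eval_fin => k Ek; apply: x_outside; rewrite negb_and -!ltnNge ltnS Ek orbT.
Qed.

(* The last term is the block of the segment which is unfinished at S i0. *)
Lemma seg_before s i0 r i : (r < K)%N ->
  below (seg_set s) (start (seg_set s) (S i0)) = nth [::] (t i0) r ->
  (i < i0)%N -> (seg_lo s <= S i)%N -> (S i0 < seg_hi s)%N ->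
  seg_eval s (x i) = seg_eval (Seg (B r) 0 (E i)) (x i) +
    colour_eval (colour (seg_set s) (S i0)) s (E i) (x i).
Proof.
move=> rK ht ii0 pS qS; rewrite !seg_eval_x -big_split/=.
apply: eq_big_nat => k /andP[_ kE]; rewrite -mulrDl.
case: (boolP (S i <= k < E i)%N) => [/andP[Sk _]|/x_outside->]; last by rewrite !mulr0.
congr (_ * _); set A := seg_set s in ht *; set u := start A (S i0) in ht *.
have kS0 : (k < S i0)%N by exact: leq_trans kE (ES_lt ii0).
have AB k' : (k' < E i)%N -> B r k' = (k' < u)%N && A k'.
  by move=> k'E; rewrite -(limB ii0 rK k'E) -ht mem_below.
have suppk : seg_supp s k = A k.
  by rewrite /seg_supp (leq_trans pS Sk) (ltn_trans kS0 qS).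
rewrite /seg_coef /colour_coef suppk {1}/seg_supp /= kE /= /seg_colour /=.
case: (ltnP k u) => ku.
  have -> : colour A k = colour (B r) k.
    apply: eq_colour => k' k'k; rewrite AB ?(ltn_trans k'k)//.
  rewrite AB// ku/=; case: (A k) => /=; last by rewrite addr0.
  case: eqP => [e|_]; last by rewrite addr0.
  exfalso; have := start_le (B r) k; rewrite leqNgt; apply/negP; rewrite negbK.
  have [-> _] : start (B r) k = start A (S i0) /\ _ := colour_inj e.
  exact: ku.
rewrite AB// ltnNge ku /= add0r.
have -> : colour A k = colour A (S i0).
  by rewrite /colour (start_between ku (ltnW kS0)).
by rewrite eqxx andbT.
Qed.

Lemma seg_eval_sum s (N : nat) (a : nat -> R) :
  seg_eval s (\sum_(0 <= i < N) a i *: x i) = \sum_(0 <= i < N) a i * seg_eval s (x i).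
Proof.
rewrite /seg_eval; under eq_bigr => k _.
  rewrite jt_sum mulr_sumr.
  under eq_bigr => i _ do rewrite jtZ mulrCA.
  over.
by rewrite exchange_big/=; apply: eq_bigr => i _; rewrite mulr_sumr.
Qed.

(** Let [i0] be the last block on which the segment exceeds [eps]. Before it the values are close to
    [beta r] on blocks beyond [seg_lo s] and vanish on blocks below it; the alternating sum of these
    model values is at most 2. Exceptions are [i0] and [j1], at cost 1 each, and [j0], at cost 3;
    the other errors total at most [2 N eps <= 2]. Thus [9 = 2 + 7]. *)
Lemma alt_sum_seg_le s N : N%:R * eps <= 1 -> eps <= 1 ->
  `|seg_eval s (\sum_(0 <= i < N) (-1) ^+ i *: x i)| <= 9.
Proof.
move=> Neps eps1; rewrite seg_eval_sum.
have s1 k : `|(-1) ^+ k : R| = 1 by rewrite normrX normrN1 expr1n.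
have [hall|hN] := pselect (forall i, (i < N)%N -> `|seg_eval s (x i)| <= eps).
  apply: le_trans (ler_norm_sum _ _ _) _.
  apply: le_trans (_ : \sum_(0 <= i < N) eps <= _).
    by apply: ler_sum_nat => i /andP[_ iN]; rewrite normrM s1 mul1r hall.
  rewrite big_const_nat subn0 iter_addr_0 -[leLHS]mulr_natl (le_trans Neps)//.
  by rewrite ler1n.
have [i0 [i0N hi0 hlast]] : exists i0, [/\ (i0 < N)%N, eps < `|seg_eval s (x i0)| &
    forall i, (i < N)%N -> (i0 < i)%N -> `|seg_eval s (x i)| <= eps].
  pose Q i := (i < N)%N && (eps < `|seg_eval s (x i)|).
  have exQ : exists i, Q i.
    apply: contrapT => h; apply: hN => i iN; rewrite leNgt; apply/negP => hi.
    by apply: h; exists i; rewrite /Q iN.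
  have ubQ i : Q i -> (i <= N)%N by move=> /andP[/ltnW].
  case: (ex_maxnP exQ ubQ) => i0 /andP[h1 h2] h3; exists i0; split=> // i iN i0i.
  rewrite leNgt; apply/negP => hi; move: i0i.
  by rewrite ltnNge h3// /Q iN.
have [r rK hr] := hist hi0.
(* The block of the segment unfinished at [S i0] is not part of [B r]; it has one colour, hence
   matters on one [x i] only. *)
have [j0 hj0] := colour_sparse (colour (seg_set s) (S i0)).
have qS : (S i0 < seg_hi s)%N.
  rewrite ltnNge; apply/negP => qS; move: hi0;
  rewrite seg_eval_x big1_seq ?normr0 ?ltNge ?eps0//.
  move=> k _; case: (boolP (S i0 <= k < E i0)%N) => [/andP[Sk _]|/x_outside->];
  last by rewrite mulr0.
  by rewrite /seg_coef /seg_supp ltnNge (leq_trans qS Sk) andbF mul0r.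
(* At most one block is cut by the lower end of the segment. *)
have [j1 hj1] : exists j1, forall i, i <> j1 -> (S i < seg_lo s)%N -> (E i <= seg_lo s)%N.
  have [[j h]|h] := pselect (exists j, (S j < seg_lo s < E j)%N).
    exists j => i ij Si; rewrite leqNgt; apply/negP => Ei.
    move: h => /andP[h1 h2]; case: (ltngtP i j) => // hij.
      by have := leq_trans (ltn_trans h1 Ei) (ES_lt hij); rewrite ltnn.
    by have := leq_trans (ltn_trans Si h2) (ES_lt hij); rewrite ltnn.
  exists 0%N => i _ Si; rewrite leqNgt; apply/negP => Ei.
  by apply: h; exists i; rewrite Si Ei.
have le1 i : `|seg_eval s (x i)| <= 1 := le_trans (seg_le s (x i)) (x1 i).
have beta2 : `|beta r| <= 2.
  have h1 := limbeta 0 rK.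
  have h2 := le_trans (seg_le (Seg (B r) 0 (E 0%N)) (x 0%N)) (x1 0%N).
  rewrite -(subKr (seg_eval (Seg (B r) 0 (E 0%N)) (x 0%N)) (beta r)).
  apply: le_trans (ler_normB _ _) _.
  by rewrite (_ : (2 : R) = 1 + 1)// lerD// (le_trans h1).
pose P i := (seg_lo s <= S i)%N.
pose I i : R := ((i < i0)%N && P i)%:R.
pose err i := seg_eval s (x i) - I i * beta r.
have herr i : (i < N)%N -> `|err i| <=
    2 * eps + ((i == i0)%:R * 1 + (i == j1)%:R * 1 + (i == j0)%:R * 3).
  move=> iN.
  have n0 (b : bool) (c : R) : 0 <= c -> 0 <= b%:R * c by move=> c0; rewrite mulr_ge0.
  have e2 : 0 <= 2 * eps by rewrite mulr_ge0.
  have := n0 (i == i0) 1 ler01; have : i = i0 -> (i == i0)%:R * 1 = 1 :> R.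
    by move=> ->; rewrite eqxx mul1r.
  have := n0 (i == j1) 1 ler01; have : i = j1 -> (i == j1)%:R * 1 = 1 :> R.
    by move=> ->; rewrite eqxx mul1r.
  have := n0 (i == j0) 3 (ler0n R 3); have : i = j0 -> (i == j0)%:R * 3 = 3 :> R.
    by move=> ->; rewrite eqxx mul1r.
  move: (_ * 1) (_ * 1) (_ * 3) => d0 d1 d3 q3 p3 q1 p1 q0 p0.
  have li := le1 i.
  rewrite /err /I; case: (ltngtP i i0) => ii0 /=.
  - case: (boolP (P i)) => Pi; last first.
      rewrite mul0r subr0; have [/q1 e|ij1] := pselect (i = j1); first by lra.
      have Ei : (E i <= seg_lo s)%N by apply: hj1 => //; rewrite ltnNge.
      rewrite seg_eval_x big_nat big1 ?normr0 => [|k /andP[_ kE]]; first by lra.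
      by rewrite /seg_coef /seg_supp leqNgt (leq_trans kE Ei) mul0r.
    rewrite mul1r; have [/q3 e|ij0] := pselect (i = j0).
      by have := ler_normB (seg_eval s (x i)) (beta r); lra.
    rewrite (seg_before rK hr ii0 Pi qS) addrAC.
    apply: le_trans (ler_normD _ _) _.
    by have := limbeta i rK; have := hj0 i s ij0; lra.
  - by rewrite mul0r subr0; have := hlast i iN ii0; lra.
  - by rewrite mul0r subr0; have := q0 ii0; lra.
have -> : \sum_(0 <= i < N) (-1) ^+ i * seg_eval s (x i) =
    beta r * (\sum_(0 <= i < i0) (-1) ^+ i * (P i)%:R) + \sum_(0 <=
      i < N) (-1) ^+ i * err i.
  have -> : \sum_(0 <= i < i0) (-1) ^+ i * (P i)%:R = \sum_(0 <= i < N) (-1) ^+ i * I i.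
    rewrite [RHS](big_cat_nat (n := i0))/= ?(ltnW i0N)// [X in _ = _ + X]big_nat.
    rewrite [X in _ = _ + X]big1 ?addr0 => [|i /andP[h _]].
      by apply: eq_big_nat => i /andP[_ h]; rewrite /I h.
    by rewrite /I ltnNge h mulr0.
  rewrite mulr_sumr -big_split/=; apply: eq_bigr => i _; rewrite /err; ring.
have upP i j : (i <= j)%N -> P i -> P j.
  by move=> ij Pi; apply: leq_trans Pi (S_homo ij).
apply: le_trans (ler_normD _ _) _.
have h1 : `|beta r * (\sum_(0 <= i < i0) (-1) ^+ i * (P i)%:R)| <= 2.
  by rewrite normrM -[leRHS]mulr1 ler_pM// alt_upclosed.
have h2 : `|\sum_(0 <= i < N) (-1) ^+ i * err i| <= 7.
  apply: le_trans (ler_norm_sum _ _ _) _.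
  apply: le_trans (ler_sum_nat (G := fun i => 2 * eps +
      ((i == i0)%:R * 1 + (i == j1)%:R * 1 + (i == j0)%:R * 3)) _) _.
    by move=> i /andP[_ iN]; rewrite normrM s1 mul1r herr.
  rewrite !big_split/= !(sum_delta (fun=> 1)) (sum_delta (fun=> 3)).
  have -> : \sum_(0 <= i < N) 2 * eps = 2 * (N%:R * eps).
    by rewrite big_const_nat subn0 iter_addr_0 -[LHS]mulr_natl mulrCA.
  by do 3 case: ifP => _; lra.
by rewrite (_ : (9 : R) = 2 + 7) ?lerD//; ring.
Qed.

End AlternatingSums.

(** Extend a duplicate-free list as long as possible: the bound stops this, and a list without
    extension covers [P]. *)
Lemma cover_of_uniq_bound (T : choiceType) (P : T -> Prop) (K : nat) :
  (forall s : seq T, uniq s -> (forall x, x \in s -> P x) -> (size s <= K)%N) ->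
  exists s : seq T, (size s <= K)%N /\ forall x, P x -> x \in s.
Proof.
move=> h.
have H n : (exists s : seq T, [/\ uniq s, forall x, x \in s -> P x & size s = n]) \/
    (exists s : seq T, (size s <= K)%N /\ forall x, P x -> x \in s).
  elim: n => [|n [[s [us Ps sn]]|]]; [by left; exists [::]| |by right].
  have [[x [Px xs]]|hN] := pselect (exists x, P x /\ x \notin s).
    left; exists (x :: s); split=> /=; [by rewrite xs| |by rewrite sn].
    by move=> y; rewrite inE => /orP[/eqP->|/Ps].
  right; exists s; split; first exact: h.
  by move=> x Px; apply: contrapT => /negP xs; apply: hN; exists x.
case: (H K.+1) => // -[s [us Ps sn]].
by have := h s us Ps; rewrite sn ltnn.
Qed.

(** * Subspaces, spans and kernels *)

Section SpanSubspace.
Variable (R : realType) (X : normedModType R).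
Variable Y : set X.
Hypothesis hY : Defs.subspace Y.

Lemma subspace0 : Y 0.
Proof. by have [h _] := hY; move: h; rewrite inE. Qed.

Lemma subspaceD (a : R) x y : Y x -> Y y -> Y (a *: x + y).
Proof.
by move=> Yx Yy; have [_ h] := hY; have := h a x y; rewrite !inE; apply.
Qed.

Lemma subspaceZ (a : R) x : Y x -> Y (a *: x).
Proof. by move=> Yx; rewrite -[_ *: _]addr0; apply: subspaceD => //; exact: subspace0. Qed.

Lemma subspace_sum (I : Type) (r : seq I) (P : pred I) (a : I -> R) (v : I -> X) :
  (forall i, Y (v i)) -> Y (\sum_(i <- r | P i) a i *: v i).
Proof.
move=> h; elim/big_ind: _ => [|x y Yx Yy|i _]; [exact: subspace0| |exact: subspaceZ].
by rewrite -[x]scale1r; exact: subspaceD.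
Qed.

Lemma span_sub (A : set X) : A `<=` Y -> linear_span A `<=` Y.
Proof. by move=> AY _ [n [v [a [hv ->]]]]; apply: subspace_sum => i; exact: AY. Qed.

(** Over the kernel, one further vector spans [Y]. Applied to successive coordinates, this produces
    vectors of [Y] with many vanishing initial coordinates. *)
Lemma not_fd_kernel (f : {linear X -> R^o}) : ~ finite_dimensional Y ->
  ~ finite_dimensional (Y `&` [set y | f y = 0]).
Proof.
move=> nfd [A finA eA]; apply: nfd.
have spA x : A x -> linear_span A x.
  move=> Ax; exists 1%N, (fun=> x), (fun=> 1); split=> //.
  by rewrite big_ord1 scale1r.
have [[v [Yv fv]]|hN] := pselect (exists v, Y v /\ f v != 0); last first.
  exists A => //; rewrite -eA; apply/seteqP; split => [y Yy|y []//]; split=> //=.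
  by apply: contrapT => /eqP fy; apply: hN; exists y.
exists (A `|` [set v]); first by rewrite finite_setU; split=> //; exact: finite_set1.
apply/seteqP; split => [y Yy|]; last first.
  apply: span_sub => y [/spA|->//]; by rewrite -eA => -[].
have : linear_span A (- (f y / f v) *: v + y).
  rewrite -eA; split; first exact: subspaceD.
  by rewrite /= linearD linearZ /= scaleNr [X in - X]mulfVK// addNr.
move=> [n [w [a [Aw e]]]].
exists n.+1, (fun i => oapp w v (unlift ord0 i)), (fun i =>
  oapp a (f y / f v) (unlift ord0 i)).
split.
  by move=> i; case: (unlift ord0 i) => [j|] /=; [left|right].
rewrite big_ord_recl unlift_none /=.
under eq_bigr do rewrite liftK /=.
by rewrite -e scaleNr addrA addrN add0r.
Qed.

End SpanSubspace.

Lemma block_coord_le (R : realType) (x : nat -> jt R) (S E : nat -> nat) (a : nat -> R)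
    (A : R) n k :
  (forall i k, ~~ (S i <= k < E i)%N -> x i k = 0) ->
  (forall i, (S i <= E i)%N) -> (forall i, (E i <= S i.+1)%N) ->
  (forall i, `|x i| <= 1) -> 0 <= A -> (forall i, (i < n)%N -> `|a i| <= A) ->
  `|(\sum_(0 <= i < n) a i *: x i : jt R) k| <= A.
Proof.
move=> xs SE ES x1 A0 aA; rewrite jt_sum.
have [[l [ln hl]]|hN] := pselect (exists l, (l < n)%N /\ (S l <= k < E l)%N); last first.
  rewrite big_nat big1 ?normr0// => i /andP[_ iN]; rewrite jtZ xs ?mulr0//.
  by apply/negP => h; apply: hN; exists i.
rewrite (bigD1_seq l) ?mem_index_iota ?iota_uniq// big1 => [|i il].
  rewrite [X in `|X|]addr0 jtZ normrM -[leRHS]mulr1 ler_pM ?aA//.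
  exact: le_trans (coord_le _ _) (x1 l).
rewrite jtZ xs ?mulr0//; apply/negP => /andP[h3 h4]; move: hl => /andP[h5 h6].
case: (ltngtP i l) il => // hil _.
  by have := leq_trans h4 (leq_trans (ES_lt SE ES hil) h5); rewrite ltnn.
by have := leq_trans h6 (leq_trans (ES_lt SE ES hil) h3); rewrite ltnn.
Qed.

(** * Gliding humps and flat vectors *)

Section SmallSegments.
Variable R : realType.
Notation X := (jt R).
Notation kappa := (kappa R).
Variable Y : set X.
Hypothesis hY : Defs.subspace Y.
Hypothesis nfdY : ~ finite_dimensional Y.

Lemma tail_unit n : exists y, [/\ Y y, `|y| = 1 & forall k, (k < n)%N -> y k = 0].
Proof.
pose YT n := [set y : X | Y y /\ forall k, (k < n)%N -> y k = 0].
have subYT m : Defs.subspace (YT m).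
  split; first by rewrite inE; split=> //; exact: subspace0.
  move=> a x y; rewrite !inE => -[Yx hx] [Yy hy]; split; first exact: subspaceD.
  by move=> k km; rewrite jtD jtZ hx// hy// mulr0 addr0.
have nfdYT m : ~ finite_dimensional (YT m).
  elim: m => [|m IH].
    by have -> : YT 0%N = Y by apply/seteqP; split => [y []|y Yy].
  have -> : YT m.+1 = YT m `&` [set y | coord m y = 0].
    apply/seteqP; split => [y [Yy hy]|y [[Yy hy] ym]].
      split; last exact: hy.
      by split=> // k km; apply: hy; exact: ltnW.
    by split=> // k; rewrite ltnS leq_eqVlt => /orP[/eqP->|/hy].
  exact: not_fd_kernel.
have [y [[Yy hy] y0]] : exists y, YT n y /\ y != 0.
  apply: contrapT => h; apply: (nfdYT n); exists set0 => //.
  apply/seteqP; split => [y Yy|_ [m [v [a [hv ->]]]]].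
    exists 0%N, (fun=> 0), (fun=> 0); split=> [[]//|].
    by rewrite big_ord0; apply: contrapT => /eqP y0; apply: h; exists y.
  case: m v a hv => [|m] v a hv; last by have := hv ord0.
  by rewrite big_ord0; exact: subspace0.
have ny : 0 < `|y| by rewrite normr_gt0.
exists (`|y|^-1 *: y); split; first exact: subspaceZ.
  by rewrite normrZ ger0_norm ?invr_ge0// mulVf// gt_eqF.
by move=> k kn; rewrite jtZ hy// mulr0.
Qed.

(** Gliding hump: the next position is taken so far out that the chosen vector nearly lives before
    it. [P] and [eta] depend on the position reached, so smallness can be demanded relative to where
    the support begins. *)
Lemma chain (P : nat -> X -> Prop) (eta : nat -> R) :
  (forall s, 0 < eta s) ->
  (forall s, exists z, [/\ Y z, `|z| = 1, forall k, (k < s)%N -> z k = 0 & P s z]) ->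
  forall s0, exists (s : nat -> nat) (z : nat -> X), s 0%N = s0 /\
    forall l, [/\ (s l < s l.+1)%N, Y (z l), `|z l| = 1,
      forall k, (k < s l)%N -> z l k = 0 &
      P (s l) (z l) /\ `|z l - proj (s l) (s l.+1) (z l)| <= eta (s l)].
Proof.
move=> eta0 hz s0.
have {hz} : forall s, exists zt : X * nat, [/\ (s < zt.2)%N, Y zt.1, `|zt.1| = 1,
    forall k, (k < s)%N -> zt.1 k = 0 & P s zt.1 /\ `|zt.1 - proj s zt.2 zt.1| <= eta s].
  move=> s; have [z [Yz z1 zs Pz]] := hz s.
  have [N hN] := tail_cvg z (eta0 s).
  exists (z, maxn N s.+1) => /=; split=> //; first by rewrite leq_max ltnSn orbT.
  split=> //; suff -> : proj s (maxn N s.+1) z = proj 0 (maxn N s.+1) z.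
    by apply: hN; exact: leq_maxl.
  apply: jt_ext => k; rewrite !projE leq0n/=; case: (leqP s k) => //= ks.
  by rewrite zs// if_same.
move=> /choice[g hg].
exists (fun l => iter l (fun s => (g s).2) s0), (fun l => (g (iter l (fun s =>
  (g s).2) s0)).1).
by split=> // l; exact: hg.
Qed.

Lemma lower_blocks (x : nat -> X) (S E : nat -> nat) (a : nat -> R) N :
  (forall i k, ~~ (S i <= k < E i)%N -> x i k = 0) ->
  (forall i, (S i <= E i)%N) -> (forall i, (E i <= S i.+1)%N) ->
  kappa ^+ 2 * \sum_(0 <= i < N) a i ^+ 2 * `|x i| ^+ 2 <=
    `|\sum_(0 <= i < N) a i *: x i| ^+ 2.
Proof.
move=> xs SE ES; apply: le_trans (sqnorm_norm _).
elim: N => [|N IH]; first by rewrite !big_geq// mulr0 sqnorm_ge0.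
rewrite !big_nat_recr//= mulrDr.
apply: le_trans (@sqnorm_add _ _ _ (S N) _ _).
- rewrite lerD//; apply: le_trans (kappa_sqnorm _).
  by rewrite normrZ exprMn real_normK ?num_real.
- move=> k Sk; rewrite jt_sum big_nat big1// => i /andP[_ iN].
  rewrite jtZ xs ?mulr0// negb_and -!ltnNge ltnS; apply/orP; right.
  exact: leq_trans (ES_lt SE ES iN) Sk.
- by move=> k kS; rewrite jtZ xs ?mulr0// leqNgt kS.
Qed.

Lemma large_square (C : R) : 0 <= C ->
  exists2 m, (0 < m)%N & C <= kappa * m%:R / 2 - 1.
Proof.
move=> C0; have k0 := @kappa_gt0 R.
have h0 : 0 <= (C + 1) * 2 / kappa by rewrite divr_ge0 ?(ltW k0)// mulr_ge0// addr_ge0.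
exists (Num.bound ((C + 1) * 2 / kappa)).+1 => //.
have := archi_boundP h0; rewrite ltr_pdivrMr// -[in leRHS]addn1 natrD.
by set b := (Num.bound _)%:R => h; rewrite mulrDr mulr1; lra.
Qed.

(** Each [x i] keeps norm at least 1/2, so [lower_blocks] on [m ^ 2] of them gives [kappa m / 2];
    replacing [x] by [z] changes the sum by at most 1. *)
Lemma block_average (x z : nat -> X) (S E : nat -> nat) (a : nat -> R) (m : nat) :
  (forall i k, ~~ (S i <= k < E i)%N -> x i k = 0) ->
  (forall i, (S i <= E i)%N) -> (forall i, (E i <= S i.+1)%N) ->
  (0 < m)%N -> (forall i, `|z i| = 1) -> (forall i, `|a i| = 1) ->
  (forall i, `|z i - x i| <= (2 * (m ^ 2)%:R)^-1) ->
  `|\sum_(0 <= i < m ^ 2) a i *: z i - \sum_(0 <= i < m ^ 2) a i *: x i| <= 1 /\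
  kappa * m%:R / 2 - 1 <= `|\sum_(0 <= i < m ^ 2) a i *: z i|.
Proof.
move=> xs SE ES m0 z1 a1 zx.
have M1 : (1 : R) <= (m ^ 2)%:R by rewrite ler1n expn_gt0 m0.
have M0 : (0 : R) < (m ^ 2)%:R by rewrite (lt_le_trans ltr01).
have h1 : `|\sum_(0 <= i < m ^ 2) a i *: z i - \sum_(0 <= i < m ^ 2) a i *: x i| <= 1.
  rewrite -sumrB; apply: le_trans (ler_norm_sum _ _ _) _.
  apply: le_trans (_ : \sum_(0 <= i < m ^ 2) (2 * (m ^ 2)%:R)^-1 <= _).
    by apply: ler_sum => i _; rewrite -scalerBr normrZ a1 mul1r.
  rewrite big_const_nat subn0 iter_addr_0 -[leLHS]mulr_natl invfM mulrCA divff ?gt_eqF//.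
  by rewrite mulr1 invf_le1// ler1n.
split=> //.
have x2 i : 2^-1 <= `|x i|.
  have h2 : `|z i| <= `|z i - x i| + `|x i| by rewrite -{1}(subrK (x i) (z i)) ler_normD.
  have h3 : (2 * (m ^ 2)%:R)^-1 <= 2^-1 :> R.
    by rewrite lef_pV2 ?posrE ?mulr_gt0// ler_peMr.
  have := zx i; rewrite z1 in h2; lra.
have h2 := @lower_blocks x S E a (m ^ 2)%N xs SE ES.
have h3 : (kappa * m%:R / 2) ^+ 2 <= `|\sum_(0 <= i < m ^ 2) a i *: x i| ^+ 2.
  apply: le_trans h2; rewrite -mulrA exprMn ler_wpM2l ?sqr_ge0//.
  apply: le_trans (_ : \sum_(0 <= i < m ^ 2) (2^-1 ^+ 2 : R) <= _).
    by rewrite big_const_nat subn0 iter_addr_0 -[leRHS]mulr_natl exprMn natrX.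
  apply: ler_sum => i _; rewrite -(@real_normK _ (a i)) ?num_real// a1 expr1n mul1r.
  by rewrite ler_sqr ?nnegrE.
have h4 : kappa * m%:R / 2 <= `|\sum_(0 <= i < m ^ 2) a i *: x i|.
  by rewrite -ler_sqr ?nnegrE// !mulr_ge0// ltW// kappa_gt0.
have := ler_normB (\sum_(0 <= i < m ^ 2) a i *: z i)
  (\sum_(0 <= i < m ^ 2) a i *: z i - \sum_(0 <= i < m ^ 2) a i *: x i).
rewrite subKr; lra.
Qed.

(** A sum of [m ^ 2] almost disjoint unit vectors has coordinates at most 2, namely 1 from the
    disjoint blocks and 1 from the perturbation, while its norm grows like [m]; normalization makes
    it flat. *)
Lemma flat_unit (delta : R) s0 : 0 < delta ->
  exists v, [/\ Y v, `|v| = 1, forall k, (k < s0)%N -> v k = 0 & forall k, `|v k| <= delta].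
Proof.
move=> d0; have [m m0 hm] := @large_square (2 / delta) (divr_ge0 (ler0n _ _) (ltW d0)).
have M0 : 0 < (2 * (m ^ 2)%:R)^-1 :> R by rewrite invr_gt0 mulr_gt0// ltr0n expn_gt0 m0.
have [s [z [s0E hz]]] := @chain (fun _ _ => True) (fun=> (2 * (m ^ 2)%:R)^-1) (fun=> M0)
  (fun s => let: ex_intro y (And3 a b c) := tail_unit s in ex_intro _ y (And4 a b c I)) s0.
pose x l := proj (s l) (s l.+1) (z l).
have ss l : (s l <= s l.+1)%N by have [/ltnW] := hz l.
have xs i k : ~~ (s i <= k < s i.+1)%N -> x i k = 0 by rewrite projE => /negbTE ->.
have [h1 h2] := @block_average x z s (fun l => s l.+1) (fun=> 1) m xs ss (fun l =>
  leqnn _) m0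
  (fun l => let: And5 _ _ h _ _ := hz l in h) (fun=> normr1 R)
  (fun l => let: And5 _ _ _ _ (conj _ h) := hz l in h).
set v := \sum_(0 <= i < m ^ 2) 1 *: z i in h1 h2.
set w := \sum_(0 <= i < m ^ 2) 1 *: x i in h1.
have nv : 0 < `|v| by apply: lt_le_trans (le_trans hm h2); rewrite divr_gt0.
have x1 l : `|x l| <= 1.
  by apply: le_trans (norm_proj _ _ _) _; have [_ _ ->] := hz l.
have w1 k : `|w k| <= 1.
  by apply: (block_coord_le k xs ss (fun l => leqnn _) x1 ler01) => i _; rewrite normr1.
exists (`|v|^-1 *: v); split.
- apply: subspaceZ => //; apply: subspace_sum => // i; by have [] := hz i.
- by rewrite normrZ ger0_norm ?invr_ge0// mulVf// gt_eqF.
- move=> k ks; rewrite jtZ jt_sum big1 ?mulr0// => i _.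
  rewrite jtZ; have [_ _ _ -> //] := hz i; first by rewrite mulr0.
  by apply: leq_trans ks _; rewrite -s0E; exact: (S_homo ss (fun l => leqnn _) (leq0n i)).
- move=> k; rewrite jtZ normrM ger0_norm ?invr_ge0// ler_pdivrMl// mulrC.
  have : `|v k| <= 2.
    have := coord_le (v - w) k; rewrite jtB => h3.
    have := ler_normD (v k - w k) (w k); rewrite subrK; have := w1 k; lra.
  move=> /le_trans; apply; rewrite mulrC -ler_pdivrMr//.
  exact: le_trans hm h2.
Qed.

End SmallSegments.

(** * Limits of histories along an ultrafilter *)

Section LimitHistories.
Variable R : realType.

(** [beta] is the limit along [U], written as the supremum of the levels that [u] reaches on a set
    of [U]. *)
Lemma ultra_limit (U : set_system nat) (u : nat -> R) (eps : R) : UltraFilter U ->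
  (forall l, `|u l| <= 1) -> 0 < eps ->
  exists beta, U [set l | `|u l - beta| <= eps].
Proof.
move=> UU u1 e0; pose A := [set r | U [set l | r <= u l]].
have supA : has_sup A.
  split.
    exists (-1); rewrite /A /=; apply: filterS filterT => l _ /=.
    by have := u1 l; rewrite ler_norml => /andP[].
  exists 1 => r /filter_ex[l /= h]; apply: le_trans h _.
  by have := u1 l; rewrite ler_norml => /andP[].
exists (sup A).
have [r Ar hr] := sup_adherent e0 supA.
have [h|h] := in_ultra_setVsetC [set l | sup A + eps <= u l] UU.
  have : sup A + eps <= sup A by apply: ub_le_sup => //; case: supA.
  by rewrite gerDl leNgt e0.
apply: filterS (filterI Ar h) => l /= [h1 /negP]; rewrite -ltNge => h2.
by rewrite ler_distl; apply/andP; split; [lra|exact: ltW].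
Qed.

(** The sets [B r] are pointwise limits along an ultrafilter and are fixed first; then [beta r] is
    the limit of the values of [B r]. On a window of length [N] only finitely many conditions are
    imposed, so they hold together on a set of [U], which meets every tail. *)
Lemma limit_histories (K : nat) (T : nat -> seq (seq nat)) (v : nat -> pred nat -> R)
    (eps : R) : (forall l A, `|v l A| <= 1) -> 0 < eps ->
  exists (B : nat -> pred nat) (beta : nat -> R), forall N l0, exists l, [/\ (l0 < l)%N,
    forall r k, (r < K)%N -> (k < N)%N -> (k \in nth [::] (T l) r) = B r k &
    forall r, (r < K)%N -> `|v l (B r) - beta r| <= eps].
Proof.
move=> v1 e0.
have [U [UU sU]] := ultraFilterLemma eventually_filter.
pose B r : pred nat := fun k => `[< U [set l | k \in nth [::] (T l) r] >].
have hB r k : U [set l | (k \in nth [::] (T l) r) = B r k].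
  have [h|h] := in_ultra_setVsetC [set l | k \in nth [::] (T l) r] UU.
    by apply: filterS (h) => l /= ->; apply/esym/asboolP.
  apply: filterS (h) => l /= /negP/negbTE ->; apply/esym/negbTE/negP => /asboolP h'.
  by have [l' []] := filter_ex (filterI h h').
have /choice[beta hbeta] : forall r, exists b, U [set l | `|v l (B r) - b| <= eps].
  by move=> r; apply: ultra_limit => //.
exists B, beta => N l0.
have h1 : U [set l | forall (r : 'I_K) (k : 'I_N), (val k \in nth [::] (T l) r) = B r k].
  by apply: filter_forall => r; apply: filter_forall => k; exact: hB.
have h2 : U [set l | forall r : 'I_K, `|v l (B r) - beta r| <= eps].
  by apply: filter_forall => r; exact: hbeta.
have h3 : U [set l | (l0 < l)%N] by apply: sU; exists l0.+1.
have [l [l0l [hl1 hl2]]] := filter_ex (filterI h3 (filterI h1 h2)).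
exists l; split=> // [r k rK kN|r rK].
  exact: (hl1 (Ordinal rK) (Ordinal kN)).
exact: (hl2 (Ordinal rK)).
Qed.

End LimitHistories.

(** * Unit vectors with uniformly small segments *)

Section SmallSeg.
Variable R : realType.
Notation X := (jt R).
Notation kappa := (kappa R).

Lemma history_count (x : X) (S : nat) (eps : R) (ts : seq (seq nat)) : `|x| <= 1 ->
  0 < eps -> (forall k, (k < S)%N -> x k = 0) -> uniq ts ->
  (forall t, t \in ts -> exists2 s,
    eps < `|seg_eval s x| & below (seg_set s) (start (seg_set s) S) = t) ->
  (size ts)%:R <= (eps ^+ 2)^-1.
Proof.
move=> x1 e0 xS uts hts.
pose t (i : 'I_(size ts)) := nth [::] ts i.
have {hts} hts i : exists s, eps < `|seg_eval s x| /\ below (seg_set s) (start (seg_set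
  s) S) = t i.
  by have [|s h1 h2] := hts (t i); [exact: mem_nth|exists s].
have [g hg] := choice hts.
(* Cutting below [S] keeps the values, as [x] vanishes there, and moves all common points beyond
   [S], where [eq_colour_back] separates different histories. *)
pose g' i := Seg (seg_set (g i)) (maxn S (seg_lo (g i))) (seg_hi (g i)).
have cg : compat g'.
  move=> i j n ij; rewrite /seg_supp /= => /andP[/andP[Sn _] _] _; apply/eqP => e.
  have Sn' : (S <= n)%N by apply: leq_trans Sn; exact: leq_maxl.
  have := eq_colour_back Sn' e.
  have [_ ->] := hg i; have [_ ->] := hg j; rewrite /t => E.
  by move/eqP: ij; apply; apply/val_inj/eqP;
  rewrite -(nth_uniq [::] (ltn_ord i) (ltn_ord j) uts) E.
have sg i : seg_eval (g' i) x = seg_eval (g i) x.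
  apply: eq_bigr => k _ /=; case: (ltnP k S) => kS; first by rewrite xS// !mulr0.
  by congr (_ * _); rewrite /seg_coef /seg_supp /= geq_max kS.
have h1 : fam_sq (Family cg) x <= 1.
  by apply: le_trans (fam_sq_norm _ _) _; rewrite expr_le1.
rewrite -[leRHS]mul1r ler_pdivlMr ?exprn_gt0//; apply: le_trans h1.
rewrite /fam_sq /= -[X in X%:R * _]card_ord mulr_natl -sumr_const; apply: ler_sum => i _.
by rewrite sg -[leRHS]real_normK ?num_real// ler_sqr ?nnegrE ?(ltW e0)//;
have [/ltW] := hg i.
Qed.

(** Together with [colour_block_l1] this yields the sparseness of colours: small colours are
    suppressed by the flatness of [x], large ones by their coefficient. *)
Lemma colour_block_le (j : nat) (s : segment) (E : nat) (x : X) (mu : R) :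
  0 <= mu -> (forall k, `|x k| <= mu) -> `|colour_eval j s E x| <= (block_size j)%:R * mu.
Proof.
move=> mu0 hmu; have [h _] := @colour_bound R (solo s) j E x mu (\sum_(0 <=
  k < E) `|x k|) mu0 hmu (lexx _).
apply: le_trans (ler_norm_sum _ _ _) _.
apply: le_trans (_ : \sum_(0 <= k < E) (seg_set s k && (colour (seg_set s) k == j))%:R *
  mu <= _).
  apply: ler_sum => k _; rewrite normrM ler_pM//.
  rewrite /colour_coef /seg_supp /seg_colour; case: (_ <= k < _)%N => /=;
  last by rewrite normr0.
  by case: (_ && _); rewrite ?normr0// ger0_norm ?coef_ge0 ?coef_le1.
by rewrite -mulr_suml ler_wpM2r// -natr_sum ler_nat colour_card.
Qed.

Lemma colour_block_l1 (j : nat) (s : segment) (E : nat) (x : X) :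
  (forall k, `|x k| <= 1) -> `|colour_eval j s E x| <= coef R j * E%:R.
Proof.
move=> hx; apply: le_trans (ler_norm_sum _ _ _) _.
apply: le_trans (_ : \sum_(0 <= k < E) coef R j <= _); last first.
  by rewrite big_const_nat subn0 iter_addr_0 mulr_natr.
apply: ler_sum => k _; rewrite normrM -[leRHS]mulr1 ler_pM//.
by rewrite /colour_coef; case: ifP => _; rewrite ?normr0 ?coef_ge0// ger0_norm ?coef_ge0.
Qed.

Lemma nat_half_exp (s : nat) : s%:R * 2^-1 ^+ s <= 1 :> R.
Proof.
rewrite exprVn ler_pdivrMr ?exprn_gt0// mul1r -natrX ler_nat.
by apply: ltnW; exact: ltn_expl.
Qed.

Lemma block_size_homo j k : (j <= k)%N -> (block_size j <= block_size k)%N.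
Proof. by move=> jk; rewrite /block_size leq_exp2r// root_size_homo. Qed.

Variable Y : set X.
Hypothesis hY : Defs.subspace Y.
Hypothesis nfdY : ~ finite_dimensional Y.

Lemma small_seg (delta : R) s0 : 0 < delta ->
  exists v, [/\ Y v, `|v| = 1, forall k, (k < s0)%N -> v k = 0 &
    forall s, `|seg_eval s v| <= delta].
Proof.
(* The 10 is the bound 9 of [alt_sum_seg_le] plus the error 1 from replacing [x] by [z]; the norm
   [10 / delta] turns it into [delta]. *)
move=> d0; have [m m0 hm] := @large_square R (10 / delta) (divr_ge0 (ler0n _ _) (ltW d0)).
pose N := (m ^ 2)%N; pose eps : R := (2 * N%:R)^-1.
have N1 : (1 : R) <= N%:R by rewrite ler1n expn_gt0 m0.
have e0 : 0 < eps by rewrite invr_gt0 mulr_gt0// (lt_le_trans ltr01).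
have [J hJ] := half_exp_small e0.
have nn0 s : (0 : R) < (block_size (s + J))%:R by rewrite ltr0n block_size_gt0.
(* At this flatness every colour up to [s + J] has value at most [eps] on the block; [J] absorbs the
   coefficients of the colours beyond it. *)
have flat s : exists z, [/\ Y z, `|z| = 1, forall k, (k < s)%N -> z k = 0 &
    forall k, `|z k| <= eps / (block_size (s + J))%:R].
  by apply: flat_unit => //; exact: divr_gt0.
have [s [z [s0E hz]]] := chain (fun=> e0) flat s0.
pose x l := proj (s l) (s l.+1) (z l).
have ss l : (s l <= s l.+1)%N by have [/ltnW] := hz l.
have xs i k : ~~ (s i <= k < s i.+1)%N -> x i k = 0 by rewrite projE => /negbTE ->.
have x1 l : `|x l| <= 1 by apply: le_trans (norm_proj _ _ _) _; have [_ _ ->] := hz l.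
have xflat l k : `|x l k| <= eps / (block_size (s l + J))%:R.
  rewrite projE; case: ifP => _; last by rewrite normr0 divr_ge0 ?ltW.
  by have [_ _ _ _ [h _]] := hz l.
pose K := Num.bound (eps ^+ 2)^-1.
have cover l : exists T : seq (seq nat), (size T <= K)%N /\ forall t,
    (exists2 sg, eps < `|seg_eval sg (x l)| & below (seg_set sg) (start (seg_set sg) (s
      l)) = t) -> t \in T.
  apply: cover_of_uniq_bound => ts uts hts.
  have : (size ts)%:R < K%:R :> R.
    apply: le_lt_trans (archi_boundP _); last by rewrite invr_ge0 exprn_ge0// ltW.
    apply: (@history_count (x l) (s l)) => // k kl.
    by rewrite xs// leqNgt kl.
  by rewrite ltr_nat => /ltnW.
have [T hT] := choice cover.
have [B [beta hBb]] := @limit_histories R K T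
  (fun l A => seg_eval (Seg A 0 (s l.+1)) (x l)) eps
  (fun l A => le_trans (seg_le _ _) (x1 l)) e0.
(* The next index has histories that already equal their limits up to the end of the current block,
   as the alternating sum estimate demands. *)
have /choice[g hg] : forall l, exists l', [/\ (l < l')%N,
    forall r k, (r < K)%N -> (k < s l.+1)%N -> (k \in nth [::] (T l') r) = B r k &
    forall r, (r < K)%N -> `|seg_eval (Seg (B r) 0 (s l'.+1)) (x l') - beta r| <= eps].
  by move=> l; exact: hBb.
pose li i := iter i g (g 0%N).
have li_lt i : (li i < li i.+1)%N by have [] := hg (li i).
have li_homo i j : (i < j)%N -> (li i < li j)%N.
  elim: j => // j IH; rewrite ltnS leq_eqVlt => /orP[/eqP->//|/IH h].
  exact: ltn_trans h (li_lt j).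
have s_homo i j : (i <= j)%N -> (s i <= s j)%N.
  exact: (@S_homo s (fun l => s l.+1) ss (fun l => leqnn _)).
have li_beta i r : (r < K)%N ->
    `|seg_eval (Seg (B r) 0 (s (li i).+1)) (x (li i)) - beta r| <= eps.
  by case: i => [|i]; [have [_ _ h] := hg 0%N|have [_ _ h] := hg (li i)]; exact: h.
have xsi i k : ~~ (s (li i) <= k < s (li i).+1)%N -> x (li i) k = 0 by exact: xs.
have ssi i : (s (li i) <= s (li i).+1)%N by exact: ss.
have esi i : (s (li i).+1 <= s (li i.+1))%N by apply: s_homo.
have segv sg : `|seg_eval sg (\sum_(0 <= i < N) (-1) ^+ i *: x (li i))| <= 9.
  apply: (@alt_sum_seg_le R (fun i => x (li i)) (fun i => s (li i))
    (fun i => s (li i).+1) eps K (fun i => T (li i)) B beta (ltW e0)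
    (fun i => x1 (li i)) xsi ssi esi).
  - move=> i sg' h; have [h1 h2] := hT (li i).
    have h3 : below (seg_set sg') (start (seg_set sg') (s (li i))) \in T (li i) by apply:
      h2; exists sg'.
    exists (index (below (seg_set sg') (start (seg_set sg') (s (li i)))) (T (li i))).
      by apply: leq_trans h1; rewrite index_mem.
    by rewrite nth_index.
  - move=> i i' r k ii' rK kE; case: i' ii' => // i' ii'.
    have [_ h _] := hg (li i'); apply: h => //.
    apply: leq_trans kE _; apply: s_homo; rewrite ltnS.
    by move: ii'; rewrite ltnS leq_eqVlt => /orP[/eqP->//|/li_homo/ltnW].
  - by move=> i r rK; exact: li_beta.
  - move=> j.
    have sl l : (l <= s l)%N.
      by elim: l => // l IH; apply: leq_ltn_trans IH _; have [] := hz l.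
    have hlarge l : (j <= s l + J)%N ->
      forall sg', `|colour_eval j sg' (s l.+1) (x l)| <= eps.
      move=> jl sg'.
      apply: le_trans (colour_block_le _ _ _ _ (xflat l)) _; first by rewrite divr_ge0 ?ltW.
      by rewrite mulrCA ler_piMr ?(ltW e0)// ler_pdivrMr// mul1r ler_nat block_size_homo.
    have hsmall l : (s l.+1 + J <= j)%N ->
      forall sg', `|colour_eval j sg' (s l.+1) (x l)| <= eps.
      move=> jl sg'; apply: le_trans (colour_block_l1 _ _ _ _) _.
        by move=> k; apply: le_trans (coord_le _ _) (x1 l).
      apply: le_trans hJ.
      apply: le_trans (_ : 2^-1 ^+ (s l.+1 + J) * (s l.+1)%:R <= _).
        rewrite ler_wpM2r//; apply: le_trans (coef_le R j) _.
        by apply: half_exp_le; exact: leqW.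
      rewrite exprD mulrAC -[leRHS]mul1r ler_wpM2r ?exprn_ge0// mulrC.
      exact: nat_half_exp.
    have exl : exists l, (j <= s (li l) + J)%N.
      exists j; rewrite (leq_trans (sl j))//; apply: leq_trans (leq_addr _ _).
      apply: s_homo; elim: j {hlarge hsmall} => // j IH.
      exact: leq_ltn_trans IH (li_lt j).
    (* From [l0] on the colour [j] is suppressed by flatness. If [i.+1 < l0], block [i] ends so
       early that the coefficient of [j] suffices. The predecessor of [l0] is the exception. *)
    pose l0 := ex_minn exl; exists l0.-1 => i sg' il0.
    rewrite /l0 in il0; move: il0; case: ex_minnP => l hl hmin il0.
    case: (leqP l i) => li'.
      apply: hlarge; apply: leq_trans hl _; rewrite leq_add2r; apply: s_homo.
      by move: li'; rewrite leq_eqVlt => /orP[/eqP->//|/li_homo/ltnW].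
    apply: hsmall.
    have i1l : (i.+1 < l)%N.
      rewrite ltn_neqAle li' andbT; apply/eqP => e; apply: il0; by rewrite -e.
    have : ~~ (j <= s (li i.+1) + J)%N.
      by apply/negP => /hmin; rewrite leqNgt i1l.
    rewrite -ltnNge => /ltnW; apply: leq_trans; rewrite leq_add2r; exact: esi.
  - by rewrite /eps invfM mulrCA divff ?mulr1 ?invf_le1 ?ler1n// gt_eqF// (lt_le_trans
    ltr01).
  - by rewrite /eps invf_le1 ?mulr_gt0 ?(lt_le_trans ltr01)//; nra.
have [h1 h2] := @block_average R (fun i => x (li i)) (fun i => z (li i)) (fun i => s (li i))
  (fun i => s (li i).+1) (fun i => (-1) ^+ i) m xsi ssi esi m0
  (fun i => let: And5 _ _ h _ _ := hz (li i) in h)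
  (fun i => etrans (normrX i (-1)) (etrans (congr1 (fun a =>
    a ^+ i) (normrN1 R)) (expr1n _ i)))
  (fun i => let: And5 _ _ _ _ (conj _ h) := hz (li i) in h).
set v := \sum_(0 <= i < m ^ 2) (-1) ^+ i *: z (li i) in h1 h2.
set w := \sum_(0 <= i < m ^ 2) (-1) ^+ i *: x (li i) in h1.
have nv : 0 < `|v| by apply: lt_le_trans (le_trans hm h2); rewrite divr_gt0.
exists (`|v|^-1 *: v); split.
- apply: subspaceZ => //; apply: subspace_sum => // i; by have [] := hz (li i).
- by rewrite normrZ ger0_norm ?invr_ge0// mulVf// gt_eqF.
- move=> k ks; rewrite jtZ jt_sum big1 ?mulr0// => i _.
  rewrite jtZ; have [_ _ _ -> //] := hz (li i); first by rewrite mulr0.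
  by apply: leq_trans ks _; rewrite -s0E; exact: s_homo.
- move=> sg.
  have sevB (a b : X) : seg_eval sg (a - b : X) = seg_eval sg a - seg_eval sg b.
    exact: (normsetB a b (normset_seg R sg)).
  have -> : seg_eval sg (`|v|^-1 *: v : X) = `|v|^-1 * seg_eval sg v.
    exact: (normsetZ _ v (normset_seg R sg)).
  rewrite normrM ger0_norm ?invr_ge0// ler_pdivrMl// mulrC.
  have : `|seg_eval sg v| <= 10.
    have := seg_le sg (v - w); rewrite sevB => h3.
    have := ler_normD (seg_eval sg v - seg_eval sg w) (seg_eval sg w); rewrite subrK.
    have := segv sg; rewrite -/w; lra.
  move=> /le_trans; apply; rewrite mulrC -ler_pdivrMr//.
  exact: le_trans hm h2.
Qed.

End SmallSeg.

(** * The l2 norm and operators on l2 *)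

Section Ell2Norm.
Variable R : realType.

Definition ell2_fun (u : ell2 R) : nat -> R := (u : LfunType _ _).

Lemma ell2_funD (a : R) (u v : ell2 R) k :
  ell2_fun (a *: u + v) k = a * ell2_fun u k + ell2_fun v k.
Proof. by []. Qed.

Lemma ell2_norm_ge0 (u : ell2 R) : 0 <= ell2_norm u.
Proof. by rewrite fine_ge0// Lnorm_ge0. Qed.

Lemma ell2_norm_cvg (u : ell2 R) :
  (fun n => \sum_(0 <= k < n) ell2_fun u k ^+ 2 : R^o) @ \oo --> ell2_norm u ^+ 2.
Proof.
pose f k : \bar R := (ell2_fun u k ^+ 2)%:E.
have f0 k : (0 <= f k)%E by rewrite lee_fin sqr_ge0.
have e : ('N[@counting nat R]_2%:E [EFin \o (u : LfunType _ _)] =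
  sqrte (\sum_(k <oo) f k))%E.
  rewrite Lnorm_counting// poweR12_sqrt; last by apply: nneseries_ge0 => k _ _;
  exact: poweR_ge0.
  congr sqrte; apply: eq_eseriesr => k _.
  by rewrite /f /= (@powR_mulrn _ _ 2)// real_normK ?num_real.
have S0 : (0 <= \sum_(k <oo) f k)%E by apply: nneseries_ge0.
(* A divergent series would make the norm infinite, against membership in [LfunType]. *)
have Sfin : (\sum_(k <oo) f k)%E \is a fin_num.
  rewrite ge0_fin_numE// ltNge leye_eq; apply/negP => /eqP Sy.
  have := @Lfunction_finite _ _ _ _ _ (lee1n 2) (u : LfunType _ _); rewrite /finite_norm.
  by rewrite [X in (X < _)%E](_ : _ = +oo%E)// e Sy.
have -> : ell2_norm u ^+ 2 = fine (\sum_(k <oo) f k)%E.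
  rewrite /ell2_norm e -(fineK Sfin) /= sqr_sqrtr//.
  by rewrite fine_ge0.
have h : (fun n => (\sum_(0 <= k < n) f k)%E) @ \oo --> (\sum_(k <oo) f k)%E.
  exact: is_cvg_nneseries.
rewrite -(fineK Sfin) in h.
have -> : (fun n => \sum_(0 <= k < n) ell2_fun u k ^+ 2 : R^o) =
    fine \o (fun n => (\sum_(0 <= k < n) f k)%E).
  by apply/funext => n /=; rewrite /f sumEFin.
exact: fine_cvg h.
Qed.

End Ell2Norm.

Section Ell2Operator.
Variable R : realType.
Notation X := (jt R).
Variables (z : nat -> X) (c C : R).
Hypothesis c0 : 0 < c.
Hypothesis C0 : 0 < C.
Hypothesis zle : forall (a : nat -> R) n A, 0 <= A ->
  \sum_(0 <= k < n) a k ^+ 2 <= A ^+ 2 ->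
  `|\sum_(0 <= k < n) a k *: z k| <= C * A.
Hypothesis zge : forall (a : nat -> R) n A, 0 <= A -> \sum_(0 <= k < n) a k ^+ 2 = A ^+ 2 ->
  c * A <= `|\sum_(0 <= k < n) a k *: z k|.

Definition ell2_op (u : ell2 R) : X :=
  limn (series (fun k => ell2_fun u k *: z k)).

Lemma ell2_op_cvg (u : ell2 R) :
  series (fun k => ell2_fun u k *: z k) @ \oo --> ell2_op u.
Proof.
apply: cauchy_cvg; apply/cauchy_exP => e e0.
pose s n := \sum_(0 <= k < n) ell2_fun u k ^+ 2.
have cs : (s : nat -> R^o) @ \oo --> ell2_norm u ^+ 2 by exact: ell2_norm_cvg.
pose d := e / (2 * C).
have d0 : 0 < d by rewrite divr_gt0// mulr_gt0.
have d2 : 0 < d ^+ 2 / 2 by rewrite divr_gt0// exprn_gt0.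
have /cvgrPdist_lt/(_ _ d2)[N _ hN] := cs.
exists (series (fun k => ell2_fun u k *: z k) N); exists N => // n /= Nn.
rewrite -ball_normE /= distrC.
(* Zero padding turns the piece from [N] to [n] into a sum from 0, the form [zle] speaks of. *)
pose a k := if (N <= k)%N then ell2_fun u k else 0.
have -> : series (fun k => ell2_fun u k *: z k) n - series (fun k =>
  ell2_fun u k *: z k) N =
    \sum_(0 <= k < n) a k *: z k.
  rewrite /series/= (big_cat_nat (n := N) (p := n))//= addrAC subrr add0r.
  rewrite [RHS](big_cat_nat (n := N) (p := n))//= [X in _ = X + _]big_nat.
  rewrite [X in _ = X + _]big1 ?add0r => [|k /andP[_ kN]].
    by apply: eq_big_nat => k /andP[Nk _]; rewrite /a Nk.
  by rewrite /a leqNgt kN scale0r.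
apply: (@le_lt_trans _ _ (C * d)); last first.
  rewrite (_ : C * d = e / 2) ?ltr_pdivrMr ?ltr_pMr ?ltr1n//.
  by rewrite /d; field; rewrite gt_eqF.
apply: zle; first exact: ltW.
have -> : \sum_(0 <= k < n) a k ^+ 2 = s n - s N.
  rewrite /s [in RHS](big_cat_nat (n := N) (p := n))//= addrAC subrr add0r.
  rewrite [LHS](big_cat_nat (n := N) (p := n))//= [X in X + _ = _]big_nat.
  rewrite [X in X + _ = _]big1 ?add0r => [|k /andP[_ kN]].
    by apply: eq_big_nat => k /andP[Nk _]; rewrite /a Nk.
  by rewrite /a leqNgt kN expr0n.
have h1 := hN n Nn; have h2 := hN N (leqnn _).
move: h1 h2; rewrite /= !ltr_norml => /andP[h1 h2] /andP[h3 h4].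
lra.
Qed.

Lemma ell2_op_linear : linear ell2_op.
Proof.
move=> a u v; apply/cvg_lim => //.
have -> : series (fun k => ell2_fun (a *: u + v) k *: z k) =
    (fun n => a *: series (fun k => ell2_fun u k *: z k) n +
       series (fun k => ell2_fun v k *: z k) n).
  apply/funext => n; rewrite /series /= scaler_sumr -big_split/=.
  apply: eq_bigr => k _; rewrite scalerA -scalerDl.
  by congr (_ *: _); exact: ell2_funD.
by apply: cvgD; [apply: cvgZr|]; exact: ell2_op_cvg.
Qed.

Lemma ell2_op_bounds (u : ell2 R) :
  c * ell2_norm u <= `|ell2_op u| <= C * ell2_norm u.
Proof.
have h : (fun n => `|series (fun k => ell2_fun u k *: z k) n|) @ \oo --> (`|ell2_op u|).
  exact: (cvg_norm (@ell2_op_cvg u)).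
have h2 := @ell2_norm_cvg R u.
pose s n := Num.sqrt (\sum_(0 <= k < n) ell2_fun u k ^+ 2).
have s0 n : 0 <= \sum_(0 <= k < n) ell2_fun u k ^+ 2.
  by apply: sumr_ge0 => k _; exact: sqr_ge0.
have hs : s @ \oo --> ell2_norm u.
  rewrite -[ell2_norm u]ger0_norm ?ell2_norm_ge0// -sqrtr_sqr.
  by apply: continuous_cvg => //; exact: sqrt_continuous.
apply/andP; split.
  have h3 : (fun n => c * s n) @ \oo --> (c * ell2_norm u).
    by apply: cvgMr.
  apply: (ler_cvg_to h3 h); apply: nearW => n.
  by apply: zge; [exact: sqrtr_ge0|rewrite sqr_sqrtr].
have h3 : (fun n => C * s n) @ \oo --> (C * ell2_norm u).
  by apply: cvgMr.
apply: (ler_cvg_to h h3); apply: nearW => n.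
by apply: zle; [exact: sqrtr_ge0|rewrite sqr_sqrtr].
Qed.

Lemma ell2_op_isomorphic : Defs.subspace (range ell2_op) /\ isomorphic_ell2 (range ell2_op).
Proof.
pose T : {linear ell2 R -> X} := HB.pack ell2_op
  (GRing.isLinear.Build R (ell2 R) X _ ell2_op ell2_op_linear).
split.
  split; first by rewrite inE; exists 0 => //; exact: (raddf0 T).
  move=> a x y; rewrite !inE => -[u _ <-] [v _ <-]; exists (a *: u + v) => //.
  exact: ell2_op_linear.
exists T; split=> //; exists c, C; split=> // u; exact: ell2_op_bounds.
Qed.

Lemma ell2_op_range (Y : set X) : Defs.subspace Y -> closed Y -> (forall k, Y (z k)) ->
  range ell2_op `<=` Y.
Proof.
move=> hY cY Yz _ [u _ <-].
apply: (@closed_cvg _ _ _ _ _ Y cY _ _ (@ell2_op_cvg u)); apply: nearW => n.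
exact: subspace_sum.
Qed.

End Ell2Operator.

(** * Block sequences equivalent to the l2 basis *)

Section Saturation.
Variable R : realType.
Notation X := (jt R).
Notation kappa := (kappa R).

(* The values of a compatible family on the blocks are almost orthogonal:
   bounded in l_1 on the earlier blocks, tiny in l_oo on the later one. *)
Lemma upper_blocks (x : nat -> X) (S E : nat -> nat) (a : nat -> R) (A : R) n :
  (forall i k, ~~ (S i <= k < E i)%N -> x i k = 0) ->
  (forall i, (S i <= E i)%N) -> (forall i, (E i <= S i.+1)%N) ->
  (forall i, `|x i| <= 1) -> (forall i, (i <= S i)%N) ->
  (forall i s, `|seg_eval s (x i)| <= 2^-1 ^+ (2 * (S i).+1)) ->
  0 <= A -> \sum_(0 <= i < n) a i ^+ 2 <= A ^+ 2 ->
  `|\sum_(0 <= i < n) a i *: x i| <= 2 * A.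
Proof.
move=> xs SE ES x1 iS small A0 hA.
have aA i : (i < n)%N -> `|a i| <= A.
  move=> iN; rewrite -ler_sqr ?nnegrE// real_normK ?num_real//; apply: le_trans hA.
  rewrite (bigD1_seq i) ?mem_index_iota ?iota_uniq//= lerDl.
  by apply: sumr_ge0 => j _; exact: sqr_ge0.
have h2 k : (0 : R) <= 2^-1 ^+ k by rewrite exprn_ge0.
(* Induction on the blocks: the block [m] adds its square [a m ^+ 2] and a cross term of at most
   [A ^+ 2 * 2^-(m+1)]. The total is at most [2 A^2], below the square of [2 A]. *)
have famle F m : (m <= n)%N -> fam_sq F (\sum_(0 <= i < m) a i *: x i : X) <=
    \sum_(0 <= i < m) a i ^+ 2 + A ^+ 2 * \sum_(0 <= i < m) 2^-1 ^+ i.+1.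
  elim: m => [|m IH] mn.
    rewrite !big_geq// mulr0 addr0 /fam_sq big1// => i _.
    by rewrite (normset0 (normset_seg R (fam_seg F i))) expr0n.
  set u : X := \sum_(0 <= i < m) a i *: x i in IH.
  have -> : \sum_(0 <= i < m.+1) a i *: x i = a m *: x m + u :> X.
    by rewrite big_nat_recr//= addrC.
  have usupp k : (S m <= k)%N -> u k = 0.
    move=> Sk; rewrite /u jt_sum big_nat big1// => i /andP[_ iN].
    rewrite jtZ xs ?mulr0// negb_and -!ltnNge ltnS; apply/orP; right.
    exact: leq_trans (ES_lt SE ES iN) Sk.
  pose ip := \sum_i seg_eval (fam_seg F i) u * seg_eval (fam_seg F i) (x m).
  have -> : fam_sq F (a m *: x m + u : X) =
    fam_sq F u + a m ^+ 2 * fam_sq F (x m) + 2 * (a m * ip).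
    rewrite /fam_sq /ip !mulr_sumr -!big_split/=; apply: eq_bigr => i _.
    by rewrite (seg_eval_lin (fam_seg F i) (a m) (x m) u : seg_eval _ (jtval (a m *: x m
      + u)) = _); ring.
  (* [u] lives on [S m] positions with coordinates at most [A] in absolute value. Half of the
     exponent [2 * (S m).+1] will absorb the factor [S m]. *)
  have hip : `|ip| <= 2^-1 ^+ (2 * (S m).+1) * ((S m)%:R * A).
    apply: le_trans (ler_norm_sum _ _ _) _.
    apply: le_trans (_ : \sum_i 2^-1 ^+ (2 * (S m).+1) * `|seg_eval (fam_seg F i) u| <= _).
      by apply: ler_sum => i _; rewrite normrM mulrC ler_wpM2r// small.
    rewrite -mulr_sumr ler_wpM2l//; apply: le_trans (fam_sq_l1 F usupp) _.
    apply: le_trans (_ : \sum_(0 <= k < S m) A <= _).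
      apply: ler_sum => k _; apply: (block_coord_le k xs SE ES x1 A0) => i im.
      by apply: aA; exact: ltn_trans im mn.
    by rewrite big_const_nat subn0 iter_addr_0 -[leLHS]mulr_natl.
  have hcross : 2 * (a m * ip) <= A ^+ 2 * 2^-1 ^+ m.+1.
    apply: le_trans (ler_norm _) _; rewrite !normrM (ger0_norm (ler0n R 2)).
    apply: le_trans (_ : 2 * (A * (2^-1 ^+ (2 * (S m).+1) * ((S m)%:R * A))) <= _).
      by rewrite ler_wpM2l// ler_pM// aA.
    have -> : 2 * (A * (2^-1 ^+ (2 * (S m).+1) * ((S m)%:R * A))) =
        A ^+ 2 * (2^-1 ^+ (S m).+1 * ((S m)%:R * 2^-1 ^+ (S m))).
      by rewrite mul2n -addnn exprD !exprS; field.
    rewrite ler_wpM2l ?sqr_ge0// -[leRHS]mulr1 ler_pM ?nat_half_exp ?mulr_ge0//.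
    by apply: half_exp_le; rewrite ltnS.
  have hx : a m ^+ 2 * fam_sq F (x m) <= a m ^+ 2.
    rewrite ler_piMr ?sqr_ge0//; apply: le_trans (fam_sq_norm _ _) _.
    by rewrite expr_le1.
  have := IH (ltnW mn); rewrite !big_nat_recr//= mulrDr; lra.
have A2 : A ^+ 2 <= (2 * A) ^+ 2 by rewrite exprMn ler_peMl ?sqr_ge0// expr2; lra.
rewrite -ler_sqr ?nnegrE ?mulr_ge0//; apply: norm_sqr_le => [k|F].
  apply: le_trans A2; rewrite ler_sqr ?nnegrE//.
  exact: (block_coord_le k xs SE ES x1 A0 aA).
apply: le_trans (famle F n (leqnn n)) _.
have : A ^+ 2 * \sum_(0 <= i < n) 2^-1 ^+ i.+1 <= A ^+ 2.
  by rewrite ler_piMr ?sqr_ge0// sum_half_exp_le1.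
rewrite exprMn; have := sqr_ge0 A; lra.
Qed.

Lemma jt_ell2_saturated : ell2_saturated X.
Proof.
move=> Y hY cY nfdY.
have k0 := @kappa_gt0 R; have k1 := @kappa_le1 R.
(* The perturbations sum to at most [kappa / 4] times the l2 norm of the coefficients. The blocks
   keep norm at least 3/4, so the lower constant is [3 kappa / 4 - kappa / 4 = kappa / 2], and the
   upper one is at most [2 + kappa / 4 <= 3]. *)
pose eta s : R := kappa / 4 * 2^-1 ^+ s.+1.
have eta0 s : 0 < eta s by rewrite mulr_gt0 ?divr_gt0// exprn_gt0.
have sm s : exists z, [/\ Y z, `|z| = 1, forall k, (k < s)%N -> z k = 0 &
    forall sg, `|seg_eval sg z| <= 2^-1 ^+ (2 * s.+1)].
  by apply: small_seg => //; rewrite exprn_gt0.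
have [s [z [_ hz]]] := chain eta0 sm 0%N.
pose x l := proj (s l) (s l.+1) (z l).
have ss l : (s l <= s l.+1)%N by have [/ltnW] := hz l.
have sss l : (s l.+1 <= s l.+1)%N by [].
have xs i k : ~~ (s i <= k < s i.+1)%N -> x i k = 0 by rewrite projE => /negbTE ->.
have z1 l : `|z l| = 1 by have [] := hz l.
have x1 l : `|x l| <= 1 by apply: le_trans (norm_proj _ _ _) _; rewrite z1.
have sl l : (l <= s l)%N.
  by elim: l => // l IH; apply: leq_ltn_trans IH _; have [] := hz l.
have xsmall i sg : `|seg_eval sg (x i)| <= 2^-1 ^+ (2 * (s i).+1).
  by rewrite -seg_eval_restr; have [_ _ _ _ [h _]] := hz i; exact: h.
have zx l : `|z l - x l| <= kappa / 4 * 2^-1 ^+ l.+1.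
  have [_ _ _ _ [_ h]] := hz l; apply: le_trans h _.
  by rewrite /eta ler_wpM2l ?divr_ge0 ?(ltW k0)//; apply: half_exp_le; rewrite ltnS.
have pert a n A : 0 <= A -> \sum_(0 <= k < n) a k ^+ 2 <= A ^+ 2 ->
    `|\sum_(0 <= k < n) a k *: z k - \sum_(0 <= k < n) a k *: x k| <= kappa / 4 * A.
  move=> A0 hA; rewrite -sumrB; apply: le_trans (ler_norm_sum _ _ _) _.
  apply: le_trans (_ : \sum_(0 <= k < n) (kappa / 4 * A) * 2^-1 ^+ k.+1 <= _); last first.
    by rewrite -mulr_sumr ler_piMr ?sum_half_exp_le1// mulr_ge0 ?divr_ge0 ?(ltW k0).
  apply: ler_sum_nat => k /andP[_ kn]; rewrite -scalerBr normrZ.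
  rewrite mulrAC mulrC ler_pM//.
  rewrite -ler_sqr ?nnegrE// real_normK ?num_real//; apply: le_trans hA.
  rewrite (bigD1_seq k) ?mem_index_iota ?iota_uniq//= lerDl.
  by apply: sumr_ge0 => j _; exact: sqr_ge0.
have zle a n A : 0 <= A -> \sum_(0 <= k < n) a k ^+ 2 <= A ^+ 2 ->
    `|\sum_(0 <= k < n) a k *: z k| <= 3 * A.
  move=> A0 hA; have h1 := pert a n A A0 hA.
  have h2 := upper_blocks xs ss sss x1 sl xsmall A0 hA.
  have := ler_normD (\sum_(0 <= k < n) a k *: z k - \sum_(0 <= k < n) a k *: x k)
    (\sum_(0 <= k < n) a k *: x k).
  rewrite subrK; nra.
have x3 l : 3 / 4 <= `|x l|.
  have h1 := zx l; have := ler_normD (z l - x l) (x l); rewrite subrK z1 => h2.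
  have h3 : kappa / 4 * 2^-1 ^+ l.+1 <= 1 / 4 * 1.
    rewrite ler_pM ?exprn_ge0 ?divr_ge0 ?(ltW k0)//.
      by rewrite ler_wpM2r ?invr_ge0.
    by have := @half_exp_le R 0 l.+1 (leq0n _); rewrite expr0.
  lra.
have zge a n A : 0 <= A -> \sum_(0 <= k < n) a k ^+ 2 = A ^+ 2 ->
    kappa / 2 * A <= `|\sum_(0 <= k < n) a k *: z k|.
  move=> A0 hA; have hA' : \sum_(0 <= k < n) a k ^+ 2 <= A ^+ 2 by rewrite hA.
  have h1 := pert a n A A0 hA'.
  have h2 := lower_blocks a n xs ss sss.
  have h3 : kappa * (3 / 4) * A <= `|\sum_(0 <= k < n) a k *: x k|.
    rewrite -ler_sqr ?nnegrE ?mulr_ge0 ?(ltW k0) ?invr_ge0//; apply: le_trans h2.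
    have -> : (kappa * (3 / 4) * A) ^+ 2 = kappa ^+ 2 * ((3 / 4) ^+ 2 * A ^+ 2) by field.
    rewrite ler_wpM2l ?sqr_ge0// -hA mulr_sumr.
    apply: ler_sum => k _; rewrite mulrC ler_wpM2l ?sqr_ge0//.
    by rewrite ler_sqr ?nnegrE ?divr_ge0.
  have := ler_normB (\sum_(0 <= k < n) a k *: z k)
    (\sum_(0 <= k < n) a k *: z k - \sum_(0 <= k < n) a k *: x k).
  rewrite subKr; lra.
have c0 : 0 < kappa / 2 by rewrite divr_gt0.
exists (range (ell2_op z)).
  by apply: (ell2_op_range (ltr0Sn R 2) zle) => // k; have [] := hz k.
exact: (ell2_op_isomorphic c0 (ltr0Sn R 2) zle zge).
Qed.

End Saturation.

Theorem proposition0p2 (R : realType) :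
  exists (X : completeNormedModType R) (e : nat -> X),
    schauder_basis e /\ boundedly_complete e /\
    ell2_saturated X /\
    ((forall n, `|e n| = 1) /\ weak_cvg e 0 /\
     forall M : set nat, infinite_set M ->
       james_tree_property e (closed_span (e @` M))).
Proof.
exists (jt R), (@unit_vec R); split; first exact: unit_vec_schauder.
split; first exact: unit_vec_boundedly_complete.
split; first exact: jt_ell2_saturated.
split; first exact: norm_unit_vec.
by split; [exact: unit_vec_weak_null|exact: unit_vec_james_tree].
Qed.
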